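(* Let $P_i=(x_i,y_i,z_i)$, $i=1,\dots,8$, where $x_1,y_1,z_1,\dots,x_8,y_8,z_8$ are $24$ unknowns over $\mathbb{Q}$, and let $R=\mathbb{Q}[x_1,y_1,z_1,\dots,x_8,y_8,z_8]$. Let $[123]$ be the determinant of the $3\times 3$ matrix with rows $P_1,P_2,P_3$, and put \begin{align*} C_x &= C(P_1, P_4, P_5, P_6, P_7, P_8), & D_x &= D(P_1; P_2, P_3, P_4, P_5, P_6, P_7, P_8),\\ C_y &= C(P_2, P_4, P_5, P_6, P_7, P_8), & D_y &= D(P_2; P_3, P_1, P_4, P_5, P_6, P_7, P_8),\\ C_z &= C(P_3, P_4, P_5, P_6, P_7, P_8), & D_z &= D(P_3; P_1, P_2, P_4, P_5, P_6, P_7, P_8). \end{align*} Consider the vector $$V \;=\; \frac{1}{[123]}\cdot\bigl(C_xD_yD_z \cdot P_1 + D_xC_yD_z \cdot P_2 + D_xD_yC_z \cdot P_3\bigr).$$ Then: (1) $V$ is a vector of homogeneous coordinates for the Cayley-Bacharach point $P_9$ of $P_1,\dots,P_8$. (2) The three coordinates of $V$ are polynomials in $R$, homogeneous of multidegree $(8,8,8,8,8,8,8,8)$ with respect to the $\mathbb{Z}^8$-grading $\deg x_i=\deg y_i=\deg z_i=\mathbf{e}_i$. (3) The formula is invariant under the symmetric group $S_8$ permuting $P_1,\dots,P_8$: each permutation maps $V$ to $\pm V$, hence to the same projective point. (4) The formula contains no extraneous factor: the three coordinates of $V$ have greatest common divisor $1$ in $R$.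
   Context: Cayley-Bacharach point. If $P_1,\dots,P_8$ are eight distinct points in $\mathbb{P}^2$ over a field (here: the field of rational functions in the $24$ unknowns over $\mathbb{Q}$, with the $P_i$ the generic points), no three on a line and no six on a conic, then the cubic forms vanishing at $P_1,\dots,P_8$ form a $2$-dimensional vector space. Any two linearly independent such cubics meet in nine points counted with multiplicity (over an algebraic closure), eight of which are $P_1,\dots,P_8$; the remaining ninth point does not depend on the choice of the two cubics, and it is called the Cayley-Bacharach point $P_9$ of $P_1,\dots,P_8$. Polynomials $C$ and $D$. For vectors $Q_i=(x_i,y_i,z_i)$, let $$C(Q_1,\dots,Q_6)=\det\big(x_i^2,\; x_iy_i,\; x_iz_i,\; y_i^2,\; y_iz_i,\; z_i^2\big)_{i=1,\dots,6},$$ the determinant of the $6\times 6$ matrix whose $i$-th row is displayed. Let $D(Q_1;Q_2,\dots,Q_8)$ be the determinant of the $10\times10$ matrix whose first seven rows are, for $i=2,3,\dots,8$ in this order, $$(x_i^3,\; x_i^2y_i,\; x_i^2z_i,\; x_iy_i^2,\; x_iy_iz_i,\; x_iz_i^2,\; y_i^3,\; y_i^2z_i,\; y_iz_i^2,\; z_i^3),$$ and whose last three rows are \begin{align*} &(3x_1^2,\; 2x_1y_1,\; 2x_1z_1,\; y_1^2,\; y_1z_1,\; z_1^2,\; 0,\; 0,\; 0,\; 0),\\ &(0,\; x_1^2,\; 0,\; 2x_1y_1,\; x_1z_1,\; 0,\; 3y_1^2,\; 2y_1z_1,\; z_1^2,\; 0),\\ &(0,\; 0,\; x_1^2,\; 0,\;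 x_1y_1,\; 2x_1z_1,\; 0,\; y_1^2,\; 2y_1z_1,\; 3z_1^2). \end{align*} For other arguments, such as $C(P_1,P_4,P_5,P_6,P_7,P_8)$ or $D(P_2;P_3,P_1,P_4,\dots,P_8)$, substitute the listed vectors for $Q_1,Q_2,\dots$ in the listed order. *)

(* Defs.v *)
From HB Require Import structures.
From mathcomp Require Import all_boot all_order all_algebra all_fingroup.
From mathcomp Require Import fraction.
From mathcomp.multinomials Require Import mpoly.

Set Implicit Arguments.
Unset Strict Implicit.
Unset Printing Implicit Defensive.

Import GRing.Theory.
Local Open Scope ring_scope.

(* Points of P^2 over a field are given by nonzero row vectors of length 3;   *)
(* u and v are the same point iff (u == v)%MS.                                *)

Definition evalpt (R : comNzRingType) (F : {mpoly R[3]}) (Q : 'rV[R]_3) : R :=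
  F.@[fun j => Q 0 j].

Section Determinants.
Variable R : comNzRingType.
Implicit Types Q : 'rV[R]_3.

Definition bracket Q1 Q2 Q3 : R :=
  \det (\matrix_(i < 3) nth 0 [:: Q1; Q2; Q3] i).

Definition quadrics_row Q : 'rV[R]_6 :=
  let x := Q 0 0 in let y := Q 0 1 in let z := Q 0 2 in
  \row_(j < 6) [:: x ^+ 2; x * y; x * z; y ^+ 2; y * z; z ^+ 2]`_j.

Definition Cdet Q1 Q2 Q3 Q4 Q5 Q6 : R :=
  \det (\matrix_(i < 6)
    nth 0 [seq quadrics_row Q | Q <- [:: Q1; Q2; Q3; Q4; Q5; Q6]] i).

Definition cubics_row Q : 'rV[R]_10 :=
  let x := Q 0 0 in let y := Q 0 1 in let z := Q 0 2 in
  \row_(j < 10) [:: x ^+ 3; x ^+ 2 * y; x ^+ 2 * z; x * y ^+ 2; x * y * z;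
                    x * z ^+ 2; y ^+ 3; y ^+ 2 * z; y * z ^+ 2; z ^+ 3]`_j.

(* The partial derivatives of the entries of cubics_row.                      *)
Definition cubics_row_dx Q : 'rV[R]_10 :=
  let x := Q 0 0 in let y := Q 0 1 in let z := Q 0 2 in
  \row_(j < 10) [:: 3 * x ^+ 2; 2 * x * y; 2 * x * z; y ^+ 2; y * z; z ^+ 2;
                    0; 0; 0; 0]`_j.

Definition cubics_row_dy Q : 'rV[R]_10 :=
  let x := Q 0 0 in let y := Q 0 1 in let z := Q 0 2 in
  \row_(j < 10) [:: 0; x ^+ 2; 0; 2 * x * y; x * z; 0; 3 * y ^+ 2; 2 * y * z;
                    z ^+ 2; 0]`_j.

Definition cubics_row_dz Q : 'rV[R]_10 :=
  let x := Q 0 0 in let y := Q 0 1 in let z := Q 0 2 in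
  \row_(j < 10) [:: 0; 0; x ^+ 2; 0; x * y; 2 * x * z; 0; y ^+ 2; 2 * y * z;
                    3 * z ^+ 2]`_j.

Definition Ddet Q1 Q2 Q3 Q4 Q5 Q6 Q7 Q8 : R :=
  \det (\matrix_(i < 10)
    nth 0 ([seq cubics_row Q | Q <- [:: Q2; Q3; Q4; Q5; Q6; Q7; Q8]]
           ++ [:: cubics_row_dx Q1; cubics_row_dy Q1; cubics_row_dz Q1]) i).

End Determinants.

Definition ninth_formula (K : fieldType) (p : 'I_8 -> 'rV[K]_3) : 'rV[K]_3 :=
  let P1 := p (inord 0) in  let P2 := p (inord 1) in
  let P3 := p (inord 2) in  let P4 := p (inord 3) in
  let P5 := p (inord 4) in  let P6 := p (inord 5) in
  let P7 := p (inord 6) in  let P8 := p (inord 7) in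
  let Cx := Cdet P1 P4 P5 P6 P7 P8 in
  let Cy := Cdet P2 P4 P5 P6 P7 P8 in
  let Cz := Cdet P3 P4 P5 P6 P7 P8 in
  let Dx := Ddet P1 P2 P3 P4 P5 P6 P7 P8 in
  let Dy := Ddet P2 P3 P1 P4 P5 P6 P7 P8 in
  let Dz := Ddet P3 P1 P2 P4 P5 P6 P7 P8 in
  (bracket P1 P2 P3)^-1 *:
    ((Cx * Dy * Dz) *: P1 + (Dx * Cy * Dz) *: P2 + (Dx * Dy * Cz) *: P3).

Section LocalRing.
Variable L : fieldType.
Implicit Types (F G : {mpoly L[3]}) (X : 'rV[L]_3).

(* h belongs to the local ring O_X of P^2 at X: it is a quotient of two forms *)
(* of the same degree, with denominator not vanishing at X.                   *)
Definition regular_at X (h : {fraction {mpoly L[3]}}) : Prop :=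
  exists d (A S : {mpoly L[3]}),
    [/\ A \is d.-homog, S \is d.-homog, evalpt S X != 0
      & h = tofrac A / tofrac S].

(* h belongs to the ideal of O_X generated by the germs of the curves F = 0   *)
(* and G = 0.                                                                 *)
Definition in_local_ideal F G X (h : {fraction {mpoly L[3]}}) : Prop :=
  exists d (A B S : {mpoly L[3]}),
    [/\ A * F \is d.-homog, B * G \is d.-homog, S \is d.-homog,
        evalpt S X != 0 & h = tofrac (A * F + B * G) / tofrac S].

(* The local ring O_X modulo (F, G) has dimension m over L: some m-tuple b of *)
(* elements of O_X induces a basis of the quotient.                           *)
Definition intersection_mult F G X (m : nat) : Prop :=
  exists b : 'I_m -> {fraction {mpoly L[3]}},
    (forall i, regular_at X (b i)) /\
    (forall h, regular_at X h ->
       exists! c : 'rV[L]_m,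
         in_local_ideal F G X (h - \sum_(i < m) tofrac (c 0 i)%:MP * b i)).

End LocalRing.

Section CayleyBacharach.
Variable K : fieldType.
Implicit Types (p : 'I_8 -> 'rV[K]_3) (F G : {mpoly K[3]}).

(* No k of the eight points lie on a curve of degree d.                       *)
Definition no_points_on_curve (k d : nat) p : Prop :=
  forall A : {set 'I_8}, #|A| = k ->
  forall F, F \is d.-homog -> (forall i, i \in A -> evalpt F (p i) = 0) ->
  F = 0.

Definition general_position p : Prop :=
  [/\ forall i, p i != 0,
      forall i j, i != j -> ~~ (p i == p j)%MS,
      no_points_on_curve 3 1 p
    & no_points_on_curve 6 2 p].

Definition cubic_through p F : Prop :=
  F \is 3.-homog /\ forall i, evalpt F (p i) = 0.

Definition lin_indep2 F G : Prop :=
  forall a b : K, a *: F + b *: G = 0 -> a = 0 /\ b = 0.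

(* Over an algebraic closure L of K, the intersection cycle of any two        *)
(* independent cubics through the eight points is p_0 + ... + p_7 + Q, i.e.,  *)
(* every X has intersection multiplicity equal to the number of times that it *)
(* occurs in this list; in particular there is no other intersection point.   *)
Definition is_Cayley_Bacharach_point p (Q : 'rV[K]_3) : Prop :=
  [/\ general_position p, Q != 0
    & forall F G, cubic_through p F -> cubic_through p G -> lin_indep2 F G ->
      forall (L : closedFieldType) (iota : {rmorphism K -> L}),
      integralRange iota ->
      forall X : 'rV[L]_3, X != 0 ->
      intersection_mult (map_mpoly iota F) (map_mpoly iota G) X
        (\sum_(i < 8) (map_mx iota (p i) == X)%MS + (map_mx iota Q == X)%MS)%N].

End CayleyBacharach.

(* The unknown number mxvec_index i j is the j-th coordinate of the i-th      *)
(* point, i < 8, j < 3.                                                       *)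
Notation polyR := {mpoly rat[(8 * 3)%N]}.
Notation fracK := {fraction polyR}.

Definition generic_point (i : 'I_8) : 'rV[fracK]_3 :=
  \row_(j < 3) tofrac ('X_(mxvec_index i j) : polyR).

Definition multihomogeneous (d : 'I_8 -> nat) (f : polyR) : Prop :=
  forall m, m \in msupp f ->
  forall i : 'I_8, (\sum_(j < 3) m (mxvec_index i j))%N = d i.

Definition divides (R : comNzRingType) (d f : R) : Prop := exists q, f = d * q.

Definition is_gcd3 (R : comNzRingType) (W : 'rV[R]_3) (g : R) : Prop :=
  (forall j, divides g (W 0 j)) /\
  (forall d, (forall j, divides d (W 0 j)) -> divides d g).

(* Main.v *)
(* After a linear change of coordinates P1, P2, P3 are the coordinate points.  *)
(* Then every C and D is, up to a known nonzero factor, a maximal minor of the *)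
(* 8 x 10 matrix of the cubic monomials at the points, and by Pluecker duality *)
(* these are the 2 x 2 minors of the coefficients of two independent cubics    *)
(* F, G through the points. In the chart y = 1 both cubics are quadratic in z, *)
(* and eliminating z yields a sextic in x whose extreme coefficients are       *)
(* products of such minors. Five of its roots come from P4, ..., P8, so the    *)
(* sixth gives x / y at the ninth point; exchanging y and z gives x / z. The   *)
(* six roots are distinct, so F and G meet transversally at the nine points.   *)
(*   The bracket [123] is prime, being linear in one of the unknowns, and it   *)
(* divides the numerator of V, which vanishes when P1, P2, P3 are collinear.   *)
(*   Let s exchange P1 and Pk, k > 3. The numerators before and after s are    *)
(* proportional, as the ninth base point is unique; the factor is read off     *)
(* from [V23] = CxDyDz, which is antisymmetric. The cases k = 2, 3 are direct. *)
(*   A common divisor of the coordinates of V is homogeneous in every point.   *)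
(* When P4 moves on a suitable line and the other points are suitable rational *)
(* points, V does not vanish anywhere, so that the divisor is constant there   *)
(* and has degree 0 in P4. By symmetry it has degree 0 in every point.         *)
From Stdlib Require Import ZArith.
Require Import Defs.
From HB Require Import structures.
From mathcomp Require Import all_boot all_order all_algebra all_fingroup.
From mathcomp Require Import fraction ring zify ssrZ algC.
From mathcomp.multinomials Require Import mpoly.

Set Implicit Arguments.
Unset Strict Implicit.
Unset Printing Implicit Defensive.

Import GRing.Theory.
Local Open Scope ring_scope.

(** * The determinants C and D under morphisms and changes of coordinates *)

(** Under a linear change of coordinates everything is preserved up to nonzero scalars ([Cdet_mul],
    [Ddet_mul]), so P1, P2, P3 may be taken as the coordinate points. A cubic through them contains
    no pure cubes and is quadratic in each variable. Up to constants, Dx, Dy, Dz and the products of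
    Cx, Cy, Cz with coordinates of the other five points become maximal minors of the 8 x 10
    evaluation matrix ([Ddet_e0], [Cdet_e0] and their companions). By [plucker_duality] these are,
    up to one common factor, the 2 x 2 minors of the coefficients of any basis F, G of the pencil.

    Eliminating z in the chart y = 1 leaves, besides a factor t, a sextic in t = x / y. Its extreme
    coefficients are products of two such minors and five of its roots come from P4, ..., P8, so
    Vieta's formula ([last_root]) gives the sixth: it is the ratio of the first two coordinates of
    the numerator. The chart z = 1 gives x / z. Matching the two charts shows that the numerator is
    a base point ([pencil_ninth]). The six roots are distinct, so there is no further base point
    ([pencil_base]) and the cubics meet transversally ([pencil_transversal]), because the derivative
    of the sextic is a multiple of the Jacobian ([jacobian_sextic]). Transversality means local
    multiplicity one ([intersection_mult_transversal]). The open conditions behind all this are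
    collected in [generic_config]; the generic points satisfy them because an integral sample does
    ([sample_generic]).

    If P1, P2, P3 are collinear, each D splits off a confluent Vandermonde determinant, and the
    numerator vanishes by the linear relation between three vectors of a plane
    ([numerator_collinear]). Solving the bracket for one unknown in a fraction field gives a
    morphism whose kernel the bracket generates ([at_root_eq0]), so the bracket divides the
    numerator. Rescaling one point at a time yields the degrees ([homog_at_ninth]).

    A permuted numerator is again the ninth base point, hence proportional to the original one
    ([numerator_proportional]); comparing one bracket determines the factor ([ninth_formula_star]).

    A common divisor of the coordinates is homogeneous in each point ([homog_at_divisor]). When P4
    runs over a suitable line and the other points are fixed rational points, the numerator vanishes
    nowhere over an algebraically closed field. A common divisor then has no zero on that line,
    which forces degree 0 in P4 ([homog_at_line], [divisor_fourth_degree]); symmetry extends this to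
    every point ([divisor_degree]). *)

Section RowDeterminant.
Variable R : comNzRingType.

(** [bracket], [Cdet] and [Ddet] are all instances of this by unfolding, so that reordering and
    rescaling of rows become operations on lists. *)
Definition rdet n (s : seq 'rV[R]_n) : R := \det (\matrix_(i < n) nth 0 s i).

Lemma rdet_swap n (s1 s2 : seq 'rV[R]_n) a b :
  (size s1 + size s2).+2 = n ->
  rdet (s1 ++ [:: a, b & s2]) = - rdet (s1 ++ [:: b, a & s2]).
Proof.
move=> szn; have lt1 : ((size s1).+1 < n)%N by lia.
pose i := Ordinal (ltnW lt1); pose j := Ordinal lt1.
rewrite /rdet -[LHS]opprK; congr (- _).
have nij : i != j by rewrite -(inj_eq val_inj) /= neq_ltn ltnSn.
set A := (X in - \det X = _); set B := (X in _ = \det X).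
have -> : B = xrow i j A.
  apply/row_matrixP => k; rewrite rowK /xrow.
  have -> : row k (row_perm (tperm i j) A) = row (tperm i j k) A.
    by apply/rowP => l; rewrite !mxE.
  rewrite rowK !nth_cat; case: tpermP => [->|->|/eqP ki /eqP kj] /=.
  - by rewrite !ltnn subnn ltnNge leqnSn /= subSnn.
  - by rewrite !ltnn subnn ltnNge leqnSn /= subSnn.
  - case: ltnP => // le; case e: (k - size s1)%N => [|[|m]] //=.
    + by case/eqP: ki; apply: val_inj => /=; lia.
    + by case/eqP: kj; apply: val_inj => /=; lia.
by rewrite xrowE det_mulmx det_perm odd_tperm nij expr1 mulN1r.
Qed.

(** One adjacent transposition for each row of the block that is passed. *)
Lemma rdet_move n (s1 s2 s3 : seq 'rV[R]_n) a :
  (size s1 + size s2 + size s3).+1 = n ->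
  rdet (s1 ++ a :: s2 ++ s3) = (-1) ^+ size s2 * rdet (s1 ++ s2 ++ a :: s3).
Proof.
elim: s2 s1 => [|b s2 IH] s1 szn /=; first by rewrite expr0 mul1r.
rewrite rdet_swap; last by move: szn; rewrite size_cat /=; lia.
rewrite -cat_rcons IH; last by move: szn; rewrite size_rcons /=; lia.
by rewrite cat_rcons exprS mulN1r mulNr.
Qed.

Lemma rdet_mulmx n (s : seq 'rV[R]_n) (B : 'M_n) :
  rdet [seq r *m B | r <- s] = rdet s * \det B.
Proof.
rewrite /rdet -det_mulmx; congr (\det _); apply/row_matrixP => i.
rewrite row_mul !rowK; case: (ltnP i (size s)) => lt; first by rewrite (nth_map 0).
by rewrite !nth_default ?size_map // mul0mx.
Qed.

Lemma rdet_scale n (s : seq ('rV[R]_n * R)) : size s = n ->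
  rdet [seq r.2 *: r.1 | r <- s] = \prod_(r <- s) r.2 * rdet (unzip1 s).
Proof.
move=> szn; rewrite /rdet.
pose d : 'rV[R]_n := \row_i (nth (0, 0) s i).2.
have -> : \prod_(r <- s) r.2 = \det (diag_mx d).
  rewrite det_diag (big_nth (0, 0)) szn big_mkord.
  by apply: eq_bigr => i _; rewrite mxE.
rewrite -det_mulmx; congr (\det _); apply/matrixP => i j.
by rewrite mul_diag_mx !mxE !(nth_map (0, 0)) ?szn //= mxE.
Qed.

End RowDeterminant.

Lemma rdet_map (R S : comNzRingType) (f : {rmorphism R -> S}) n (s : seq 'rV[R]_n) :
  rdet [seq map_mx f r | r <- s] = f (rdet s).
Proof.
rewrite /rdet -det_map_mx; congr (\det _); apply/matrixP => i j; rewrite !mxE.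
case: (ltnP i (size s)) => lt; first by rewrite (nth_map 0) // mxE.
by rewrite !nth_default ?size_map // !mxE rmorph0.
Qed.

Section Naturality.
Variables (R S : comNzRingType) (f : {rmorphism R -> S}).
Implicit Types Q : 'rV[R]_3.

Lemma row_nth_map n (s : seq R) :
  map_mx f (\row_(j < n) s`_j) = \row_(j < n) [seq f x | x <- s]`_j.
Proof.
apply/rowP => j; rewrite !mxE; case: (ltnP j (size s)) => lt.
  by rewrite (nth_map 0).
by rewrite !nth_default ?size_map // rmorph0.
Qed.

Lemma quadrics_row_map Q : quadrics_row (map_mx f Q) = map_mx f (quadrics_row Q).
Proof. by rewrite /quadrics_row row_nth_map /= ?(rmorphM, rmorphXn, rmorph_nat, rmorph0) !mxE. Qed.
Lemma cubics_row_map Q : cubics_row (map_mx f Q) = map_mx f (cubics_row Q).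
Proof. by rewrite /cubics_row row_nth_map /= ?(rmorphM, rmorphXn, rmorph_nat, rmorph0) !mxE. Qed.
Lemma cubics_row_dx_map Q : cubics_row_dx (map_mx f Q) = map_mx f (cubics_row_dx Q).
Proof. by rewrite /cubics_row_dx row_nth_map /= ?(rmorphM, rmorphXn, rmorph_nat, rmorph0) !mxE. Qed.
Lemma cubics_row_dy_map Q : cubics_row_dy (map_mx f Q) = map_mx f (cubics_row_dy Q).
Proof. by rewrite /cubics_row_dy row_nth_map /= ?(rmorphM, rmorphXn, rmorph_nat, rmorph0) !mxE. Qed.
Lemma cubics_row_dz_map Q : cubics_row_dz (map_mx f Q) = map_mx f (cubics_row_dz Q).
Proof. by rewrite /cubics_row_dz row_nth_map /= ?(rmorphM, rmorphXn, rmorph_nat, rmorph0) !mxE. Qed.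

Lemma bracket_map Q1 Q2 Q3 :
  bracket (map_mx f Q1) (map_mx f Q2) (map_mx f Q3) = f (bracket Q1 Q2 Q3).
Proof. exact: (rdet_map f [:: Q1; Q2; Q3]). Qed.

Lemma Cdet_map Q1 Q2 Q3 Q4 Q5 Q6 :
  Cdet (map_mx f Q1) (map_mx f Q2) (map_mx f Q3) (map_mx f Q4) (map_mx f Q5)
    (map_mx f Q6) = f (Cdet Q1 Q2 Q3 Q4 Q5 Q6).
Proof.
by rewrite [RHS](esym (rdet_map f _)) /= -!quadrics_row_map.
Qed.

Lemma Ddet_map Q1 Q2 Q3 Q4 Q5 Q6 Q7 Q8 :
  Ddet (map_mx f Q1) (map_mx f Q2) (map_mx f Q3) (map_mx f Q4) (map_mx f Q5)
    (map_mx f Q6) (map_mx f Q7) (map_mx f Q8) = f (Ddet Q1 Q2 Q3 Q4 Q5 Q6 Q7 Q8).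
Proof.
rewrite [RHS](esym (rdet_map f _)) /=.
by rewrite -!cubics_row_map -cubics_row_dx_map -cubics_row_dy_map -cubics_row_dz_map.
Qed.

End Naturality.

Section CoordinateChange.
Variable R : comNzRingType.
Implicit Types (Q H : 'rV[R]_3) (g : 'M[R]_3).

Lemma sum3 (V : nmodType) (F : 'I_3 -> V) : \sum_i F i = F 0 + F 1 + F 2.
Proof.
rewrite !big_ord_recl big_ord0 addr0 addrA.
by congr (_ + F _ + F _); apply: val_inj.
Qed.

Lemma mul3E m n (A : 'M[R]_(m, 3)) (B : 'M_(3, n)) i j :
  (A *m B) i j = A i 0 * B 0 j + A i 1 * B 1 j + A i 2 * B 2 j.
Proof. by rewrite mxE sum3. Qed.

(** The coefficient of s t in the quadratic monomials of s Q + t H. *)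
Definition quadrics_polar Q H : 'rV[R]_6 :=
  let b i j := Q 0 i * H 0 j + H 0 i * Q 0 j in
  \row_(j < 6) [:: b 0 0; b 0 1; b 0 2; b 1 1; b 1 2; b 2 2]`_j.

(** The derivative at Q, in the direction H, of the vector of cubic monomials. *)
Definition cubics_polar Q H : 'rV[R]_10 :=
  let d i j k := Q 0 i * Q 0 j * H 0 k + Q 0 i * H 0 j * Q 0 k
                 + H 0 i * Q 0 j * Q 0 k in
  \row_(j < 10) [:: d 0 0 0; d 0 0 1; d 0 0 2; d 0 1 1; d 0 1 2; d 0 2 2; d 1 1 1; d 1 1 2; d 1 2 2; d 2 2 2]`_j.

(** The full polarization: the multilinear coefficient, a sum over the six assignments of the three
    points. *)
Definition cubics_polar3 Q1 Q2 Q3 : 'rV[R]_10 :=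
  let t i j k := Q1 0 i * (Q2 0 j * Q3 0 k + Q3 0 j * Q2 0 k)
                 + Q2 0 i * (Q1 0 j * Q3 0 k + Q3 0 j * Q1 0 k)
                 + Q3 0 i * (Q1 0 j * Q2 0 k + Q2 0 j * Q1 0 k) in
  \row_(j < 10) [:: t 0 0 0; t 0 0 1; t 0 0 2; t 0 1 1; t 0 1 2; t 0 2 2; t 1 1 1; t 1 1 2; t 1 2 2; t 2 2 2]`_j.

(** The action of g on quadratic monomials: in the expansion of the monomials of x r0 + y r1 + z r2,
    with r0, r1, r2 the rows of g, each row collects the coefficients of one monomial in x, y, z.
    [Sym3] is the same in degree 3. *)
Definition Sym2 g : 'M[R]_6 :=
  let r i := row i g in
  \matrix_(i < 6) nth 0 [:: quadrics_row (r 0); quadrics_polar (r 0) (r 1);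
    quadrics_polar (r 0) (r 2); quadrics_row (r 1); quadrics_polar (r 1) (r 2);
    quadrics_row (r 2)] i.

Definition Sym3 g : 'M[R]_10 :=
  let r i := row i g in
  \matrix_(i < 10) nth 0 [:: cubics_row (r 0); cubics_polar (r 0) (r 1);
    cubics_polar (r 0) (r 2); cubics_polar (r 1) (r 0);
    cubics_polar3 (r 0) (r 1) (r 2); cubics_polar (r 2) (r 0);
    cubics_row (r 1); cubics_polar (r 1) (r 2); cubics_polar (r 2) (r 1);
    cubics_row (r 2)] i.

Lemma row_list_mulmx m n (a : seq R) (s : seq 'rV_n) : size s = m ->
  (\row_(j < m) a`_j) *m (\matrix_(i < m) nth 0 s i) =
  foldr +%R 0 [seq r.1 *: r.2 | r <- zip a s].
Proof.
move=> <-; rewrite mulmx_sum_row; under eq_bigr => i _ do rewrite mxE rowK.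
elim: s a => [|r s IH] [|x a] /=; rewrite ?big_ord0 //.
  by rewrite big1 // => i _; rewrite nth_nil scale0r.
by rewrite big_ord_recl /= IH.
Qed.

Lemma quadrics_row_mul Q g : quadrics_row (Q *m g) = quadrics_row Q *m Sym2 g.
Proof.
rewrite /quadrics_row /= row_list_mulmx //= !mul3E /quadrics_polar /quadrics_row /=.
rewrite ![row _ _ _ _]mxE.
move: (g 0 0) (g 0 1) (g 0 2) (g 1 0) (g 1 1) (g 1 2) (g 2 0) (g 2 1) (g 2 2).
move=> g00 g01 g02 g10 g11 g12 g20 g21 g22.
move: (Q 0 0) (Q 0 1) (Q 0 2) => x y z.
apply/rowP => j; rewrite !mxE; case: j.
by do 6?[case => [?|]] => //=; ring.
Qed.

Lemma cubics_row_mul Q g : cubics_row (Q *m g) = cubics_row Q *m Sym3 g.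
Proof.
rewrite {1 2}/cubics_row /= row_list_mulmx //= !mul3E.
rewrite /cubics_polar /cubics_polar3 /cubics_row /=.
rewrite ![row _ _ _ _]mxE.
move: (g 0 0) (g 0 1) (g 0 2) (g 1 0) (g 1 1) (g 1 2) (g 2 0) (g 2 1) (g 2 2).
move=> g00 g01 g02 g10 g11 g12 g20 g21 g22.
move: (Q 0 0) (Q 0 1) (Q 0 2) => x y z.
apply/rowP => j; rewrite !mxE; case: j.
by do 10?[case => [?|]] => //=; ring.
Qed.

(** The chain rule: [cubics_row_mul] differentiated in the direction H. *)
Lemma cubics_polar_mul Q H g :
  cubics_polar Q H *m Sym3 g = cubics_polar (Q *m g) (H *m g).
Proof.
rewrite {1 2}/cubics_polar /= row_list_mulmx //= !mul3E.
rewrite /cubics_polar /cubics_polar3 /cubics_row /=.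
rewrite ![row _ _ _ _]mxE.
move: (g 0 0) (g 0 1) (g 0 2) (g 1 0) (g 1 1) (g 1 2) (g 2 0) (g 2 1) (g 2 2).
move=> g00 g01 g02 g10 g11 g12 g20 g21 g22.
move: (Q 0 0) (Q 0 1) (Q 0 2) => x y z.
move: (H 0 0) (H 0 1) (H 0 2) => h0 h1 h2.
apply/rowP => j; rewrite !mxE; case: j.
by do 10?[case => [?|]] => //=; ring.
Qed.

Lemma cubics_row_dxE Q : cubics_row_dx Q = cubics_polar Q (delta_mx 0 0).
Proof.
apply/rowP => j; rewrite !mxE; case: j.
by do 10?[case => [?|]] => //=; ring.
Qed.

Lemma cubics_row_dyE Q : cubics_row_dy Q = cubics_polar Q (delta_mx 0 1).
Proof.
apply/rowP => j; rewrite !mxE; case: j.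
by do 10?[case => [?|]] => //=; ring.
Qed.

Lemma cubics_row_dzE Q : cubics_row_dz Q = cubics_polar Q (delta_mx 0 2).
Proof.
apply/rowP => j; rewrite !mxE; case: j.
by do 10?[case => [?|]] => //=; ring.
Qed.

End CoordinateChange.

Section CoordinateChangeDet.
Variable R : comNzRingType.
Implicit Types (Q H : 'rV[R]_3) (g h : 'M[R]_3).

Lemma quadrics_polarE Q H :
  quadrics_polar Q H = quadrics_row (Q + H) - quadrics_row Q - quadrics_row H.
Proof.
by apply/rowP => j; rewrite !mxE; case: j; do 6?[case => [?|]] => //=; ring.
Qed.

Lemma cubics_polar3E Q1 Q2 Q3 : cubics_polar3 Q1 Q2 Q3 =
  cubics_row (Q1 + Q2 + Q3) - cubics_row (Q1 + Q2) - cubics_row (Q1 + Q3)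
  - cubics_row (Q2 + Q3) + cubics_row Q1 + cubics_row Q2 + cubics_row Q3.
Proof.
by apply/rowP => j; rewrite !mxE; case: j; do 10?[case => [?|]] => //=; ring.
Qed.

(** Polar rows are combinations of values of [quadrics_row] by [quadrics_polarE], so they transform
    as the values do. *)
Lemma Sym2M g h : Sym2 (g *m h) = Sym2 g *m Sym2 h.
Proof.
have polar Q H : quadrics_polar (Q *m h) (H *m h) = quadrics_polar Q H *m Sym2 h.
  by rewrite !quadrics_polarE -mulmxDl !quadrics_row_mul !mulmxBl.
apply/row_matrixP => i; rewrite row_mul !rowK !row_mul !polar.
by rewrite !quadrics_row_mul; case: i; do 6?[case => [?|]].
Qed.

Lemma Sym3M g h : Sym3 (g *m h) = Sym3 g *m Sym3 h.
Proof.
have polar Q1 Q2 Q3 : cubics_polar3 (Q1 *m h) (Q2 *m h) (Q3 *m h) =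
    cubics_polar3 Q1 Q2 Q3 *m Sym3 h.
  by rewrite !cubics_polar3E -!mulmxDl !cubics_row_mul !mulmxDl !mulNmx.
apply/row_matrixP => i; rewrite row_mul !rowK !row_mul !polar.
by rewrite !cubics_row_mul -!cubics_polar_mul; case: i; do 10?[case => [?|]].
Qed.

Lemma row1 n i : row i (1%:M : 'M[R]_n) = delta_mx 0 i.
Proof. by apply/rowP => j; rewrite !mxE eqxx /= eq_sym. Qed.

Lemma Sym2_1 : Sym2 1%:M = 1%:M :> 'M[R]_6.
Proof.
apply/row_matrixP => i; rewrite rowK !row1; apply/rowP => j; rewrite !mxE.
case: i; do 6?[case => [?|]] => //=; rewrite !mxE;
by case: j; do 6?[case => [?|]] => //=; rewrite ?mxE /=; ring.
Qed.

Lemma Sym3_1 : Sym3 1%:M = 1%:M :> 'M[R]_10.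
Proof.
apply/row_matrixP => i; rewrite rowK !row1; apply/rowP => j; rewrite !mxE.
case: i; do 10?[case => [?|]] => //=; rewrite !mxE;
by case: j; do 10?[case => [?|]] => //=; rewrite ?mxE /=; ring.
Qed.

Lemma Cdet_mul g Q1 Q2 Q3 Q4 Q5 Q6 :
  Cdet (Q1 *m g) (Q2 *m g) (Q3 *m g) (Q4 *m g) (Q5 *m g) (Q6 *m g) =
  Cdet Q1 Q2 Q3 Q4 Q5 Q6 * \det (Sym2 g).
Proof. by rewrite /Cdet -rdet_mulmx /= !quadrics_row_mul. Qed.

Lemma rdet_cat m n (s t : seq 'rV[R]_(m + n)) : size s = m ->
  rdet (s ++ t) = \det (col_mx (\matrix_(i < m) nth 0 s i) (\matrix_(i < n) nth 0 t i)).
Proof.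
move=> szs; congr (\det _); apply/matrixP => i j; rewrite !mxE nth_cat szs.
case: splitP => k -> /=; rewrite mxE; first by [].
by rewrite addKn.
Qed.

Lemma cubics_polar_row Q g i :
  cubics_polar Q (row i g) = \sum_k g i k *: cubics_polar Q (delta_mx 0 k).
Proof.
apply/rowP => j; rewrite sum3 !mxE.
by case: j; do 10?[case => [?|]] => //=; rewrite ?mxE /=; ring.
Qed.

(** All ten rows are transformed by [Sym3 g], but the derivatives are then taken along the rows of g
    instead of the coordinate directions. Those three rows are g times the standard ones, whence the
    factor [\det g], kept on the left because R is only a ring. *)
Lemma Ddet_mul g Q1 Q2 Q3 Q4 Q5 Q6 Q7 Q8 :
  \det g * Ddet (Q1 *m g) (Q2 *m g) (Q3 *m g) (Q4 *m g) (Q5 *m g) (Q6 *m g)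
    (Q7 *m g) (Q8 *m g) = Ddet Q1 Q2 Q3 Q4 Q5 Q6 Q7 Q8 * \det (Sym3 g).
Proof.
rewrite /Ddet -rdet_mulmx /= !cubics_row_dxE !cubics_row_dyE !cubics_row_dzE.
rewrite !cubics_polar_mul -!cubics_row_mul.
pose s := [seq cubics_row (Q *m g) | Q <- [:: Q2; Q3; Q4; Q5; Q6; Q7; Q8]].
pose e (k : 'I_3) : 'rV[R]_3 := delta_mx 0 k.
have eg k : e k *m g = row k g by rewrite -rowE.
pose t := [:: cubics_polar (Q1 *m g) (e 0); cubics_polar (Q1 *m g) (e 1);
  cubics_polar (Q1 *m g) (e 2)].
pose t' := [:: cubics_polar (Q1 *m g) (e 0 *m g); cubics_polar (Q1 *m g) (e 1 *m g);
  cubics_polar (Q1 *m g) (e 2 *m g)].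
have eqt : \matrix_(i < 3) nth 0 t' i = g *m \matrix_(i < 3) nth 0 t i.
  apply/row_matrixP => i; rewrite row_mul rowK.
  have -> : nth 0 t' i = cubics_polar (Q1 *m g) (row i g).
    by case: i => -[|[|[|//]]] lti; rewrite /= eg; congr (cubics_polar _ (row _ _));
      apply: val_inj.
  rewrite cubics_polar_row [RHS]mulmx_sum_row; apply: eq_bigr => k _.
  rewrite rowK mxE; congr (_ *: _).
  by case: k => -[|[|[|//]]] lti; congr (cubics_polar _ (delta_mx _ _));
      apply: val_inj.
change (\det g * rdet (s ++ t) = rdet (s ++ t')).
rewrite !(@rdet_cat 7 3) //.
rewrite [X in _ = \det (col_mx _ X)]eqt.
set A := \matrix_(i < 7) _; set B := \matrix_(i < 3) _.
have -> : col_mx A (g *m B) = block_mx 1%:M 0 0 g *m col_mx A B.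
  by rewrite mul_block_col mul1mx !mul0mx addr0 add0r.
by rewrite det_mulmx det_ublock det1 mul1r.
Qed.

End CoordinateChangeDet.

(** By functoriality [Sym2 (invmx g)] is an inverse of [Sym2 g]. *)
Lemma det_Sym2_neq0 (K : fieldType) (g : 'M[K]_3) :
  g \in unitmx -> \det (Sym2 g) != 0.
Proof.
move=> gu; apply: contraNneq (oner_neq0 K) => d0.
by rewrite -(det1 K 6) -Sym2_1 -(mulmxV gu) Sym2M det_mulmx d0 mul0r.
Qed.

Lemma Sym3_unit (K : fieldType) (g : 'M[K]_3) :
  g \in unitmx -> Sym3 g \in unitmx.
Proof.
move=> gu; rewrite unitmxE unitfE; apply: contraNneq (oner_neq0 K) => d0.
by rewrite -(det1 K 10) -Sym3_1 -(mulmxV gu) Sym3M det_mulmx d0 mul0r.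
Qed.

(** * Evaluation of numerical determinants *)

(* MathComp uses %Z for its own integers.                                      *)
Delimit Scope Z_scope with bZ.

(* Integer polynomials in one variable are lists of binary coefficients, so    *)
(* that determinants of numerical configurations can be evaluated by           *)
(* vm_compute; the zero polynomial must be written [::] to be skipped.         *)
Fixpoint zadd (a b : seq Z) : seq Z :=
  match a, b with
  | [::], _ => b
  | _, [::] => a
  | x :: a', y :: b' => (x + y)%bZ :: zadd a' b'
  end.

Definition zscale (c : Z) : seq Z -> seq Z := map (Z.mul c).

Fixpoint zmul (a b : seq Z) : seq Z :=
  if a is x :: a' then zadd (zscale x b) (0%bZ :: zmul a' b) else [::].

Definition rem_nth T j (r : seq T) := take j r ++ drop j.+1 r.

(** Laplace expansion along the first row; entries [[::]] are skipped, which keeps the many sparse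
    rows cheap. *)
Fixpoint zdet n (M : seq (seq (seq Z))) : seq Z :=
  if n is n'.+1 then
    if M is r :: M' then
      foldr (fun j acc =>
        if nth [::] r j is [::] then acc else
        zadd (zscale (if odd j then -1 else 1)%bZ
               (zmul (nth [::] r j) (zdet n' (map (rem_nth j) M')))) acc)
        [::] (iota 0 n)
    else [::]
  else [:: 1%bZ].

Section ZEval.
Variables (R : comNzRingType) (t : R).

Definition zint (c : Z) : R := (int_of_Z c)%:~R.

Fixpoint zeval (a : seq Z) : R := if a is c :: a' then zint c + t * zeval a' else 0.

Lemma zintD a b : zint (Z.add a b) = zint a + zint b.
Proof. by rewrite /zint -intrD -rmorphD. Qed.
Lemma zintM a b : zint (Z.mul a b) = zint a * zint b.
Proof. by rewrite /zint -intrM -rmorphM. Qed.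

Lemma zevalD a b : zeval (zadd a b) = zeval a + zeval b.
Proof.
elim: a b => [|x a IH] [|y b] /=; rewrite ?add0r ?addr0 //.
by rewrite zintD IH; ring.
Qed.

Lemma zevalZ c a : zeval (zscale c a) = zint c * zeval a.
Proof. by elim: a => [|x a IH] /=; rewrite ?mulr0 // zintM IH; ring. Qed.

Lemma zevalM a b : zeval (zmul a b) = zeval a * zeval b.
Proof.
elim: a => [|x a IH] /=; first by rewrite mul0r.
by rewrite zevalD zevalZ /= IH /zint; ring.
Qed.

Definition zmx n (M : seq (seq (seq Z))) : 'M[R]_n :=
  \matrix_(i, j) zeval (nth [::] (nth [::] M i) j).

Lemma nth_rem_nth T (x : T) j r k : nth x (rem_nth j r) k = nth x r (bump j k).
Proof.
rewrite /rem_nth nth_cat size_take /bump.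
case: (ltnP j (size r)) => lt.
  case: (ltnP k j) => kj; first by rewrite nth_take.
  by rewrite nth_drop; congr nth; lia.
have -> : drop j.+1 r = [::] by rewrite drop_oversize // ltnW.
case: (ltnP k (size r)) => kr.
  have -> : (j <= k)%N = false by lia.
  by rewrite nth_take //; lia.
by rewrite nth_nil nth_default //; case: (j <= k)%N => /=; lia.
Qed.

Lemma det_zmx n M : \det (zmx n M) = zeval (zdet n M).
Proof.
elim: n M => [|n IH] [|r M]; rewrite ?det_mx00 /=; rewrite ?mulr0 ?addr0 //.
  rewrite (expand_det_row _ ord0) big1 // => j _.
  by rewrite mxE /= !nth_nil mul0r.
rewrite (expand_det_row _ ord0).
pose F j := zeval (nth [::] r j) * (-1) ^+ j * zeval (zdet n (map (rem_nth j) M)).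
rewrite (eq_bigr (fun j : 'I_n.+1 => F j)) => [|j _]; last first.
  rewrite mxE /= /F -mulrA; congr (_ * _).
  rewrite /cofactor add0n -IH; congr (_ * \det _).
  apply/matrixP => i k; rewrite !mxE /=.
  case: (ltnP i (size M)) => lt; first by rewrite (nth_map [::]) // nth_rem_nth.
  by rewrite !(@nth_default _ [::] _ i) ?size_map // !nth_nil.
rewrite -(big_mkord xpredT F) /index_iota subn0.
change (\sum_(i <- 0%N :: iota 1 n) F i = zeval (foldr (fun j acc =>
        if nth [::] r j is [::] then acc else
        zadd (zscale (if odd j then -1 else 1)%bZ
               (zmul (nth [::] r j) (zdet n (map (rem_nth j) M)))) acc)
        [::] (0%N :: iota 1 n))).
elim: (0%N :: iota 1 n) => [|j s IHs]; first by rewrite big_nil.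
rewrite big_cons IHs /= {1}/F.
case: (nth [::] r j) => [|c a]; first by rewrite /= !mul0r add0r.
rewrite zevalD zevalZ zevalM; congr (_ + _).
rewrite mulrA; congr (_ * _); rewrite mulrC; congr (_ * _).
by rewrite -signr_odd; case: (odd j).
Qed.
End ZEval.

(** * Pencils of cubics through the coordinate points *)

(** With E = ([pinvmx A], B), the product of A stacked on C with E is block lower triangular with
    diagonal blocks 1 and C B. Hence k = [\det E], and the choice C = [pinvmx B] shows that k is
    nonzero. *)
Lemma plucker_duality (K : fieldType) m n (A : 'M[K]_(m, m + n)) (B : 'M_(m + n, n)) :
  row_free A -> row_full B -> A *m B = 0 ->
  exists2 k : K, k != 0 &
    forall C : 'M_(n, m + n), \det (C *m B) = k * \det (col_mx A C).
Proof.
move=> freeA fullB AB0; pose E := row_mx (pinvmx A) B.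
have detE C : \det (C *m B) = \det E * \det (col_mx A C).
  rewrite mulrC -det_mulmx mul_col_row AB0 mulmxVp //.
  by rewrite det_lblock det1 mul1r.
exists (\det E) => //; apply: contraNneq (oner_neq0 K) => E0.
by rewrite -(det1 K n) -(mulVpmx fullB) detE E0 mul0r.
Qed.

Section ColumnPick.
Variable R : comNzRingType.

(** Reordering columns is multiplication by a 0-1 matrix; its determinant, the sign of the
    reordering, is evaluated through [colmx] and [zdet]. *)
Definition colpick n (l : seq nat) (r : 'rV[R]_n) : 'rV_n :=
  r *m \matrix_(i < n, j < n) (i == nth 0 l j :> nat)%:R.

Lemma colpickE n (l : seq nat) (a : seq R) : all (fun k => k < n)%N l -> size l = n ->
  colpick l (\row_(j < n) a`_j) = \row_(j < n) (map (nth 0 a) l)`_j.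
Proof.
move=> /allP ltl szl; apply/rowP => j; rewrite !mxE (nth_map 0%N) ?szl //.
have lt : (nth 0 l j < n)%N by apply: ltl; rewrite mem_nth ?szl.
rewrite (bigD1 (Ordinal lt)) //= big1 => [|i ne]; rewrite !mxE ?eqxx ?mulr1 ?addr0 //.
by rewrite -(inj_eq val_inj) /= in ne; rewrite (negbTE ne) mulr0.
Qed.

Definition colmx n (l : seq nat) : seq (seq (seq Z)) :=
  [seq [seq if i == k then [:: 1%bZ] else [::] | k <- l] | i <- iota 0 n].

Lemma rdet_colpick n (l : seq nat) (s : seq 'rV[R]_n) : size l = n ->
  rdet (map (colpick l) s) = rdet s * zeval 0 (zdet n (colmx n l)).
Proof.
move=> szl; rewrite rdet_mulmx -det_zmx; congr (_ * \det _).
apply/matrixP => i j; rewrite !mxE (nth_map 0%N) ?size_iota // nth_iota //.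
rewrite (nth_map 0%N) ?szl // add0n; case: eqP => //= _.
by rewrite mul0r addr0.
Qed.

Lemma rdet_block m n (s : seq (R * 'rV[R]_m * 'rV[R]_n)) : size s = m ->
  rdet ([seq row_mx (r.1.1 *: r.1.2) r.2 | r <- s]
        ++ [seq row_mx 0 (delta_mx 0 i) | i <- enum 'I_n]) =
  \prod_(r <- s) r.1.1 * rdet [seq r.1.2 | r <- s].
Proof.
move=> szs; rewrite rdet_cat ?size_map //.
have -> : \matrix_(i < n) nth 0 [seq row_mx 0 (delta_mx 0 j) | j <- enum 'I_n] i
    = row_mx 0 1%:M :> 'M[R]_(n, m + n).
  apply/row_matrixP => i; rewrite rowK (nth_map i) ?size_enum_ord //.
  by rewrite nth_ord_enum row_row_mx row0 row1.
set A := \matrix_(i < m) _.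
rewrite -[A]hsubmxK -block_mxEv det_ublock det1 mulr1 {}/A.
have -> : \prod_(r <- s) r.1.1 = \prod_(r <- [seq (r.1.2, r.1.1) | r <- s]) r.2.
  by rewrite big_map.
have -> : [seq r.1.2 | r <- s] = unzip1 [seq (r.1.2, r.1.1) | r <- s].
  by rewrite /unzip1 -map_comp.
rewrite -rdet_scale ?size_map //; congr (\det _); apply/matrixP => i j.
have lt : (i < size s)%N by rewrite szs.
rewrite !mxE !(nth_map (0, 0, 0)) // (nth_map (0, 0)) ?size_map //.
by rewrite (nth_map (0, 0, 0)) // row_mxEl.
Qed.
End ColumnPick.

(** * C and D when three of the points are the coordinate points *)

Section NormalForm.
Variable R : comNzRingType.
Implicit Types P Q : 'rV[R]_3.

Definition unit_row n k : 'rV[R]_n := \row_(j < n) (j == k :> nat)%:R.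

Lemma unit_row_mulmx n p k (B : 'M_(n, p)) (ltk : (k < n)%N) :
  unit_row n k *m B = row (Ordinal ltk) B.
Proof.
by rewrite rowE; congr (_ *m _); apply/rowP => j; rewrite !mxE.
Qed.

Lemma colpick_unit_row n l k : uniq l -> size l = n -> k \in l -> (k < n)%N ->
  colpick l (unit_row n k) = unit_row n (index k l).
Proof.
move=> ul szl kl ltk; rewrite /colpick unit_row_mulmx.
apply/rowP => j; rewrite !mxE /= -{1}(nth_index 0%N kl) nth_uniq ?szl ?index_mem //.
  by rewrite eq_sym.
by rewrite -szl index_mem.
Qed.

Lemma rdet_scale1 n (s1 s2 : seq 'rV[R]_n) a x : (size s1 + size s2).+1 = n ->
  rdet (s1 ++ (a *: x) :: s2) = a * rdet (s1 ++ x :: s2).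
Proof.
move=> szs; pose s := [seq (r, 1) | r <- s1] ++ (x, a) :: [seq (r, 1) | r <- s2].
have one (t : seq 'rV[R]_n) : \prod_(r <- t) (1 : R) = 1 by rewrite big1_eq.
have -> : s1 ++ (a *: x) :: s2 = [seq r.2 *: r.1 | r <- s].
  rewrite map_cat /= -!map_comp /comp /=.
  by congr (_ ++ _ :: _); rewrite -[LHS]map_id; apply: eq_map => r; rewrite scale1r.
rewrite rdet_scale ?size_cat ?size_map /= ?size_map; last by move: szs; lia.
rewrite big_cat big_cons !big_map /= !one mul1r mulr1; congr (_ * rdet _).
by rewrite /unzip1 map_cat /= -!map_comp /comp /= !map_id.
Qed.

(** For eight points this is, up to sign, the maximal minor of the evaluation matrix that omits the
    columns i and j. *)
Definition cubics_minor (s : seq 'rV[R]_3) i j : R :=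
  rdet ([seq cubics_row P | P <- s] ++ [:: unit_row 10 i; unit_row 10 j]).

Variables P4 P5 P6 P7 P8 : 'rV[R]_3.
Let e k : 'rV[R]_3 := delta_mx 0 k.
Let Ps := [:: e 0; e 1; e 2; P4; P5; P6; P7; P8].

Ltac rows := apply/rowP => -[]; do 10?[case => [?|]] => //=; rewrite !mxE /=; ring.

Lemma cubics_row_e0 : cubics_row (e 0) = unit_row 10 0. Proof. rows. Qed.
Lemma cubics_row_e1 : cubics_row (e 1) = unit_row 10 6. Proof. rows. Qed.
Lemma cubics_row_e2 : cubics_row (e 2) = unit_row 10 9. Proof. rows. Qed.

Let cubics_row_e := (cubics_row_e0, cubics_row_e1, cubics_row_e2).

(** At the first coordinate point the derivative rows are 3, 1, 1 times the unit rows of x^3, x^2 y,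
    x^2 z. The first one replaces the evaluation row of that point, which is missing from the other
    seven, and the other two select the minor. The next two lemmas are analogous. *)
Lemma Ddet_e0 : Ddet (e 0) (e 1) (e 2) P4 P5 P6 P7 P8 = - 3 * cubics_minor Ps 1 2.
Proof.
have dx : cubics_row_dx (e 0) = 3 *: unit_row 10 0 by rows.
have dy : cubics_row_dy (e 0) = unit_row 10 1 by rows.
have dz : cubics_row_dz (e 0) = unit_row 10 2 by rows.
rewrite /Ddet -/(rdet _) /cubics_minor /= !cubics_row_e dx dy dz.
set c4 := cubics_row P4; set c5 := cubics_row P5; set c6 := cubics_row P6.
set c7 := cubics_row P7; set c8 := cubics_row P8; set u := unit_row 10.
rewrite (@rdet_scale1 _ [:: u 6; u 9; c4; c5; c6; c7; c8] [:: u 1; u 2]) //.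
rewrite (@rdet_move R 10 [::] [:: u 6; u 9; c4; c5; c6; c7; c8] [:: u 1; u 2] (u 0)) //=.
by ring.
Qed.

Lemma Ddet_e1 : Ddet (e 1) (e 2) (e 0) P4 P5 P6 P7 P8 = 3 * cubics_minor Ps 3 7.
Proof.
have dx : cubics_row_dx (e 1) = unit_row 10 3 by rows.
have dy : cubics_row_dy (e 1) = 3 *: unit_row 10 6 by rows.
have dz : cubics_row_dz (e 1) = unit_row 10 7 by rows.
rewrite /Ddet -/(rdet _) /cubics_minor /= !cubics_row_e dx dy dz.
set c4 := cubics_row P4; set c5 := cubics_row P5; set c6 := cubics_row P6.
set c7 := cubics_row P7; set c8 := cubics_row P8; set u := unit_row 10.
rewrite (@rdet_scale1 _ [:: u 9; u 0; c4; c5; c6; c7; c8; u 3] [:: u 7]) //.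
rewrite (@rdet_move R 10 [:: u 0] [:: u 9; c4; c5; c6; c7; c8; u 3] [:: u 7] (u 6)) //=.
rewrite (@rdet_move R 10 [::] [:: u 9] [:: c4; c5; c6; c7; c8; u 3; u 6; u 7] (u 0)) //=.
by ring.
Qed.

Lemma Ddet_e2 : Ddet (e 2) (e 0) (e 1) P4 P5 P6 P7 P8 = - 3 * cubics_minor Ps 5 8.
Proof.
have dx : cubics_row_dx (e 2) = unit_row 10 5 by rows.
have dy : cubics_row_dy (e 2) = unit_row 10 8 by rows.
have dz : cubics_row_dz (e 2) = 3 *: unit_row 10 9 by rows.
rewrite /Ddet -/(rdet _) /cubics_minor /= !cubics_row_e dx dy dz.
set c4 := cubics_row P4; set c5 := cubics_row P5; set c6 := cubics_row P6.
set c7 := cubics_row P7; set c8 := cubics_row P8; set u := unit_row 10.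
rewrite (@rdet_scale1 _ [:: u 0; u 6; c4; c5; c6; c7; c8; u 5; u 8] [::]) //.
rewrite (@rdet_move R 10 [:: u 0; u 6] [:: c4; c5; c6; c7; c8; u 5; u 8] [::] (u 9)) //=.
by ring.
Qed.

(** The list l puts the six monomials divisible by the k-th coordinate first. The unit rows
    eliminate the other four columns, and division by the coordinate turns the six cubic monomials
    into the quadratic ones. *)
Lemma rdet_divisible (k : 'I_3) l (s : seq 'rV[R]_3) (us : seq nat) :
  size s = 6%N -> uniq l -> size l = 10%N -> all (fun i => i < 10)%N l ->
  drop 6 l = us ->
  (forall P, exists y : 'rV_4,
     colpick l (cubics_row P) = row_mx (P 0 k *: quadrics_row P) y) ->
  rdet ([seq cubics_row P | P <- s] ++ [seq unit_row 10 i | i <- us])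
    * zeval 0 (zdet 10 (colmx 10 l)) =
  \prod_(P <- s) P 0 k * rdet [seq quadrics_row P | P <- s].
Proof.
move=> szs ul szl ltl dl cl; rewrite -rdet_colpick //.
pose y P : 'rV[R]_4 := \row_j (colpick l (cubics_row P)) 0 (rshift 6 j).
pose t := [seq (P 0 k, quadrics_row P, y P) | P <- s].
have -> : \prod_(P <- s) P 0 k = \prod_(r <- t) r.1.1 by rewrite big_map.
have -> : [seq quadrics_row P | P <- s] = [seq r.1.2 | r <- t] by rewrite -map_comp.
rewrite -(@rdet_block R 6 4) ?size_map // map_cat.
congr (rdet (_ ++ _)).
  rewrite -[LHS]map_comp -[RHS]map_comp; apply: eq_map => P /=; have [z Ez] := cl P.
  rewrite Ez; congr (@row_mx R 1 6 4 _ _); apply/rowP => j; rewrite mxE Ez.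
  by rewrite [RHS](row_mxEr (_ : 'rV_6) _ 0 j).
rewrite -[LHS]map_comp; apply: (@eq_from_nth _ 0).
  by rewrite size_map [RHS]size_map size_enum_ord -dl size_drop szl.
move=> i; rewrite size_map -dl size_drop szl => lti.
rewrite (nth_map 0%N) ?size_drop ?szl //= nth_drop.
rewrite (nth_map (Ordinal lti)) ?size_enum_ord //=.
have mem6 : nth 0%N l (6 + i) \in l by rewrite mem_nth // szl; lia.
rewrite colpick_unit_row // ?index_uniq ?szl //; last exact: (allP ltl).
rewrite (nth_ord_enum (Ordinal lti) (Ordinal lti)).
apply/rowP => j; rewrite !mxE; case: splitP => m -> /=.
  by rewrite !mxE; case: eqP => // ?; have := ltn_ord m; lia.
by rewrite !mxE eqxx /= eqn_add2l.
Qed.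
End NormalForm.

Section NormalFormConics.
Variable R : comNzRingType.
Variables P4 P5 P6 P7 P8 : 'rV[R]_3.
Let e k : 'rV[R]_3 := delta_mx 0 k.
Let Ps := [:: e 0; e 1; e 2; P4; P5; P6; P7; P8].

Lemma row_mx_list m n (a b : seq R) : size a = m ->
  row_mx (\row_(j < m) a`_j) (\row_(j < n) b`_j) = \row_(j < m + n) (a ++ b)`_j.
Proof.
move=> sza; apply/rowP => j; rewrite !mxE nth_cat sza.
case: splitP => k jk; rewrite mxE jk /= ?ltn_ord //.
by rewrite addKn ?ltnNge ?leq_addr.
Qed.

Lemma Cdet_divisible (k : 'I_3) l (s : seq 'rV[R]_3) :
  size s = 6%N -> uniq l -> size l = 10%N -> all (fun i => i < 10)%N l ->
  (forall P : 'rV[R]_3, let x := P 0 0 in let y := P 0 1 in let z := P 0 2 in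
    take 6 [seq nth 0 [:: x ^+ 3; x ^+ 2 * y; x ^+ 2 * z; x * y ^+ 2; x * y * z;
              x * z ^+ 2; y ^+ 3; y ^+ 2 * z; y * z ^+ 2; z ^+ 3] i | i <- l] =
    [:: P 0 k * x ^+ 2; P 0 k * (x * y); P 0 k * (x * z); P 0 k * y ^+ 2;
        P 0 k * (y * z); P 0 k * z ^+ 2]) ->
  rdet ([seq cubics_row P | P <- s] ++ [seq unit_row R 10 i | i <- drop 6 l])
    * zeval 0 (zdet 10 (colmx 10 l)) =
  \prod_(P <- s) P 0 k * rdet [seq quadrics_row P | P <- s].
Proof.
move=> szs ul szl ltl El; apply: rdet_divisible => // P.
pose x := P 0 0; pose y := P 0 1; pose z := P 0 2.
pose a := [:: x ^+ 3; x ^+ 2 * y; x ^+ 2 * z; x * y ^+ 2; x * y * z;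
              x * z ^+ 2; y ^+ 3; y ^+ 2 * z; y * z ^+ 2; z ^+ 3].
exists (\row_j (drop 6 (map (nth 0 a) l))`_j); rewrite colpickE //.
have -> : P 0 k *: quadrics_row P = \row_(j < 6) (take 6 (map (nth 0 a) l))`_j.
  by rewrite El; apply/rowP => j; rewrite !mxE; case: j; do 6?[case => [?|]].
by rewrite row_mx_list ?cat_take_drop // size_take size_map szl.
Qed.

Let rowsE := (cubics_row_e0 R, cubics_row_e1 R, cubics_row_e2 R).

Ltac prods := rewrite !big_cons big_nil !mxE /= !mulr1 !mul1r ?mulrA.

(** The monomials free of x are y^3, y^2 z, y z^2, z^3. The coordinate points on x = 0 already
    contribute the unit rows of y^3 and z^3, so the minor has to provide those of y^2 z and y
    z^2. *)
Lemma Cdet_e0 : P4 0 0 * P5 0 0 * P6 0 0 * P7 0 0 * P8 0 0 * Cdet (e 0) P4 P5 P6 P7 P8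
  = cubics_minor Ps 7 8.
Proof.
have := @Cdet_divisible 0 [:: 0; 1; 2; 3; 4; 5; 6; 7; 8; 9]%N [:: e 0; P4; P5; P6; P7; P8] erefl erefl erefl erefl.
set d := zdet _ _; have -> : d = [:: 1%bZ] by vm_compute.
have -> : P4 0 0 * P5 0 0 * P6 0 0 * P7 0 0 * P8 0 0 = \prod_(P <- [:: e 0; P4; P5; P6; P7; P8]) P 0 0 by prods.
rewrite /Cdet -/(rdet [seq quadrics_row P | P <- [:: e 0; P4; P5; P6; P7; P8]]).
move=> H; rewrite -H => [|P /=]; last by do 6![apply: (congr2 cons); first by ring].
rewrite /cubics_minor [in LHS]/= [in RHS]/= !rowsE {H}.
set c4 := cubics_row P4; set c5 := cubics_row P5; set c6 := cubics_row P6.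
set c7 := cubics_row P7; set c8 := cubics_row P8; set u := unit_row R 10.
rewrite (@rdet_move R 10 [:: u 0%N] [:: u 9%N; c4; c5; c6; c7; c8] [:: u 7%N; u 8%N] (u 6%N)) //=.
rewrite (@rdet_move R 10 [:: u 0%N] [:: c4; c5; c6; c7; c8; u 6%N; u 7%N; u 8%N] [::] (u 9%N)) //=.
by rewrite [zint _ _](_ : _ = 1) //; ring.
Qed.

Lemma Cdet_e1 : P4 0 1 * P5 0 1 * P6 0 1 * P7 0 1 * P8 0 1 * Cdet (e 1) P4 P5 P6 P7 P8
  = - cubics_minor Ps 2 5.
Proof.
have := @Cdet_divisible 1 [:: 1; 3; 4; 6; 7; 8; 0; 2; 5; 9]%N [:: e 1; P4; P5; P6; P7; P8] erefl erefl erefl erefl.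
set d := zdet _ _; have -> : d = [:: 1%bZ] by vm_compute.
have -> : P4 0 1 * P5 0 1 * P6 0 1 * P7 0 1 * P8 0 1 = \prod_(P <- [:: e 1; P4; P5; P6; P7; P8]) P 0 1 by prods.
rewrite /Cdet -/(rdet [seq quadrics_row P | P <- [:: e 1; P4; P5; P6; P7; P8]]).
move=> H; rewrite -H => [|P /=]; last by do 6![apply: (congr2 cons); first by ring].
rewrite /cubics_minor [in LHS]/= [in RHS]/= !rowsE {H}.
set c4 := cubics_row P4; set c5 := cubics_row P5; set c6 := cubics_row P6.
set c7 := cubics_row P7; set c8 := cubics_row P8; set u := unit_row R 10.
rewrite (@rdet_move R 10 [::] [:: u 6%N; u 9%N; c4; c5; c6; c7; c8] [:: u 2%N; u 5%N] (u 0%N)) //=.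
rewrite (@rdet_move R 10 [:: u 6%N] [:: c4; c5; c6; c7; c8; u 0%N; u 2%N; u 5%N] [::] (u 9%N)) //=.
by rewrite [zint _ _](_ : _ = 1) //; ring.
Qed.

Lemma Cdet_e2 : P4 0 2 * P5 0 2 * P6 0 2 * P7 0 2 * P8 0 2 * Cdet (e 2) P4 P5 P6 P7 P8
  = cubics_minor Ps 1 3.
Proof.
have := @Cdet_divisible 2 [:: 2; 4; 5; 7; 8; 9; 0; 1; 3; 6]%N [:: e 2; P4; P5; P6; P7; P8] erefl erefl erefl erefl.
set d := zdet _ _; have -> : d = [:: 1%bZ] by vm_compute.
have -> : P4 0 2 * P5 0 2 * P6 0 2 * P7 0 2 * P8 0 2 = \prod_(P <- [:: e 2; P4; P5; P6; P7; P8]) P 0 2 by prods.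
rewrite /Cdet -/(rdet [seq quadrics_row P | P <- [:: e 2; P4; P5; P6; P7; P8]]).
move=> H; rewrite -H => [|P /=]; last by do 6![apply: (congr2 cons); first by ring].
rewrite /cubics_minor [in LHS]/= [in RHS]/= !rowsE {H}.
set c4 := cubics_row P4; set c5 := cubics_row P5; set c6 := cubics_row P6.
set c7 := cubics_row P7; set c8 := cubics_row P8; set u := unit_row R 10.
rewrite (@rdet_move R 10 [::] [:: u 6%N; u 9%N; c4; c5; c6; c7; c8] [:: u 1%N; u 3%N] (u 0%N)) //=.
rewrite (@rdet_move R 10 [::] [:: u 9%N; c4; c5; c6; c7; c8; u 0%N; u 1%N; u 3%N] [::] (u 6%N)) //=.
by rewrite [zint _ _](_ : _ = 1) //; ring.
Qed.

End NormalFormConics.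

(** * Elimination: the sextic of two cubics *)

Section TopCoefficient.
Variable R : idomainType.
Implicit Types p q : {poly R}.

Lemma coefM_top m n p q : (size p <= m.+1)%N -> (size q <= n.+1)%N ->
  (p * q)`_(m + n) = p`_m * q`_n.
Proof.
move=> szp szq; have lt : (m < (m + n).+1)%N by rewrite ltnS leq_addr.
rewrite coefM (bigD1 (Ordinal lt)) //= addKn big1 ?addr0 // => i ne.
have {}ne : (i != m :> nat) by rewrite -(inj_eq val_inj) in ne.
case: (ltnP m i) => mi; first by rewrite (nth_default _ (leq_trans szp mi)) mul0r.
by rewrite (nth_default 0 (_ : size q <= m + n - i)%N) ?mulr0 //; lia.
Qed.

Lemma size_polyM_leq m n p q : (size p <= m.+1)%N -> (size q <= n.+1)%N ->
  (size (p * q)%R <= (m + n).+1)%N.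
Proof. by move=> szp szq; apply: leq_trans (size_polyMleq _ _) _; lia. Qed.

End TopCoefficient.

Section SimpleRoots.
Variable K : fieldType.
Implicit Types (p : {poly K}) (rs : seq K).

Lemma deriv_simple_root rs r t : uniq rs -> t \in rs -> r != 0 ->
  (r *: \prod_(s <- rs) ('X - s%:P))^`().[t] != 0.
Proof.
move=> urs trs r0; rewrite (big_rem t) //= derivZ derivM derivXsubC mul1r.
rewrite !hornerE subrr mul0r addr0 mulf_neq0 // horner_prod.
rewrite prodf_seq_neq0; apply/allP => s srem /=; rewrite hornerXsubC subr_eq0.
by apply: contraTneq srem => <-; rewrite mem_rem_uniq // inE eqxx.
Qed.

(* Vieta: the last root is read off the constant and leading coefficients.     *)
Lemma last_root n p rs : size rs = n -> (size p <= n.+2)%N -> uniq rs ->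
  all (root p) rs -> p`_n.+1 != 0 -> 0 \notin rs ->
  let t := (-1) ^+ n.+1 * p`_0 / (p`_n.+1 * \prod_(s <- rs) s) in
  p = p`_n.+1 *: \prod_(s <- t :: rs) ('X - s%:P).
Proof.
move=> szr szp urs rootp lead0 rs0 t.
have urs' : uniq_roots rs by rewrite uniq_rootsE.
have /dvdpP[q Ep] := uniq_roots_dvdp rootp urs'.
set P := \prod_(s <- rs) _ in Ep.
have mP : P \is monic by apply: monic_prod_XsubC.
have szP : size P = n.+1 by rewrite size_prod_XsubC szr.
have p0 : p != 0 by apply: contraNneq lead0 => ->; rewrite coef0.
have szq : (size q <= 2)%N.
  have q0 : q != 0 by apply: contraNneq p0; rewrite Ep => ->; rewrite mul0r.
  by move: szp; rewrite Ep size_Mmonic // szP; lia.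
have Eq : q = p`_n.+1 *: 'X + (q`_0)%:P.
  have -> : p`_n.+1 = q`_1.
    rewrite Ep -add1n coefM_top ?szP //.
    have -> : P`_n = lead_coef P by rewrite lead_coefE szP.
    by rewrite (monicP mP) mulr1.
  apply/polyP => i; rewrite coefD coefZ coefX coefC.
  case: i => [|[|i]] /=; rewrite ?mulr1 ?mulr0 ?addr0 ?add0r //.
  by rewrite nth_default // (leq_trans szq).
have P0 : P`_0 = (-1) ^+ n * \prod_(s <- rs) s.
  rewrite -horner_coef0 horner_prod -szr; elim: (rs) => [|s l IH] /=.
    by rewrite !big_nil mulr1.
  by rewrite !big_cons IH hornerXsubC exprS; ring.
have prod0 : \prod_(s <- rs) s != 0.
  by rewrite prodf_seq_neq0; apply/allP => s srs /=; apply: contraNneq rs0 => <-.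
have q0E : q`_0 = - (p`_n.+1 * t).
  have : p`_0 = q`_0 * P`_0 by rewrite Ep coef0M.
  rewrite P0 /t exprS; set s := (-1) ^+ n => ->.
  have ss : s * s = 1 by rewrite /s -exprD addnn -signr_odd odd_double.
  transitivity (q`_0 * (s * s)); first by rewrite ss mulr1.
  by field; rewrite lead0 prod0.
rewrite big_cons {1}Ep {1}Eq q0E -/P.
by rewrite -!mul_polyC rmorphN rmorphM /=; ring.
Qed.
End SimpleRoots.

(* A cubic x (a1 x y + a2 x z + e y z) + b1 x y^2 + b2 y^2 z + c1 x z^2 + c2 y z^2 *)
(* through the coordinate points is quadratic in z; in the chart y = 1, x = 'X *)
(* the resultant of two of them with respect to z is 'X * sextic.              *)
Section Sextic.
Variable K : fieldType.
Variables a1 a2 b1 b2 c1 c2 e a1' a2' b1' b2' c1' c2' e' : K.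

Definition cubic3 (a1 a2 b1 b2 c1 c2 e t z : K) : K :=
  a1 * t ^+ 2 + a2 * t ^+ 2 * z + b1 * t + b2 * z + c1 * t * z ^+ 2 + c2 * z ^+ 2
  + e * t * z.

Let f := cubic3 a1 a2 b1 b2 c1 c2 e.
Let g := cubic3 a1' a2' b1' b2' c1' c2' e'.

Definition cubic3_dt (a1 a2 b1 b2 c1 c2 e t z : K) : K :=
  2 * a1 * t + 2 * a2 * t * z + b1 + c1 * z ^+ 2 + e * z.

Definition cubic3_dz (a1 a2 b1 b2 c1 c2 e t z : K) : K :=
  a2 * t ^+ 2 + b2 + 2 * c1 * t * z + 2 * c2 * z + e * t.

Definition jacobian3 t z : K :=
  cubic3_dt a1 a2 b1 b2 c1 c2 e t z * cubic3_dz a1' a2' b1' b2' c1' c2' e' t z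
  - cubic3_dt a1' a2' b1' b2' c1' c2' e' t z * cubic3_dz a1 a2 b1 b2 c1 c2 e t z.

(** Read as a quadratic in z, f is A2 z^2 + A1 z + t A0, where the factor t reflects that f vanishes
    at the origin of the chart; similarly g is B2 z^2 + B1 z + t B0. The polynomials u, v, w are 2 x
    2 minors of these coefficients. *)
Let A2 : {poly K} := Poly [:: c2; c1].
Let A1 : {poly K} := Poly [:: b2; e; a2].
Let A0 : {poly K} := Poly [:: b1; a1].
Let B2 : {poly K} := Poly [:: c2'; c1'].
Let B1 : {poly K} := Poly [:: b2'; e'; a2'].
Let B0 : {poly K} := Poly [:: b1'; a1'].
Let u := A2 * B0 - A0 * B2.
Let v := A1 * B2 - A2 * B1.
Let w := A0 * B1 - A1 * B0.

Definition sextic : {poly K} := 'X * u ^+ 2 - v * w.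

Let szA2 : (size A2 <= 2)%N. Proof. exact: size_Poly. Qed.
Let szA1 : (size A1 <= 3)%N. Proof. exact: size_Poly. Qed.
Let szA0 : (size A0 <= 2)%N. Proof. exact: size_Poly. Qed.
Let szB2 : (size B2 <= 2)%N. Proof. exact: size_Poly. Qed.
Let szB1 : (size B1 <= 3)%N. Proof. exact: size_Poly. Qed.
Let szB0 : (size B0 <= 2)%N. Proof. exact: size_Poly. Qed.

Let size_sub n (p q : {poly K}) : (size p <= n)%N -> (size q <= n)%N ->
  (size (p - q)%R <= n)%N.
Proof.
move=> szp szq; rewrite (leq_trans (size_polyD _ _)) // size_polyN geq_max.
by rewrite szp szq.
Qed.

Let szu : (size u <= 3)%N.
Proof.
by apply: size_sub; [apply: (@size_polyM_leq _ 1 1) | apply: (@size_polyM_leq _ 1 1)].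
Qed.
Let szv : (size v <= 4)%N.
Proof.
by apply: size_sub; [apply: (@size_polyM_leq _ 2 1) | apply: (@size_polyM_leq _ 1 2)].
Qed.
Let szw : (size w <= 4)%N.
Proof.
by apply: size_sub; [apply: (@size_polyM_leq _ 1 2) | apply: (@size_polyM_leq _ 2 1)].
Qed.
Let szu2 : (size (u ^+ 2) <= 5)%N.
Proof. by rewrite expr2; apply: (@size_polyM_leq _ 2 2). Qed.

Lemma size_sextic : (size sextic <= 7)%N.
Proof.
apply: size_sub; last exact: (@size_polyM_leq _ 3 3).
by apply: leq_trans (@size_polyM_leq _ 1 4 _ _ _ _) _; rewrite ?size_polyX.
Qed.

Lemma sextic0 : sextic`_0 = - ((b1 * b2' - b1' * b2) * (b2 * c2' - b2' * c2)).
Proof. by rewrite coefB coefXM !coef0M !coefB !coef0M !coef_Poly /=; ring. Qed.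

(** Since u has degree at most 2, the summand ['X * u ^+ 2] does not reach degree 6. *)
Lemma sextic6 : sextic`_6 = - ((a1 * a2' - a1' * a2) * (a2 * c1' - a2' * c1)).
Proof.
rewrite coefB coefXM nth_default ?(leq_trans szu2) //=.
rewrite (@coefM_top _ 3 3) // [v`_3]coefB [w`_3]coefB.
rewrite (@coefM_top _ 2 1 A1) // (@coefM_top _ 1 2 A2) // (@coefM_top _ 1 2 A0) //.
by rewrite (@coefM_top _ 2 1 A1 B0) // !coef_Poly /=; ring.
Qed.

Let hA2 t : A2.[t] = c1 * t + c2. Proof. by rewrite horner_Poly /=; ring. Qed.
Let hA1 t : A1.[t] = a2 * t ^+ 2 + e * t + b2. Proof. by rewrite horner_Poly /=; ring. Qed.
Let hA0 t : A0.[t] = a1 * t + b1. Proof. by rewrite horner_Poly /=; ring. Qed.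
Let hB2 t : B2.[t] = c1' * t + c2'. Proof. by rewrite horner_Poly /=; ring. Qed.
Let hB1 t : B1.[t] = a2' * t ^+ 2 + e' * t + b2'. Proof. by rewrite horner_Poly /=; ring. Qed.
Let hB0 t : B0.[t] = a1' * t + b1'. Proof. by rewrite horner_Poly /=; ring. Qed.

Let fE t z : f t z = A2.[t] * z ^+ 2 + A1.[t] * z + t * A0.[t].
Proof. by rewrite hA2 hA1 hA0 /f /cubic3; ring. Qed.
Let gE t z : g t z = B2.[t] * z ^+ 2 + B1.[t] * z + t * B0.[t].
Proof. by rewrite hB2 hB1 hB0 /g /cubic3; ring. Qed.

Let dlin (c0 d0 t : K) : (Poly [:: c0; d0])^`().[t] = d0.
Proof. by rewrite /= !cons_poly_def !derivE !hornerE; ring. Qed.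
Let dquad (c0 d0 e0 t : K) : (Poly [:: c0; d0; e0])^`().[t] = 2 * e0 * t + d0.
Proof. by rewrite /= !cons_poly_def !derivE !hornerE; ring. Qed.

Let uE t : u.[t] = A2.[t] * B0.[t] - A0.[t] * B2.[t].
Proof. by rewrite hornerD hornerN !hornerM. Qed.
Let vE t : v.[t] = A1.[t] * B2.[t] - A2.[t] * B1.[t].
Proof. by rewrite hornerD hornerN !hornerM. Qed.
Let wE t : w.[t] = A0.[t] * B1.[t] - A1.[t] * B0.[t].
Proof. by rewrite hornerD hornerN !hornerM. Qed.

(** Eliminate z^2, respectively z, between the two quadratics. *)
Let common_zero t z : f t z = 0 -> g t z = 0 ->
  t * u.[t] = v.[t] * z /\ t * w.[t] = v.[t] * z ^+ 2.
Proof.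
move=> f0 g0; rewrite uE vE wE; split; apply/eqP; rewrite -subr_eq0; apply/eqP.
  transitivity (A2.[t] * g t z - B2.[t] * f t z); last by rewrite f0 g0; ring.
  by rewrite fE gE; ring.
transitivity (B1.[t] * f t z - A1.[t] * g t z); last by rewrite f0 g0; ring.
by rewrite fE gE; ring.
Qed.

Let sexticE t : sextic.[t] = t * u.[t] ^+ 2 - v.[t] * w.[t].
Proof.
rewrite /sextic; move: u v w => p q r.
by rewrite !(hornerD, hornerN, hornerM, hornerX, horner_exp).
Qed.

Lemma root_sextic t z : t != 0 -> f t z = 0 -> g t z = 0 -> root sextic t.
Proof.
move=> t0 f0 g0; have [uz wz] := common_zero f0 g0.
apply/eqP; apply: (mulfI t0); rewrite mulr0 sexticE.
transitivity ((t * u.[t]) ^+ 2 - v.[t] * (t * w.[t])); first by ring.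
by rewrite uz wz; ring.
Qed.

(** After multiplication by t the vanishing value t u^2 - v w is added once, so that u and w occur
    in the combinations t u and t w controlled by [common_zero]. *)
Let deriv_sextic t : root sextic t -> t * sextic^`().[t] =
  2 * (t * u.[t]) * (u.[t] + t * u^`().[t]) - v^`().[t] * (t * w.[t])
  - v.[t] * (w.[t] + t * w^`().[t]).
Proof.
move=> /rootP; rewrite sexticE /sextic; move: u v w => p q r rt.
rewrite expr2 derivB !derivM derivX !(hornerD, hornerN, hornerM, hornerX, hornerC).
apply/eqP; rewrite -subr_eq0; apply/eqP.
by transitivity (- (t * p.[t] ^+ 2 - q.[t] * r.[t])); [ring | rewrite rt oppr0].
Qed.

(** Up to the factor v, the derivative of the eliminant at a projected common zero is the Jacobian
    of the two curves there. *)
Lemma jacobian_sextic t z : t != 0 -> f t z = 0 -> g t z = 0 ->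
  t * sextic^`().[t] = - (v.[t] * jacobian3 t z).
Proof.
move=> t0 f0 g0; have [uz wz] := common_zero f0 g0.
rewrite deriv_sextic ?(root_sextic t0 f0 g0) // wz uz.
apply/eqP; rewrite -subr_eq0; apply/eqP.
(* The two sides differ by a combination of f and g whose cofactors are v times the mixed second
   derivatives in t and z: [F2] is that of g, [G2] that of f. *)
pose F2 := 2 * z * c1' + 2 * a2' * t + e'; pose G2 := 2 * z * c1 + 2 * a2 * t + e.
transitivity (- v.[t] * (F2 * f t z - G2 * g t z)); last by rewrite f0 g0; ring.
rewrite /F2 /G2 /jacobian3 /cubic3_dt /cubic3_dz /f /g /cubic3.
rewrite uE vE wE.
have -> : u^`().[t] = A2^`().[t] * B0.[t] + A2.[t] * B0^`().[t]
    - (A0^`().[t] * B2.[t] + A0.[t] * B2^`().[t]).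
  by rewrite /u derivB !derivM !(hornerD, hornerN, hornerM).
have -> : v^`().[t] = A1^`().[t] * B2.[t] + A1.[t] * B2^`().[t]
    - (A2^`().[t] * B1.[t] + A2.[t] * B1^`().[t]).
  by rewrite /v derivB !derivM !(hornerD, hornerN, hornerM).
have -> : w^`().[t] = A0^`().[t] * B1.[t] + A0.[t] * B1^`().[t]
    - (A1^`().[t] * B0.[t] + A1.[t] * B0^`().[t]).
  by rewrite /w derivB !derivM !(hornerD, hornerN, hornerM).
rewrite !dlin !dquad hA0 hA1 hA2 hB0 hB1 hB2.
by ring.
Qed.

Lemma sextic_transversal t z : t != 0 -> f t z = 0 -> g t z = 0 ->
  sextic^`().[t] != 0 -> jacobian3 t z != 0.
Proof.
move=> t0 f0 g0; apply: contra_neq => j0; apply: (mulfI t0).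
by rewrite (jacobian_sextic t0 f0 g0) j0 !mulr0 oppr0.
Qed.

(** At a simple root v does not vanish, so t u = v z determines z. *)
Lemma sextic_inj t z z' : t != 0 -> f t z = 0 -> g t z = 0 ->
  f t z' = 0 -> g t z' = 0 -> sextic^`().[t] != 0 -> z = z'.
Proof.
move=> t0 f0 g0 f0' g0' d0.
have v0 : v.[t] != 0.
  apply: contra_neq d0 => v0; apply: (mulfI t0).
  by rewrite (jacobian_sextic t0 f0 g0) v0 mul0r oppr0 mulr0.
have [uz _] := common_zero f0 g0; have [uz' _] := common_zero f0' g0'.
by apply: (mulfI v0); rewrite -uz uz'.
Qed.

(** The lift is z = t u / v. If v were 0 at t, then u would be 0 by the equation of the sextic, and
    then w as well because A2 and B2 have no common root; the derivative of the sextic would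
    vanish. *)
Lemma sextic_lift t : t != 0 -> root sextic t -> sextic^`().[t] != 0 ->
  c1 * c2' - c1' * c2 != 0 -> exists2 z, f t z = 0 & g t z = 0.
Proof.
move=> t0 rt d0 c0.
have id1 : A2.[t] * w.[t] = - (A1.[t] * u.[t] + A0.[t] * v.[t]).
  by rewrite uE vE wE; ring.
have id2 : B2.[t] * w.[t] = - (B1.[t] * u.[t] + B0.[t] * v.[t]).
  by rewrite uE vE wE; ring.
have r0 : t * u.[t] ^+ 2 = v.[t] * w.[t].
  by move/rootP: rt; rewrite sexticE => /eqP; rewrite subr_eq0 => /eqP.
have v0 : v.[t] != 0.
  apply: contra_neq d0 => v0; apply: (mulfI t0); rewrite deriv_sextic // v0.
  have u0 : u.[t] = 0.
    by move/eqP: r0; rewrite v0 mul0r mulf_eq0 (negPf t0) expf_eq0 /= => /eqP.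
  have w0 : w.[t] = 0.
    apply: (mulfI c0); rewrite mulr0.
    transitivity (c1 * (B2.[t] * w.[t]) - c1' * (A2.[t] * w.[t])).
      by rewrite hA2 hB2; ring.
    by rewrite id1 id2 u0 v0; ring.
  by rewrite u0 w0; ring.
exists (t * u.[t] / v.[t]); apply: (mulfI v0); rewrite mulr0.
  transitivity (t * (A2.[t] * (t * u.[t] ^+ 2 / v.[t])) + t * (A1.[t] * u.[t] + A0.[t] * v.[t])).
    by rewrite fE; field.
  by rewrite r0 [v.[t] * _]mulrC mulfK // id1; ring.
transitivity (t * (B2.[t] * (t * u.[t] ^+ 2 / v.[t])) + t * (B1.[t] * u.[t] + B0.[t] * v.[t])).
  by rewrite gE; field.
by rewrite r0 [v.[t] * _]mulrC mulfK // id2; ring.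
Qed.

End Sextic.

Section Projection.
Variable K : fieldType.
Variables a1 a2 b1 b2 c1 c2 e a1' a2' b1' b2' c1' c2' e' : K.
Let f := cubic3 a1 a2 b1 b2 c1 c2 e.
Let g := cubic3 a1' a2' b1' b2' c1' c2' e'.
Let sx := sextic a1 a2 b1 b2 c1 c2 e a1' a2' b1' b2' c1' c2' e'.

(** The hypothesis on [tN] is Vieta's formula for the sixth root. Six distinct roots of a polynomial
    of degree 6 are all of its roots, and simple. *)
Lemma projection (q : seq (K * K)) (tN : K) :
  let ts := unzip1 q in
  size q = 5%N -> uniq ts -> 0 \notin ts ->
  (forall r, r \in q -> f r.1 r.2 = 0 /\ g r.1 r.2 = 0) ->
  a1 * a2' - a1' * a2 != 0 -> a2 * c1' - a2' * c1 != 0 ->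
  tN * ((a1 * a2' - a1' * a2) * (a2 * c1' - a2' * c1) * \prod_(t <- ts) t) =
    (b1 * b2' - b1' * b2) * (b2 * c2' - b2' * c2) ->
  tN \notin ts ->
  (forall t, t \in tN :: ts -> root sx t /\ sx^`().[t] != 0) /\
  (forall t z, t != 0 -> f t z = 0 -> g t z = 0 -> t \in tN :: ts).
Proof.
move=> ts szq uts ts0 zq ma mc EtN tNts.
pose p6 := - ((a1 * a2' - a1' * a2) * (a2 * c1' - a2' * c1)).
have p60 : p6 != 0 by rewrite oppr_eq0 mulf_neq0.
have lead : sx`_6 = p6 by apply: sextic6.
have prod0 : \prod_(s <- ts) s != 0.
  by rewrite prodf_seq_neq0; apply/allP => s srs /=; apply: contraNneq ts0 => <-.
have roots : all (root sx) ts.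
  apply/allP => _ /mapP[r rq ->]; have [fr gr] := zq r rq.
  apply: root_sextic fr gr; apply: contraNneq ts0 => <-; exact: map_f.
have szts : size ts = 5%N by rewrite size_map.
have /= := @last_root K 5 sx ts szts (size_sextic _ _ _ _ _ _ _ _ _ _ _ _ _ _) uts roots.
rewrite lead => /(_ p60 ts0); rewrite [sx`_0]sextic0.
set t := _ / _; have -> : t = tN.
  apply: (mulIf (mulf_neq0 p60 prod0)); rewrite mulfVK ?mulf_neq0 //.
  transitivity (- (tN * ((a1 * a2' - a1' * a2) * (a2 * c1' - a2' * c1) * \prod_(t <- ts) t))).
    by rewrite EtN; ring.
  by rewrite /p6; ring.
move=> Esx; have us : uniq (tN :: ts) by rewrite /= tNts.
have rootE s : root sx s = (s \in tN :: ts).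
  by rewrite Esx rootZ // root_prod_XsubC.
split=> [s sin|s z s0 fs gs]; last by rewrite -rootE; apply: root_sextic fs gs.
by rewrite rootE sin Esx deriv_simple_root.
Qed.
End Projection.

Lemma solve2 (K : fieldType) (u u' v v' a b : K) :
  u * v' - u' * v != 0 -> u * a + u' * b = 0 -> v * a + v' * b = 0 -> a = 0 /\ b = 0.
Proof.
move=> d0 eu ev; split; apply: (mulfI d0); rewrite mulr0.
  transitivity (v' * (u * a + u' * b) - u' * (v * a + v' * b)); first by ring.
  by rewrite eu ev; ring.
transitivity (u * (v * a + v' * b) - v * (u * a + u' * b)); first by ring.
by rewrite eu ev; ring.
Qed.

Lemma det_mx22 (R : comNzRingType) (A : 'M[R]_2) :
  \det A = A 0 0 * A 1 1 - A 0 1 * A 1 0.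
Proof.
rewrite (expand_det_row _ 0) !big_ord_recl big_ord0 /cofactor !det_mx11 !mxE /=.
rewrite !expr0 expr1 mul1r addr0 mulN1r mulrN.
by congr (_ * A _ _ - A _ _ * A _ _); apply: val_inj.
Qed.

Definition row3 (K : comNzRingType) (x y z : K) : 'rV[K]_3 := \row_j [:: x; y; z]`_j.

Lemma row3E (K : comNzRingType) (Q : 'rV[K]_3) : Q = row3 (Q 0 0) (Q 0 1) (Q 0 2).
Proof.
by apply/rowP => j; rewrite mxE; case: j => -[|[|[|//]]] lt /=; congr (Q _ _);
  apply: val_inj.
Qed.

Definition evalc (K : comNzRingType) (F : 'cV[K]_10) (Q : 'rV[K]_3) : K :=
  (cubics_row Q *m F) 0 0.

(** No nontrivial member of the pencil is singular at Q: the gradients of F and G there are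
    independent, without a choice of chart. *)
Definition meets_transversally (K : comNzRingType) (F G : 'cV[K]_10) (Q : 'rV[K]_3) : Prop :=
  forall a b : K, (forall H, (cubics_polar Q H *m (a *: F + b *: G)) 0 0 = 0) -> a = 0 /\ b = 0.

(** * The pencil through the coordinate points and five others *)

Section NormalPencil.
Variable K : fieldType.
Variables P4 P5 P6 P7 P8 : 'rV[K]_3.
Let e k : 'rV[K]_3 := delta_mx 0 k.
Let ps := [:: P4; P5; P6; P7; P8].
Let Ps := [:: e 0, e 1, e 2 & ps].
Let Cx := Cdet (e 0) P4 P5 P6 P7 P8.
Let Cy := Cdet (e 1) P4 P5 P6 P7 P8.
Let Cz := Cdet (e 2) P4 P5 P6 P7 P8.
Let Dx := Ddet (e 0) (e 1) (e 2) P4 P5 P6 P7 P8.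
Let Dy := Ddet (e 1) (e 2) (e 0) P4 P5 P6 P7 P8.
Let Dz := Ddet (e 2) (e 0) (e 1) P4 P5 P6 P7 P8.
Let N : 'rV[K]_3 := row3 (Cx * Dy * Dz) (Dx * Cy * Dz) (Dx * Dy * Cz).

Hypothesis ps_neq0 : forall P k, P \in ps -> P 0 k != 0.
Hypothesis uniq_xy : uniq [seq P 0 0 / P 0 1 | P : 'rV[K]_3 <- N :: ps].
Hypothesis uniq_xz : uniq [seq P 0 0 / P 0 2 | P : 'rV[K]_3 <- N :: ps].
Hypotheses (Cx0 : Cx != 0) (Cy0 : Cy != 0) (Cz0 : Cz != 0).
Hypotheses (Dx0 : Dx != 0) (Dy0 : Dy != 0) (Dz0 : Dz != 0).

Variables F G : 'cV[K]_10.
Hypothesis FG_full : row_full (row_mx F G).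
Hypothesis F_through : forall P, P \in Ps -> evalc F P = 0.
Hypothesis G_through : forall P, P \in Ps -> evalc G P = 0.

(** The factor 3 in [Ddet_e1] rules out characteristic 3. *)
Let three_neq0 : 3 != 0 :> K.
Proof.
by apply: contraNneq Dy0 => three0; rewrite /Dy Ddet_e1 three0 mul0r.
Qed.

Let cf (H : 'cV[K]_10) k := H (inord k) 0.

Let evalcE (H : 'cV[K]_10) x y z : evalc H (row3 x y z) =
  cf H 0 * x ^+ 3 + cf H 1 * (x ^+ 2 * y) + cf H 2 * (x ^+ 2 * z)
  + cf H 3 * (x * y ^+ 2) + cf H 4 * (x * y * z) + cf H 5 * (x * z ^+ 2)
  + cf H 6 * y ^+ 3 + cf H 7 * (y ^+ 2 * z) + cf H 8 * (y * z ^+ 2) + cf H 9 * z ^+ 3.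
Proof.
rewrite /evalc mxE; rewrite !big_ord_recl big_ord0 !mxE /=.
have E (i : 'I_10) : H i 0 = cf H i by rewrite /cf inord_val.
by rewrite !E /= /bump /=; ring.
Qed.

Let polarE (H : 'cV[K]_10) x y z a b c :
  (cubics_polar (row3 x y z) (row3 a b c) *m H) 0 0 =
  a * (3 * cf H 0 * x ^+ 2 + 2 * cf H 1 * x * y + 2 * cf H 2 * x * z
       + cf H 3 * y ^+ 2 + cf H 4 * y * z + cf H 5 * z ^+ 2)
  + b * (cf H 1 * x ^+ 2 + 2 * cf H 3 * x * y + cf H 4 * x * z
         + 3 * cf H 6 * y ^+ 2 + 2 * cf H 7 * y * z + cf H 8 * z ^+ 2)
  + c * (cf H 2 * x ^+ 2 + cf H 4 * x * y + 2 * cf H 5 * x * z + cf H 7 * y ^+ 2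
         + 2 * cf H 8 * y * z + 3 * cf H 9 * z ^+ 2).
Proof.
rewrite mxE !big_ord_recl big_ord0 !mxE /=.
have E (i : 'I_10) : H i 0 = cf H i by rewrite /cf inord_val.
by rewrite !E /= /bump /=; ring.
Qed.

Let through_e (H : 'cV[K]_10) : (forall P, P \in Ps -> evalc H P = 0) ->
  [/\ cf H 0 = 0, cf H 6 = 0 & cf H 9 = 0].
Proof.
move=> H0; split.
- have := H0 (e 0); rewrite inE eqxx => /(_ isT).
  by rewrite [e 0]row3E evalcE !mxE /= => <-; ring.
- have := H0 (e 1); rewrite !inE eqxx orbT => /(_ isT).
  by rewrite [e 1]row3E evalcE !mxE /= => <-; ring.
- have := H0 (e 2); rewrite !inE eqxx !orbT => /(_ isT).
  by rewrite [e 2]row3E evalcE !mxE /= => <-; ring.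
Qed.

(** The equation in the chart y = 1, with coordinates x / y and z / y. The indices pick the
    coefficients of x^2 y, x^2 z, x y^2, y^2 z, x z^2, y z^2, x y z; [cubic_xz] exchanges y and
    z. *)
Let cubic_xy (H : 'cV[K]_10) :=
  cubic3 (cf H 1) (cf H 2) (cf H 3) (cf H 7) (cf H 5) (cf H 8) (cf H 4).
Let cubic_xz (H : 'cV[K]_10) :=
  cubic3 (cf H 2) (cf H 1) (cf H 5) (cf H 8) (cf H 3) (cf H 7) (cf H 4).

Let eval_xy (H : 'cV[K]_10) x y z : (forall P, P \in Ps -> evalc H P = 0) -> y != 0 ->
  evalc H (row3 x y z) = y ^+ 3 * cubic_xy H (x / y) (z / y).
Proof.
move=> /through_e[h0 h6 h9] y0; rewrite evalcE h0 h6 h9 /cubic_xy /cubic3.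
by field.
Qed.

Let eval_xz (H : 'cV[K]_10) x y z : (forall P, P \in Ps -> evalc H P = 0) -> z != 0 ->
  evalc H (row3 x y z) = z ^+ 3 * cubic_xz H (x / z) (y / z).
Proof.
move=> /through_e[h0 h6 h9] y0; rewrite evalcE h0 h6 h9 /cubic_xz /cubic3.
by field.
Qed.

(** Since Dx is nonzero, the eight points impose independent conditions, and the coefficient vectors
    of F and G form a full-rank solution; [plucker_duality] is applied with two unit rows for C. *)
Let duality : exists2 k : K, k != 0 & forall i j, (i < 10)%N -> (j < 10)%N ->
  cf F i * cf G j - cf F j * cf G i = k * cubics_minor Ps i j.
Proof.
pose A : 'M[K]_(8, 8 + 2) := \matrix_(i < 8) nth 0 [seq cubics_row P | P <- Ps] i.
pose C i j : 'M[K]_(2, 8 + 2) :=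
  \matrix_(k < 2) nth 0 [:: unit_row K 10 i; unit_row K 10 j] k.
have minorE i j : cubics_minor Ps i j = \det (col_mx A (C i j)).
  by rewrite /cubics_minor (@rdet_cat K 8 2).
have freeA : row_free A.
  have U : col_mx A (C 1 2)%N \in unitmx.
    rewrite unitmxE unitfE -minorE; apply: contraNneq Dx0 => m0.
    by rewrite /Dx Ddet_e0 m0 mulr0.
  apply/row_freeP; exists (lsubmx (invmx (col_mx A (C 1 2)%N))).
  have := mulmxV U; set V := invmx _; rewrite -{1}[V]hsubmxK mul_col_row.
  by rewrite scalar_mx_block => /eq_block_mx[].
have AFG : A *m row_mx F G = 0.
  rewrite mul_mx_row -[RHS]row_mx0.
  have through (H : 'cV[K]_10) : (forall P, P \in Ps -> evalc H P = 0) -> A *m H = 0.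
    move=> H0; apply/matrixP => i j; rewrite ord1 [RHS]mxE.
    have lti : (i < size Ps)%N by [].
    have := H0 _ (mem_nth 0 lti); rewrite /evalc.
    suff -> : (A *m H) i 0 = (row i A *m H) 0 0.
      by rewrite rowK (nth_map 0).
    by rewrite -row_mul [RHS]mxE.
  by rewrite !through.
have [k k0 kE] := plucker_duality freeA FG_full AFG.
exists k => // i j lti ltj; rewrite minorE -kE det_mx22.
have cE (H : 'cV[K]_10) (r : 'I_2) : (C i j *m H) r 0 = cf H (nth 0%N [:: i; j] r).
  suff -> : (C i j *m H) r 0 = (row r (C i j) *m H) 0 0.
    rewrite rowK; case: r => -[|[|//]] lt /=; rewrite unit_row_mulmx mxE /cf;
      congr (H _ 0); apply: val_inj; rewrite /= inordK //.
  by rewrite -row_mul [RHS]mxE.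
have colE (H : 'cV[K]_10) (r c : 'I_2) : (forall k, row_mx F G k c = H k 0) ->
    (C i j *m row_mx F G) r c = cf H (nth 0%N [:: i; j] r).
  move=> colH; rewrite -cE [LHS]mxE [RHS]mxE.
  by apply: eq_bigr => l _; congr (_ * _); apply: colH.
have c0 l : row_mx F G l 0 = F l 0.
  by have -> : 0 = @lshift 1 1 0; [apply: val_inj | rewrite row_mxEl].
have c1 l : row_mx F G l 1 = G l 0.
  by have -> : 1 = @rshift 1 1 0; [apply: val_inj | rewrite row_mxEr].
by rewrite !(colE _ _ _ c0) !(colE _ _ _ c1) /=; ring.
Qed.

Let p i j := cf F i * cf G j - cf F j * cf G i.

Let tN := N 0 0 / N 0 1.
Let sN := N 0 0 / N 0 2.
Let ts := [seq P 0 0 / P 0 1 | P : 'rV[K]_3 <- ps].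
Let ss := [seq P 0 0 / P 0 2 | P : 'rV[K]_3 <- ps].

(** The last two equations are Vieta's formula in the two charts: the duality factor occurs squared
    on both sides, and the coordinates split off from the determinants C are absorbed by the product
    of the five known roots. *)
Let pencil_minors : [/\ p 1 2 != 0, p 3 7 != 0 & p 5 8 != 0] /\
  [/\ p 7 8 != 0, p 2 5 != 0 & p 1 3 != 0] /\
  tN * (p 1 2 * p 2 5 * \prod_(t <- ts) t) = p 3 7 * p 7 8 /\
  sN * (p 2 1 * p 1 3 * \prod_(s <- ss) s) = p 5 8 * p 8 7.
Proof.
have [k k0 dual] := duality.
have [H4 H5 H6 H7 H8] : [/\ forall l, P4 0 l != 0, forall l, P5 0 l != 0,
    forall l, P6 0 l != 0, forall l, P7 0 l != 0 & forall l, P8 0 l != 0].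
  by split=> l; apply: ps_neq0; rewrite !inE eqxx ?orbT.
have m12 : cubics_minor Ps 1 2 = - Dx / 3 by rewrite /Dx Ddet_e0; field.
have m37 : cubics_minor Ps 3 7 = Dy / 3 by rewrite /Dy Ddet_e1; field.
have m58 : cubics_minor Ps 5 8 = - Dz / 3 by rewrite /Dz Ddet_e2; field.
have m78 : cubics_minor Ps 7 8 = P4 0 0 * P5 0 0 * P6 0 0 * P7 0 0 * P8 0 0 * Cx.
  by rewrite Cdet_e0.
have m25 : cubics_minor Ps 2 5 = - (P4 0 1 * P5 0 1 * P6 0 1 * P7 0 1 * P8 0 1 * Cy).
  by rewrite Cdet_e1 opprK.
have m13 : cubics_minor Ps 1 3 = P4 0 2 * P5 0 2 * P6 0 2 * P7 0 2 * P8 0 2 * Cz.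
  by rewrite Cdet_e2.
have p12 := dual 1%N 2%N isT isT; have p37 := dual 3%N 7%N isT isT.
have p58 := dual 5%N 8%N isT isT; have p78 := dual 7%N 8%N isT isT.
have p25 := dual 2%N 5%N isT isT; have p13 := dual 1%N 3%N isT isT.
have p21 : p 2 1 = - p 1 2 by rewrite /p; ring.
have p87 : p 8 7 = - p 7 8 by rewrite /p; ring.
rewrite p21 p87 /p p12 p37 p58 p78 p25 p13 m12 m37 m58 m78 m25 m13.
rewrite /ts /ss /ps /= !big_cons big_nil /tN /sN !mxE /=.
rewrite !mulf_neq0 ?oppr_eq0 ?invr_eq0 ?mulf_neq0 //.
do 4?[split=> //]; field; rewrite ?three_neq0 ?Cx0 ?Cy0 ?Cz0 ?Dx0 ?Dy0 ?Dz0 ?H4 ?H5 ?H6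
  ?H7 ?H8 //.
Qed.

Let N_neq0 k : N 0 k != 0.
Proof. by case: k => -[|[|[|//]]] lt; rewrite mxE /= !mulf_neq0. Qed.

Let NPs_neq0 (P : 'rV[K]_3) k : P \in N :: ps -> P 0 k != 0.
Proof. by rewrite inE => /orP[/eqP->|/ps_neq0]. Qed.

Let xy_zero (H : 'cV[K]_10) (P : 'rV[K]_3) : (forall P, P \in Ps -> evalc H P = 0) -> P 0 1 != 0 ->
  evalc H P = 0 -> cubic_xy H (P 0 0 / P 0 1) (P 0 2 / P 0 1) = 0.
Proof.
move=> H0 P1 HP; apply: (mulfI (expf_neq0 3 P1)).
by rewrite mulr0 -eval_xy // -row3E.
Qed.

Let xz_zero (H : 'cV[K]_10) (P : 'rV[K]_3) : (forall P, P \in Ps -> evalc H P = 0) -> P 0 2 != 0 ->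
  evalc H P = 0 -> cubic_xz H (P 0 0 / P 0 2) (P 0 1 / P 0 2) = 0.
Proof.
move=> H0 P1 HP; apply: (mulfI (expf_neq0 3 P1)).
by rewrite mulr0 -eval_xz // -row3E.
Qed.

Let ps_Ps (P : 'rV[K]_3) : P \in ps -> P \in Ps.
Proof. by move=> Pin; rewrite 3!in_cons Pin !orbT. Qed.

Let sx_xy := sextic (cf F 1) (cf F 2) (cf F 3) (cf F 7) (cf F 5) (cf F 8) (cf F 4)
  (cf G 1) (cf G 2) (cf G 3) (cf G 7) (cf G 5) (cf G 8) (cf G 4).
Let sx_xz := sextic (cf F 2) (cf F 1) (cf F 5) (cf F 8) (cf F 3) (cf F 7) (cf F 4)
  (cf G 2) (cf G 1) (cf G 5) (cf G 8) (cf G 3) (cf G 7) (cf G 4).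

Let proj_xy :
  (forall t, t \in tN :: ts -> root sx_xy t /\ sx_xy^`().[t] != 0) /\
  (forall t z, t != 0 -> cubic_xy F t z = 0 -> cubic_xy G t z = 0 -> t \in tN :: ts).
Proof.
have [[p12 p37 p58] [[p78 p25 p13] [EtN EsN]]] := pencil_minors.
pose q := [seq (P 0 0 / P 0 1, P 0 2 / P 0 1) | P : 'rV[K]_3 <- ps].
have Eq : ts = unzip1 q by rewrite /unzip1 -map_comp.
have /andP[tNts uts] : (tN \notin ts) && uniq ts by [].
move: EtN tNts uts; rewrite Eq => EtN tNts uts.
have com i j : cf F i * cf G j - cf G i * cf F j = p i j by rewrite /p; ring.
apply: projection; rewrite ?com //.
  rewrite -Eq; apply/mapP => -[P Pin /eqP].
  by rewrite eq_sym mulf_eq0 invr_eq0 !(negbTE (ps_neq0 _ Pin)).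
move=> _ /mapP[P Pin ->]; split; apply: xy_zero; rewrite ?ps_neq0 //.
  by apply: F_through; apply: ps_Ps.
by apply: G_through; apply: ps_Ps.
Qed.

Let proj_xz :
  (forall t, t \in sN :: ss -> root sx_xz t /\ sx_xz^`().[t] != 0) /\
  (forall t z, t != 0 -> cubic_xz F t z = 0 -> cubic_xz G t z = 0 -> t \in sN :: ss).
Proof.
have [[p12 p37 p58] [[p78 p25 p13] [EtN EsN]]] := pencil_minors.
pose q := [seq (P 0 0 / P 0 2, P 0 1 / P 0 2) | P : 'rV[K]_3 <- ps].
have Eq : ss = unzip1 q by rewrite /unzip1 -map_comp.
have /andP[tNts uts] : (sN \notin ss) && uniq ss by [].
move: EsN tNts uts; rewrite Eq => {}EtN tNts uts.
have com i j : cf F i * cf G j - cf G i * cf F j = p i j by rewrite /p; ring.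
apply: projection; rewrite ?com //.
- rewrite -Eq; apply/mapP => -[P Pin /eqP].
  by rewrite eq_sym mulf_eq0 invr_eq0 !(negbTE (ps_neq0 _ Pin)).
- move=> _ /mapP[P Pin ->]; split; apply: xz_zero; rewrite ?ps_neq0 //.
    by apply: F_through; apply: ps_Ps.
  by apply: G_through; apply: ps_Ps.
- have -> : p 2 1 = - p 1 2 by rewrite /p; ring.
  by rewrite oppr_eq0.
Qed.

(** On the side x = 0 both cubics are y z times a linear form, and the two linear forms are
    independent because [p 7 8] is nonzero. The sides y = 0 and z = 0 use [p 2 5] and [p 1 3]. *)
Let base_side x y z : evalc F (row3 x y z) = 0 -> evalc G (row3 x y z) = 0 ->
  (x = 0 -> y * z = 0) /\ (y = 0 -> x * z = 0) /\ (z = 0 -> x * y = 0).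
Proof.
have [_ [[p78 p25 p13] _]] := pencil_minors.
have [f0 f6 f9] := through_e F_through; have [g0 g6 g9] := through_e G_through.
have mul_eq0 (a b : K) : a * (a * b) = 0 -> a * b = 0.
  by move/eqP; rewrite mulf_eq0 => /orP[/eqP->|/eqP //]; rewrite mul0r.
rewrite !evalcE f0 f6 f9 g0 g6 g9 => eF eG; split; last split=> c0.
- move=> x0; have [||/mul_eq0 //] := @solve2 _ _ _ _ _ (y * (y * z)) (z * (y * z)) p78.
    by rewrite -eF x0; ring.
  by rewrite -eG x0; ring.
- have [||/mul_eq0 //] := @solve2 _ _ _ _ _ (x * (x * z)) (z * (x * z)) p25.
    by rewrite -eF c0; ring.
  by rewrite -eG c0; ring.
- have [||/mul_eq0 //] := @solve2 _ _ _ _ _ (x * (x * y)) (y * (x * y)) p13.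
    by rewrite -eF c0; ring.
  by rewrite -eG c0; ring.
Qed.

Let Z3 : N 0 0 / N 0 1 != 0 :> K.
Proof. by rewrite mulf_neq0 ?invr_eq0. Qed.

(** The simple root tN lifts to a common zero (tN, 1, z), whose x / z is a root in the other chart.
    If that root is sN, the point is N up to scaling. Otherwise it belongs to some P among P4, ...,
    P8; lifts are unique, so the point would be P, although tN differs from x / y at P. *)
Lemma pencil_ninth : evalc F N = 0 /\ evalc G N = 0.
Proof.
have [[_ _ p58] _] := pencil_minors.
have [simple_xy base_xy] := proj_xy; have [simple_xz base_xz] := proj_xz.
have tN_in : tN \in tN :: ts by rewrite inE eqxx.
have [rt dt] := simple_xy _ tN_in.
have p58' : cf F 5 * cf G 8 - cf G 5 * cf F 8 != 0.
  by apply: contra_neq p58 => <-; rewrite /p; ring.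
have [z fz gz] := sextic_lift Z3 rt dt p58'.
have evz (H : 'cV[K]_10) : (forall P, P \in Ps -> evalc H P = 0) ->
    evalc H (row3 tN 1 z) = cubic_xy H tN z.
  by move=> H0; rewrite eval_xy ?oner_neq0 // expr1n mul1r !divr1.
have [eF eG] : evalc F (row3 tN 1 z) = 0 /\ evalc G (row3 tN 1 z) = 0.
  by rewrite !evz.
have z0 : z != 0.
  apply: contra_neq Z3 => z0; have [_ [_ /(_ z0)]] := base_side eF eG.
  by rewrite mulr1.
have s0 : tN / z != 0 by rewrite mulf_neq0 ?invr_eq0.
have zz (H : 'cV[K]_10) : (forall P, P \in Ps -> evalc H P = 0) ->
    evalc H (row3 tN 1 z) = 0 -> cubic_xz H (tN / z) (1 / z) = 0.
  move=> H0; rewrite eval_xz // => /eqP.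
  by rewrite mulf_eq0 expf_eq0 (negbTE z0) andbF => /eqP.
have fz' := zz F F_through eF; have gz' := zz G G_through eG.
have := base_xz _ _ s0 fz' gz'; rewrite inE => /orP[/eqP sE | /mapP[P Pin sE]].
  have zE : z = N 0 2 / N 0 1.
    apply: (mulIf s0); rewrite [z * _]mulrC mulfVK // sE /tN /sN.
    by field; rewrite !N_neq0.
  have HN (H : 'cV[K]_10) : (forall P, P \in Ps -> evalc H P = 0) ->
      cubic_xy H tN z = 0 -> evalc H N = 0.
    by move=> H0 Hz; rewrite [N]row3E eval_xy // -/tN -zE Hz mulr0.
  by split; apply: HN.
have PN k : P 0 k != 0 by apply: ps_neq0.
have PPs := ps_Ps Pin.
have [_ ds] : root sx_xz (tN / z) /\ sx_xz^`().[tN / z] != 0.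
  by apply: simple_xz; rewrite sE inE; apply/orP; right; apply/mapP; exists P.
have yE : 1 / z = P 0 1 / P 0 2.
  apply: sextic_inj ds => //; rewrite sE.
    by apply: (xz_zero F_through) => //; apply: F_through.
  by apply: (xz_zero G_through) => //; apply: G_through.
have tE : tN = P 0 0 / P 0 1.
  transitivity (tN / z / (1 / z)); first by field; rewrite z0 oner_neq0.
  by rewrite sE yE; field; rewrite !PN.
have /andP[/negP[]] : (tN \notin ts) && uniq ts by [].
by rewrite tE; apply/mapP; exists P.
Qed.

(** On the sides of the coordinate triangle only the vertices remain. Elsewhere x / y is one of six
    simple roots, each with a unique lift, and six points with these ratios are already known. *)
Lemma pencil_base X : X != 0 -> evalc F X = 0 -> evalc G X = 0 ->
  exists P c, P \in N :: Ps /\ X = c *: P.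
Proof.
rewrite [X]row3E; move: (X 0 0) (X 0 1) (X 0 2) => x y z X0 eF eG.
have e0E : row3 x 0 0 = x *: e 0.
  by apply/rowP => j; rewrite !mxE; case: j => -[|[|[|//]]] ? /=; ring.
have e1E : row3 0 y 0 = y *: e 1.
  by apply/rowP => j; rewrite !mxE; case: j => -[|[|[|//]]] ? /=; ring.
have e2E : row3 0 0 z = z *: e 2.
  by apply/rowP => j; rewrite !mxE; case: j => -[|[|[|//]]] ? /=; ring.
have [bx [by_ bz]] := base_side eF eG.
have vx : y = 0 -> z = 0 -> exists P c, P \in N :: Ps /\ row3 x y z = c *: P.
  by move=> -> ->; exists (e 0), x; rewrite !inE eqxx orbT.
have vy : x = 0 -> z = 0 -> exists P c, P \in N :: Ps /\ row3 x y z = c *: P.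
  by move=> -> ->; exists (e 1), y; rewrite !inE eqxx !orbT.
have vz : x = 0 -> y = 0 -> exists P c, P \in N :: Ps /\ row3 x y z = c *: P.
  by move=> -> ->; exists (e 2), z; rewrite !inE eqxx !orbT.
have [x0|x0] := eqVneq x 0.
  have /eqP := bx x0; rewrite mulf_eq0 => /orP[/eqP y0|/eqP z0]; first exact: vz.
  exact: vy.
have [y0|y0] := eqVneq y 0.
  by have /eqP := by_ y0; rewrite mulf_eq0 (negbTE x0) => /eqP z0; apply: vx.
have [z0|z0] := eqVneq z 0.
  by have /eqP := bz z0; rewrite mulf_eq0 (negbTE x0) (negbTE y0).
have [simple_xy base_xy] := proj_xy.
have t0 : x / y != 0 by rewrite mulf_neq0 ?invr_eq0.
have zz (H : 'cV[K]_10) : (forall P, P \in Ps -> evalc H P = 0) ->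
    evalc H (row3 x y z) = 0 -> cubic_xy H (x / y) (z / y) = 0.
  move=> H0; rewrite eval_xy // => /eqP.
  by rewrite mulf_eq0 expf_eq0 (negbTE y0) andbF => /eqP.
have fz := zz F F_through eF; have gz := zz G G_through eG.
have tin := base_xy _ _ t0 fz gz.
have /mapP[P Pin tE] : x / y \in [seq P 0 0 / P 0 1 | P : 'rV[K]_3 <- N :: ps] by [].
have PN k : P 0 k != 0 by apply: NPs_neq0.
have PNPs : P \in N :: Ps.
  by move: Pin; rewrite !in_cons => /orP[->//|/ps_Ps]; rewrite !in_cons => ->; rewrite orbT.
have [FP GP] : evalc F P = 0 /\ evalc G P = 0.
  move: PNPs; rewrite in_cons => /orP[/eqP->|PPs]; first exact: pencil_ninth.
  by split; [apply: F_through | apply: G_through].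
have [_ ds] := simple_xy _ tin.
have zE : z / y = P 0 2 / P 0 1.
  apply: sextic_inj ds => //; rewrite tE.
    by apply: (xy_zero F_through).
  by apply: (xy_zero G_through).
exists P, (y / P 0 1); split=> //.
rewrite [in RHS](row3E P); apply/rowP => j; rewrite !mxE.
have xE : x = P 0 0 / P 0 1 * y by rewrite -tE divfK.
have zE' : z = P 0 2 / P 0 1 * y by rewrite -zE divfK.
by case: j => -[|[|[|//]]] ? /=; rewrite ?xE ?zE'; field; rewrite PN.
Qed.

Let cf_lin (a b : K) i : cf (a *: F + b *: G) i = a * cf F i + b * cf G i.
Proof. by rewrite /cf !mxE. Qed.

(** Off the triangle a simple root of the sextic makes the Jacobian nonzero. At a vertex the
    gradients of F and G are two coefficients each, and their determinant is one of [p 1 2],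
    [p 3 7], [p 5 8]. *)
Lemma pencil_transversal P : P \in N :: Ps -> meets_transversally F G P.
Proof.
have [[p12 p37 p58] _] := pencil_minors.
have [f0 f6 f9] := through_e F_through; have [g0 g6 g9] := through_e G_through.
have PNPs : P \in N :: Ps -> evalc F P = 0 /\ evalc G P = 0.
  rewrite in_cons => /orP[/eqP->|PPs]; first exact: pencil_ninth.
  by split; [apply: F_through | apply: G_through].
have com i j : p i j != 0 -> cf F i * cf G j - cf F j * cf G i != 0 by [].
move=> Pin; have [FP GP] := PNPs Pin; move=> a b dH.
have {}dH x y z : (cubics_polar (row3 (P 0 0) (P 0 1) (P 0 2)) (row3 x y z)
    *m (a *: F + b *: G)) 0 0 = 0 by rewrite -row3E.
have dx := dH 1 0 0; have dy := dH 0 1 0; have dz := dH 0 0 1.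
move: dx dy dz; rewrite !polarE !cf_lin f0 f6 f9 g0 g6 g9 => dx dy dz.
have vertex i j : p i j != 0 -> cf F i * a + cf G i * b = 0 ->
    cf F j * a + cf G j * b = 0 -> a = 0 /\ b = 0.
  move=> pij; apply: solve2; apply: contra_neq pij => <-; rewrite /p; ring.
have [Pin'|/negP nPin] := boolP (P \in N :: ps).
  have PN k : P 0 k != 0 by apply: NPs_neq0.
  have [simple_xy _] := proj_xy.
  have [_ ds] : root sx_xy (P 0 0 / P 0 1) /\ sx_xy^`().[P 0 0 / P 0 1] != 0.
    by apply: simple_xy; rewrite /tN /ts -(map_cons (fun P : 'rV[K]_3 => P 0 0 / P 0 1));
      apply/mapP; exists P.
  have t0 : P 0 0 / P 0 1 != 0 by rewrite mulf_neq0 ?invr_eq0.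
  have Fz := xy_zero F_through (PN 1) FP; have Gz := xy_zero G_through (PN 1) GP.
  have := sextic_transversal t0 Fz Gz ds; rewrite /jacobian3 => J0.
  (* The square of the y-coordinate relates the derivatives in the chart y = 1 to the partial
     derivatives of the forms. *)
  apply: (solve2 J0); apply: (mulfI (expf_neq0 2 (PN 1))); rewrite mulr0.
    by rewrite -[RHS]dx /cubic3_dt; field; rewrite PN.
  by rewrite -[RHS]dz /cubic3_dz; field; rewrite PN.
have {Pin nPin} : P \in [:: e 0; e 1; e 2].
  move: Pin nPin; rewrite !in_cons; do 4?[case: (P == _) => //=].
rewrite !inE => /or3P[/eqP PE|/eqP PE|/eqP PE].
- rewrite PE !mxE /= in dy dz; apply: (vertex _ _ p12).
    by rewrite -dy; ring.
  by rewrite -dz; ring.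
- rewrite PE !mxE /= in dx dz; apply: (vertex _ _ p37).
    by rewrite -dx; ring.
  by rewrite -dz; ring.
- rewrite PE !mxE /= in dx dy; apply: (vertex _ _ p58).
    by rewrite -dx; ring.
  by rewrite -dy; ring.
Qed.
End NormalPencil.

(** * Arbitrary coordinates *)

Section NinthNumerator.
Variables (R : comNzRingType) (p : 'I_8 -> 'rV[R]_3).
Let P k := p (inord k).

Definition Cx := Cdet (P 0) (P 3) (P 4) (P 5) (P 6) (P 7).
Definition Cy := Cdet (P 1) (P 3) (P 4) (P 5) (P 6) (P 7).
Definition Cz := Cdet (P 2) (P 3) (P 4) (P 5) (P 6) (P 7).
Definition Dx := Ddet (P 0) (P 1) (P 2) (P 3) (P 4) (P 5) (P 6) (P 7).
Definition Dy := Ddet (P 1) (P 2) (P 0) (P 3) (P 4) (P 5) (P 6) (P 7).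
Definition Dz := Ddet (P 2) (P 0) (P 1) (P 3) (P 4) (P 5) (P 6) (P 7).

Definition numerator : 'rV[R]_3 :=
  (Cx * Dy * Dz) *: P 0 + (Dx * Cy * Dz) *: P 1 + (Dx * Dy * Cz) *: P 2.

(* The open conditions under which the computation of the ninth point in the   *)
(* charts y = 1 and z = 1 succeeds.                                            *)
Record generic_config : Prop := GenericConfig {
  gen_bracket : bracket (P 0) (P 1) (P 2) != 0;
  gen_C : [/\ Cx != 0, Cy != 0 & Cz != 0];
  gen_D : [/\ Dx != 0, Dy != 0 & Dz != 0];
  gen_coord : forall i, (3 <= i < 8)%N -> [/\ bracket (P i) (P 1) (P 2) != 0,
    bracket (P 0) (P i) (P 2) != 0 & bracket (P 0) (P 1) (P i) != 0];
  gen_num : forall i, (3 <= i < 8)%N ->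
    bracket numerator (P i) (P 2) != 0 /\ bracket numerator (P i) (P 1) != 0;
  gen_pair : forall i j, (3 <= i < j)%N -> (j < 8)%N ->
    bracket (P i) (P j) (P 2) != 0 /\ bracket (P i) (P j) (P 1) != 0 }.
End NinthNumerator.

Lemma ninth_formulaE (K : fieldType) (p : 'I_8 -> 'rV[K]_3) :
  ninth_formula p =
  (bracket (p (inord 0)) (p (inord 1)) (p (inord 2)))^-1 *: numerator p.
Proof. by []. Qed.

Section NumeratorMap.
Variables (R S : comNzRingType) (f : {rmorphism R -> S}) (p : 'I_8 -> 'rV[R]_3).
Let fp i := map_mx f (p i).

Lemma Cx_map : Cx fp = f (Cx p). Proof. exact: Cdet_map. Qed.
Lemma Cy_map : Cy fp = f (Cy p). Proof. exact: Cdet_map. Qed.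
Lemma Cz_map : Cz fp = f (Cz p). Proof. exact: Cdet_map. Qed.
Lemma Dx_map : Dx fp = f (Dx p). Proof. exact: Ddet_map. Qed.
Lemma Dy_map : Dy fp = f (Dy p). Proof. exact: Ddet_map. Qed.
Lemma Dz_map : Dz fp = f (Dz p). Proof. exact: Ddet_map. Qed.

Definition CD_map := (Cx_map, Cy_map, Cz_map, Dx_map, Dy_map, Dz_map).

Lemma numerator_map : numerator fp = map_mx f (numerator p).
Proof. by rewrite /numerator !CD_map !map_mxD !map_mxZ !rmorphM. Qed.

(** All conditions say that polynomial expressions in the points are nonzero, so they may be
    verified after a specialization. *)
Lemma generic_config_map :
  (forall r, (f r != 0) -> r != 0) -> generic_config fp -> generic_config p.
Proof.
move=> nz [gb gC gD gco gn gp]; split.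
- by apply: nz; rewrite -bracket_map.
- by case: gC; rewrite !CD_map => ? ? ?; split; apply: nz.
- by case: gD; rewrite !CD_map => ? ? ?; split; apply: nz.
- by move=> i /gco; rewrite /fp !bracket_map => -[? ? ?]; split; apply: nz.
- move=> i /gn; rewrite numerator_map /fp !bracket_map => -[? ?].
  by split; apply: nz.
- by move=> i j lij lj; have := gp i j lij lj; rewrite /fp !bracket_map => -[? ?];
    split; apply: nz.
Qed.

Lemma map_generic_config :
  (forall r, r != 0 -> f r != 0) -> generic_config p -> generic_config fp.
Proof.
move=> nz [gb gC gD gco gn gp]; split.
- by rewrite bracket_map nz.
- by case: gC => ? ? ?; rewrite !CD_map; split; apply: nz.
- by case: gD => ? ? ?; rewrite !CD_map; split; apply: nz.
- by move=> i /gco[? ? ?]; rewrite /fp !bracket_map; split; apply: nz.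
- by move=> i /gn[? ?]; rewrite numerator_map /fp !bracket_map; split; apply: nz.
- by move=> i j lij lj; have [? ?] := gp i j lij lj; rewrite /fp !bracket_map;
    split; apply: nz.
Qed.
End NumeratorMap.

Section BracketTheory.
Variable R : comNzRingType.
Implicit Types Q : 'rV[R]_3.

Lemma bracket_mul g Q1 Q2 Q3 :
  bracket (Q1 *m g) (Q2 *m g) (Q3 *m g) = bracket Q1 Q2 Q3 * \det g.
Proof. by rewrite [RHS](esym (rdet_mulmx [:: Q1; Q2; Q3] g)). Qed.

Lemma bracketE Q1 Q2 Q3 : bracket Q1 Q2 Q3 =
  Q1 0 0 * (Q2 0 1 * Q3 0 2 - Q2 0 2 * Q3 0 1)
  - Q1 0 1 * (Q2 0 0 * Q3 0 2 - Q2 0 2 * Q3 0 0)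
  + Q1 0 2 * (Q2 0 0 * Q3 0 1 - Q2 0 1 * Q3 0 0).
Proof.
rewrite /bracket (expand_det_row _ 0) sum3 /cofactor !det_mx22 !mxE /=.
have E0 : (1 : 'I_3) = lift 0 (0 : 'I_2) by apply: val_inj.
have l00 : lift 0 0 = 1 :> 'I_3 by apply: val_inj.
have l01 : lift 0 1 = 2 :> 'I_3 by apply: val_inj.
have l10 : lift 1 0 = 0 :> 'I_3 by apply: val_inj.
have l11 : lift 1 1 = 2 :> 'I_3 by apply: val_inj.
have l20 : lift 2 0 = 0 :> 'I_3 by apply: val_inj.
have l21 : lift 2 1 = 1 :> 'I_3 by apply: val_inj.
by rewrite !l00 !l01 !l10 !l11 !l20 !l21 /= /bump /=; ring.
Qed.

Lemma bracket_scale a Q1 Q2 Q3 : bracket (a *: Q1) Q2 Q3 = a * bracket Q1 Q2 Q3.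
Proof. by rewrite !bracketE !mxE; ring. Qed.
End BracketTheory.

Section GeneralCoordinates.
Variables (K : fieldType) (p : 'I_8 -> 'rV[K]_3).

(** Each summand has one factor C, scaled by l = [\det (Sym2 g)], and two factors D, scaled by m =
    [\det (Sym3 g) / \det g]. *)
Lemma numerator_mul g : g \in unitmx -> exists2 l, l != 0 &
  exists2 m, m != 0 &
  [/\ [/\ Cx (fun i => p i *m g) = l * Cx p, Cy (fun i => p i *m g) = l * Cy p
        & Cz (fun i => p i *m g) = l * Cz p],
      [/\ Dx (fun i => p i *m g) = m * Dx p, Dy (fun i => p i *m g) = m * Dy p
        & Dz (fun i => p i *m g) = m * Dz p]
    & numerator (fun i => p i *m g) = (l * m ^+ 2) *: (numerator p *m g)].
Proof.
move=> gu; have d0 : \det g != 0 by move: gu; rewrite unitmxE unitfE.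
have S0 : \det (Sym3 g) != 0 by move: (Sym3_unit gu); rewrite unitmxE unitfE.
exists (\det (Sym2 g)); first exact: det_Sym2_neq0.
exists (\det (Sym3 g) / \det g); first by rewrite mulf_neq0 ?invr_eq0.
have C Q1 Q2 Q3 Q4 Q5 Q6 : Cdet (Q1 *m g) (Q2 *m g) (Q3 *m g) (Q4 *m g) (Q5 *m g)
    (Q6 *m g) = \det (Sym2 g) * Cdet Q1 Q2 Q3 Q4 Q5 Q6 by rewrite Cdet_mul mulrC.
have D Q1 Q2 Q3 Q4 Q5 Q6 Q7 Q8 : Ddet (Q1 *m g) (Q2 *m g) (Q3 *m g) (Q4 *m g)
    (Q5 *m g) (Q6 *m g) (Q7 *m g) (Q8 *m g) =
    \det (Sym3 g) / \det g * Ddet Q1 Q2 Q3 Q4 Q5 Q6 Q7 Q8.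
  apply: (mulfI d0); rewrite Ddet_mul; by field.
split; [split; exact: C | split; exact: D |].
rewrite /numerator /Cx /Cy /Cz /Dx /Dy /Dz !C !D !mulmxDl -!scalemxAl !scalerDr.
by rewrite !scalerA; congr (_ *: _ + _ *: _ + _ *: _); ring.
Qed.

Lemma generic_config_mul g : g \in unitmx -> generic_config p ->
  generic_config (fun i => p i *m g).
Proof.
move=> gu [gb gC gD gco gn gp].
have d0 : \det g != 0 by move: gu; rewrite unitmxE unitfE.
have [l l0 [m m0 [[Ex Ey Ez] [Fx Fy Fz] EN]]] := numerator_mul gu.
split.
- by rewrite bracket_mul mulf_neq0.
- by case: gC => ? ? ?; rewrite Ex Ey Ez !mulf_neq0.
- by case: gD => ? ? ?; rewrite Fx Fy Fz !mulf_neq0.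
- by move=> i /gco[? ? ?]; rewrite !bracket_mul !mulf_neq0.
- move=> i /gn[? ?]; rewrite EN !bracket_scale !bracket_mul.
  by rewrite !mulf_neq0 ?expf_neq0.
- by move=> i j lij lj; have [? ?] := gp i j lij lj; rewrite !bracket_mul !mulf_neq0.
Qed.
End GeneralCoordinates.

Lemma ord3P (P : 'I_3 -> Prop) : P 0 -> P 1 -> P 2 -> forall i, P i.
Proof.
by move=> P0 P1 P2 [[|[|[|//]]] lt]; [have -> : Ordinal lt = 0 | have -> : Ordinal lt = 1
  | have -> : Ordinal lt = 2] => //; apply: val_inj.
Qed.

Lemma ord8P (P : 'I_8 -> Prop) : P (inord 0) -> P (inord 1) -> P (inord 2) ->
  (forall k, (3 <= k < 8)%N -> P (inord k)) -> forall i, P i.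
Proof.
move=> P0 P1 P2 Pk i; rewrite -(inord_val i).
by case: i => -[|[|[|k]]] lt //; apply: Pk.
Qed.

Lemma evalc_scale (R : comNzRingType) (H : 'cV[R]_10) a Q :
  evalc H (a *: Q) = a ^+ 3 * evalc H Q.
Proof.
have E : cubics_row (a *: Q) = a ^+ 3 *: cubics_row Q.
  by apply/rowP => -[]; do 10?[case => [?|]] => //=; rewrite !mxE /=; ring.
by rewrite /evalc E -scalemxAl mxE.
Qed.

Lemma cubics_polar_scale (R : comNzRingType) a (Q H : 'rV[R]_3) :
  cubics_polar (a *: Q) H = a ^+ 2 *: cubics_polar Q H.
Proof.
by apply/rowP => -[]; do 10?[case => [?|]] => //=; rewrite !mxE /=; ring.
Qed.

Section GeneralPencil.
Variables (K : fieldType) (p : 'I_8 -> 'rV[K]_3).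
Hypothesis gp : generic_config p.
Variables F G : 'cV[K]_10.
Hypothesis FG_full : row_full (row_mx F G).
Hypothesis F_through : forall i, evalc F (p i) = 0.
Hypothesis G_through : forall i, evalc G (p i) = 0.

Let base (X : 'rV[K]_3) := (exists i, X = p i) \/ X = numerator p.

(** Reduction to coordinate points: g inverts the matrix with rows P1, P2, P3. Points are multiplied
    by g and coefficient vectors by the inverse of [Sym3 g], which preserves values and directional
    derivatives. *)
Lemma generic_pencil :
  (evalc F (numerator p) = 0 /\ evalc G (numerator p) = 0) /\
  (forall X, X != 0 -> evalc F X = 0 -> evalc G X = 0 ->
    exists Q c, base Q /\ X = c *: Q) /\
  (forall Q, base Q -> meets_transversally F G Q).
Proof.
pose M : 'M[K]_3 := \matrix_(i < 3) nth 0 [:: p (inord 0); p (inord 1); p (inord 2)] i.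
have Mu : M \in unitmx by rewrite unitmxE unitfE; exact: (gen_bracket gp).
pose g := invmx M; have gu : g \in unitmx by rewrite unitmx_inv.
have gM : g *m M = 1%:M by exact: mulVmx.
have Mg : M *m g = 1%:M by exact: mulmxV.
pose q i := p i *m g.
have gq : generic_config q by exact: generic_config_mul.
have qE (k : 'I_3) (i : 'I_8) : p i = row k M -> q i = delta_mx 0 k.
  by move=> E; rewrite /q E -row_mul Mg row1.
have q0 : q (inord 0) = delta_mx 0 0 by apply: qE; rewrite rowK.
have q1 : q (inord 1) = delta_mx 0 1 by apply: qE; rewrite rowK.
have q2 : q (inord 2) = delta_mx 0 2 by apply: qE; rewrite rowK.
pose T := invmx (Sym3 g); have Tu : T \in unitmx by rewrite unitmx_inv Sym3_unit.
have ST : Sym3 g *m T = 1%:M by apply: mulmxV; apply: Sym3_unit.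
have evalT (H : 'cV[K]_10) Q : evalc (T *m H) (Q *m g) = evalc H Q.
  by rewrite /evalc cubics_row_mul -mulmxA (mulmxA (Sym3 g)) ST mul1mx.
have polarT (H : 'cV[K]_10) Q Q' :
    (cubics_polar (Q *m g) (Q' *m g) *m (T *m H)) 0 0 = (cubics_polar Q Q' *m H) 0 0.
  by rewrite -cubics_polar_mul -mulmxA (mulmxA (Sym3 g)) ST mul1mx.
pose N' := numerator q.
have [l l0 [m m0 [_ _ EN]]] := numerator_mul p gu.
have c0 : l * m ^+ 2 != 0 by rewrite mulf_neq0 ?expf_neq0.
have EN' : N' = (l * m ^+ 2) *: (numerator p *m g) by [].
pose Q4 := q (inord 3); pose Q5 := q (inord 4); pose Q6 := q (inord 5).
pose Q7 := q (inord 6); pose Q8 := q (inord 7).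
have [cC1 cC2 cC3] := gen_C gq; have [cD1 cD2 cD3] := gen_D gq.
have NE : N' = row3 (Cx q * Dy q * Dz q) (Dx q * Cy q * Dz q) (Dx q * Dy q * Cz q).
  rewrite /N' /numerator q0 q1 q2; apply/rowP => j; rewrite !mxE.
  by case: j => -[|[|[|//]]] ? /=; ring.
have br2 (Q Q' : 'rV[K]_3) : bracket Q Q' (delta_mx 0 2) = Q 0 0 * Q' 0 1 - Q 0 1 * Q' 0 0.
  by rewrite bracketE !mxE /=; ring.
have br1 (Q Q' : 'rV[K]_3) : bracket Q Q' (delta_mx 0 1) = Q 0 2 * Q' 0 0 - Q 0 0 * Q' 0 2.
  by rewrite bracketE !mxE /=; ring.
pose ps := [:: Q4; Q5; Q6; Q7; Q8].
have psE : ps = [seq q (inord k) | k <- iota 3 5] by [].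
have coord k l' : (3 <= k < 8)%N -> q (inord k) 0 l' != 0.
  move=> /(gen_coord gq)[]; rewrite q0 q1 q2.
  rewrite !(mxE, bracketE) /= => c0' c1' c2'; move: l'; apply: ord3P.
  - by apply: contra_neq c0' => ->; ring.
  - by apply: contra_neq c1' => ->; ring.
  - by apply: contra_neq c2' => ->; ring.
have Ncoord k : N' 0 k != 0.
  by rewrite NE; move: k; apply: ord3P; rewrite mxE /= !mulf_neq0.
have frac (a b c d : K) : b != 0 -> d != 0 -> a * d - b * c != 0 -> a / b != c / d.
  move=> b0 d0; apply: contra_neq => E.
  have -> : a = c / d * b by rewrite -E divfK.
  by field.
have ps0 P k : P \in ps -> P 0 k != 0.
  by rewrite psE => /mapP[j]; rewrite mem_iota => lj ->; exact: (coord j k lj).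
have pair2 k k' : (3 <= k < k')%N -> (k' < 8)%N ->
    q (inord k) 0 0 / q (inord k) 0 1 != q (inord k') 0 0 / q (inord k') 0 1.
  move=> lk lk'; have [d _] := gen_pair gq lk lk'; rewrite q2 br2 in d.
  have [lk1 lk2] : (3 <= k < 8)%N /\ (3 <= k' < 8)%N.
    by case/andP: lk => l3 lk; rewrite l3 (ltn_trans lk lk') (leq_trans l3 (ltnW lk)).
  exact: (frac _ _ _ _ (coord _ _ lk1) (coord _ _ lk2) d).
have pair1 k k' : (3 <= k < k')%N -> (k' < 8)%N ->
    q (inord k) 0 0 / q (inord k) 0 2 != q (inord k') 0 0 / q (inord k') 0 2.
  move=> lk lk'; have [_ d] := gen_pair gq lk lk'.
  rewrite q1 br1 -oppr_eq0 opprB in d.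
  have [lk1 lk2] : (3 <= k < 8)%N /\ (3 <= k' < 8)%N.
    by case/andP: lk => l3 lk; rewrite l3 (ltn_trans lk lk') (leq_trans l3 (ltnW lk)).
  exact: (frac _ _ _ _ (coord _ _ lk1) (coord _ _ lk2) d).
have Npair k : (3 <= k < 8)%N -> N' 0 0 / N' 0 1 != q (inord k) 0 0 / q (inord k) 0 1
    /\ N' 0 0 / N' 0 2 != q (inord k) 0 0 / q (inord k) 0 2.
  move=> lk; have [] := gen_num gq lk; rewrite q1 q2 br1 br2 -/N' => n2 n1.
  split; first exact: (frac _ _ _ _ (Ncoord _) (coord _ _ lk) n2).
  rewrite -oppr_eq0 opprB in n1.
  exact: (frac _ _ _ _ (Ncoord _) (coord _ _ lk) n1).
have uxy : uniq [seq P 0 0 / P 0 1 | P : 'rV[K]_3 <- N' :: ps].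
  rewrite /= !inE !negb_or !(proj1 (Npair _ _)) //.
  by rewrite !pair2.
have uxz : uniq [seq P 0 0 / P 0 2 | P : 'rV[K]_3 <- N' :: ps].
  rewrite /= !inE !negb_or !(proj2 (Npair _ _)) //.
  by rewrite !pair1.
have full' : row_full (row_mx (T *m F) (T *m G)).
  by rewrite -mul_mx_row /row_full (eqmxMfull _ _) ?row_full_unit.
have through (H : 'cV[K]_10) : (forall i, evalc H (p i) = 0) ->
    forall P, P \in [:: delta_mx 0 0, delta_mx 0 1, delta_mx 0 2 & ps] ->
    evalc (T *m H) P = 0.
  move=> H0 P; rewrite -q0 -q1 -q2 /ps !inE.
  by do 8?[case/orP]; move/eqP->; rewrite evalT.
have [FT GT] := (through F F_through, through G G_through).

have CE : ((Cx q = Cdet (delta_mx 0 0) Q4 Q5 Q6 Q7 Q8)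
  * (Cy q = Cdet (delta_mx 0 1) Q4 Q5 Q6 Q7 Q8)
  * (Cz q = Cdet (delta_mx 0 2) Q4 Q5 Q6 Q7 Q8))%type.
  by rewrite /Cx /Cy /Cz q0 q1 q2.
have DE : ((Dx q = Ddet (delta_mx 0 0) (delta_mx 0 1) (delta_mx 0 2) Q4 Q5 Q6 Q7 Q8)
  * (Dy q = Ddet (delta_mx 0 1) (delta_mx 0 2) (delta_mx 0 0) Q4 Q5 Q6 Q7 Q8)
  * (Dz q = Ddet (delta_mx 0 2) (delta_mx 0 0) (delta_mx 0 1) Q4 Q5 Q6 Q7 Q8))%type.
  by rewrite /Dx /Dy /Dz q0 q1 q2.
rewrite NE !CE !DE in uxy uxz; rewrite !CE in cC1 cC2 cC3; rewrite !DE in cD1 cD2 cD3.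
have ninth := pencil_ninth ps0 uxy uxz cC1 cC2 cC3 cD1 cD2 cD3 full' FT GT.
have basep := pencil_base ps0 uxy uxz cC1 cC2 cC3 cD1 cD2 cD3 full' FT GT.
have trans := pencil_transversal ps0 uxy uxz cC1 cC2 cC3 cD1 cD2 cD3 full' FT GT.
rewrite -!CE -!DE -NE -/ps in ninth basep trans.
have NpE : numerator p *m g = (l * m ^+ 2)^-1 *: N' by rewrite EN' scalerK.
have inQ P : P \in [:: delta_mx 0 0, delta_mx 0 1, delta_mx 0 2 & ps] ->
    exists i, P = q i.
  rewrite -q0 -q1 -q2 /ps !inE.
  by do 8?[case/orP]; move/eqP->; eexists.
have Qin i : q i \in [:: delta_mx 0 0, delta_mx 0 1, delta_mx 0 2 & ps].
  move: i; apply: ord8P => [|||k lk].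
  - by rewrite q0 in_cons eqxx.
  - by rewrite q1 2!in_cons eqxx orbT.
  - by rewrite q2 3!in_cons eqxx !orbT.
  rewrite 3!in_cons psE; do 3![apply/orP; right]; apply: (map_f (fun k => q (inord k))).
  by rewrite mem_iota.
split; last split.
- have [nF nG] := ninth.
  by rewrite -(evalT F) -(evalT G) NpE !evalc_scale nF nG !mulr0.
- move=> X X0 FX GX; have [|||P [c [Pin XE]]] := basep (X *m g).
  + by apply: contra_neq X0 => Xg; rewrite -[X]mulmx1 -gM mulmxA Xg mul0mx.
  + by rewrite evalT.
  + by rewrite evalT.
  have XE' : X = c *: (P *m M) by rewrite scalemxAl -XE -mulmxA gM mulmx1.
  move: Pin; rewrite in_cons => /orP[/eqP PN|/inQ[i Pi]].
    exists (numerator p), (c * (l * m ^+ 2)); split; first by right.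
    by rewrite XE' PN EN' -scalemxAl -mulmxA gM mulmx1 scalerA.
  by exists (p i), c; split; [left; exists i | rewrite XE' Pi /q -mulmxA gM mulmx1].
- move=> Q bQ a b dH.
  have [P [c [c00 [Pin QE]]]] : exists P c, c != 0 /\
      P \in N' :: [:: delta_mx 0 0, delta_mx 0 1, delta_mx 0 2 & ps] /\ P = c *: (Q *m g).
    case: bQ => [[i ->]|->].
      by exists (q i), 1; rewrite oner_neq0 in_cons Qin orbT scale1r.
    by exists N', (l * m ^+ 2); rewrite c0 in_cons eqxx EN'.
  apply: (trans P Pin) => H.
  have -> : H = H *m M *m g by rewrite -mulmxA Mg mulmx1.
  rewrite QE cubics_polar_scale -scalemxAl mxE.
  have -> : a *: (T *m F) + b *: (T *m G) = T *m (a *: F + b *: G).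
    by rewrite mulmxDr -!scalemxAr.
  by rewrite polarT dH mulr0.
Qed.
End GeneralPencil.

(** * Intersection multiplicities *)

Section LocalIntersection.
Variable L : fieldType.
Implicit Types (A B F G S T : {mpoly L[3]}) (X : 'rV[L]_3).

Lemma evalptD A B X : evalpt (A + B) X = evalpt A X + evalpt B X.
Proof. exact: mevalD. Qed.
Lemma evalptB A B X : evalpt (A - B) X = evalpt A X - evalpt B X.
Proof. exact: mevalB. Qed.
Lemma evalptM A B X : evalpt (A * B) X = evalpt A X * evalpt B X.
Proof. exact: mevalM. Qed.
Lemma evalptZ (a : L) A X : evalpt (a *: A) X = a * evalpt A X.
Proof. exact: mevalZ. Qed.
Lemma evalptX i X : evalpt 'X_i X = X 0 i.
Proof. exact: mevalXU. Qed.

(** The case distinction is forced by truncated subtraction: for m < n the component is 0. *)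
Lemma pihomog_mul_homog n m A F : F \is n.-homog ->
  pihomog mdeg m (A * F) = (if (n <= m)%N then pihomog mdeg (m - n) A else 0) * F.
Proof.
move=> homF; set k := maxn (mmeasure mdeg A) m.+1.
rewrite {1}(@pihomog_partitionE _ _ mdeg k A) ?leq_maxl // mulr_suml raddf_sum /=.
have comp d : pihomog mdeg m (pihomog mdeg d A * F) =
    if (d + n == m)%N then pihomog mdeg d A * F else 0.
  have hom : pihomog mdeg d A * F \is (d + n).-homog.
    by apply: dhomogM => //; apply: pihomogP.
  case: eqP => [<-|/eqP ne]; first by rewrite pihomog_dE.
  by rewrite (pihomog_ne0 ne hom).
rewrite (eq_bigr _ (fun d _ => comp (val d))).
case: leqP => [le|lt]; last first.
  rewrite mul0r big1 // => d _; case: eqP => // /esym mE.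
  by move: lt; rewrite mE ltnNge leq_addl.
have ltk : (m - n < k)%N by rewrite leq_max ltnS leq_subr orbT.
rewrite (bigD1 (Ordinal ltk)) //= subnK // eqxx big1 ?addr0 // => d.
rewrite -(inj_eq val_inj) /=; case: eqP => // dE; case: eqP => // mE.
by case: dE; rewrite -mE addnK.
Qed.

(** T may be inhomogeneous: one of its homogeneous components is nonzero at X, and the component of
    the identity in the corresponding degree has homogeneous coefficients. *)
Lemma local_ideal_intro F G X n d A S A' B' T : F \is n.-homog -> G \is n.-homog ->
  A \is d.-homog -> S \is d.-homog -> evalpt S X != 0 -> evalpt T X != 0 ->
  T * A = A' * F + B' * G ->
  in_local_ideal F G X (tofrac A / tofrac S).
Proof.
move=> homF homG homA homS SX TX E.
have [e TeX] : exists e, evalpt (pihomog mdeg e T) X != 0.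
  have := TX; rewrite {1}(pihomog_partitionE (leqnn (mmeasure mdeg T))).
  rewrite /evalpt raddf_sum /= => s0.
  have /existsP[e Te] : [exists e : 'I_(mmeasure mdeg T),
      (pihomog mdeg e T).@[fun j => X 0 j] != 0].
    apply: contraNT s0; rewrite negb_exists => /forallP T0.
    by apply/eqP; apply: big1 => e _; apply/eqP; rewrite -[_ == _]negbK.
  by exists e.
set Te := pihomog mdeg e T in TeX.
have ETA : Te * A = pihomog mdeg (e + d) (T * A).
  by rewrite (pihomog_mul_homog _ _ homA) leq_addl addnK.
have homTe : Te \is e.-homog by apply: pihomogP.
pose c (A : {mpoly L[3]}) := if (n <= e + d)%N then pihomog mdeg (e + d - n) A else 0.
have nz B : evalpt B X != 0 -> tofrac B != 0.
  by rewrite tofrac_eq0; apply: contra_neq => ->; rewrite /evalpt raddf0.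
exists (e + d)%N, (c A'), (c B'), (Te * S); split.
- by rewrite -(pihomog_mul_homog _ _ homF); apply: pihomogP.
- by rewrite -(pihomog_mul_homog _ _ homG); apply: pihomogP.
- exact: dhomogM.
- by rewrite evalptM mulf_neq0.
rewrite -!(pihomog_mul_homog _ _ homF) -!(pihomog_mul_homog _ _ homG).
rewrite -raddfD /= -E -ETA !rmorphM /=.
by rewrite invfM mulrACA divff ?nz // mul1r.
Qed.

(** One generator is a unit of the local ring, so the quotient is 0 and the empty family is a
    basis. *)
Lemma intersection_mult0 F G X n : F \is n.-homog -> G \is n.-homog ->
  evalpt F X != 0 \/ evalpt G X != 0 -> intersection_mult F G X 0.
Proof.
move=> homF homG FGX; exists (fun _ => 0); split; first by case.
move=> _ [d [A [S [homA homS SX ->]]]]; exists 0; split; last first.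
  by move=> c _; rewrite (thinmx0 c).
rewrite big_ord0 subr0.
case: FGX => TX.
  by apply: (@local_ideal_intro _ _ _ n d A S A 0 F); rewrite // mul0r addr0 mulrC.
by apply: (@local_ideal_intro _ _ _ n d A S 0 A G); rewrite // mul0r add0r mulrC.
Qed.

Definition in_ideal2 F G A := exists U V, A = U * F + V * G.

(** The last hypothesis says that F and G generate the maximal ideal of the local ring. The quotient
    is then the field of values at X, with basis 1. *)
Lemma intersection_mult1 F G X n : F \is n.-homog -> G \is n.-homog ->
  evalpt F X = 0 -> evalpt G X = 0 ->
  (forall d A, A \is d.-homog -> evalpt A X = 0 ->
     exists2 T, evalpt T X != 0 & in_ideal2 F G (T * A)) ->
  intersection_mult F G X 1.
Proof.
move=> homF homG FX GX maxideal.
have nz B : evalpt B X != 0 -> tofrac B != 0.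
  by rewrite tofrac_eq0; apply: contra_neq => ->; rewrite /evalpt raddf0.
exists (fun _ => 1); split.
  move=> _; exists 0, 1, 1; rewrite !dhomog1; split=> //.
    by rewrite /evalpt rmorph1 oner_neq0.
  by rewrite rmorph1 divr1.
move=> _ [d [A [S [homA homS SX ->]]]].
have split_const (c : 'rV[L]_1) :
    tofrac A / tofrac S - \sum_(i < 1) tofrac (c 0 i)%:MP * 1 =
    tofrac (A - c 0 0 *: S) / tofrac S.
  rewrite big_ord1 mulr1 -mul_mpolyC rmorphB rmorphM /=.
  by rewrite mulrBl mulfK // nz.
pose c := evalpt A X / evalpt S X.
exists (const_mx c); split.
  rewrite split_const mxE.
  have [||T TX [U [V E]]] := maxideal d (A - c *: S).
  - by rewrite rpredB // rpredZ.
  - by rewrite evalptB evalptZ divfK // subrr.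
  apply: (local_ideal_intro homF homG _ homS SX TX E).
  by rewrite rpredB // rpredZ.
move=> c'; rewrite split_const => -[d' [A' [B' [S' [_ _ _ S'X]]]]].
move=> /eqP; rewrite eqr_div ?nz // -!rmorphM /= tofrac_eq => /eqP E.
apply/rowP => j; rewrite ord1 mxE; apply: (mulIf SX); rewrite divfK //.
have := congr1 (fun B => evalpt B X) E.
rewrite /= !(evalptM, evalptB, evalptD, evalptZ) FX GX !mulr0 addr0 mul0r => /eqP.
by rewrite mulf_eq0 (negbTE S'X) orbF subr_eq0 => /eqP ->.
Qed.

End LocalIntersection.

(** * Cubic forms, directional derivatives and transversal intersections *)

Definition mnm3 a b c : 'X_{1..3} := [multinom nth 0%N [:: a; b; c] i | i < 3].

Definition mnms3 : seq 'X_{1..3} := [:: mnm3 3 0 0; mnm3 2 1 0; mnm3 2 0 1;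
  mnm3 1 2 0; mnm3 1 1 1; mnm3 1 0 2; mnm3 0 3 0; mnm3 0 2 1; mnm3 0 1 2; mnm3 0 0 3].

Lemma mnm3E (m : 'X_{1..3}) : m = mnm3 (m 0) (m 1) (m 2).
Proof. by apply/mnmP; apply: ord3P; rewrite mnmE. Qed.

Lemma mpolyX_mnm3 (R : comNzRingType) a b c :
  'X_[mnm3 a b c] = 'X_0 ^+ a * 'X_1 ^+ b * 'X_2 ^+ c :> {mpoly R[3]}.
Proof.
rewrite mpolyXE_id !big_ord_recl big_ord0 !mnmE mulr1 mulrA.
by congr (_ * 'X__ ^+ _ * 'X__ ^+ _); apply: val_inj.
Qed.

Lemma mnm3_inj a b c a' b' c' :
  (mnm3 a b c == mnm3 a' b' c') = [&& a == a', b == b' & c == c'].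
Proof.
apply/eqP/and3P => [E|[/eqP-> /eqP-> /eqP->]] //.
by split; apply/eqP; [have := congr1 (fun m : 'X_{1..3} => m 0) E
  | have := congr1 (fun m : 'X_{1..3} => m 1) E
  | have := congr1 (fun m : 'X_{1..3} => m 2) E]; rewrite /= !mnmE.
Qed.

Lemma uniq_mnms3 : uniq mnms3.
Proof. by rewrite /mnms3 /= !inE !mnm3_inj. Qed.

Lemma mem_mnms3 m : mdeg m = 3%N -> m \in mnms3.
Proof.
rewrite [m]mnm3E mdegE !big_ord_recl big_ord0 !mnmE /=.
move: (m 0) (m 1) (m 2) => a b c.
rewrite /bump /= !inE !mnm3_inj => E.
have [la lb lc] : [/\ a < 4, b < 4 & c < 4]%N by split; lia.
by move: E la lb lc; case: a => [|[|[|[|a]]]]; case: b => [|[|[|[|b]]]];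
  case: c => [|[|[|[|c]]]].
Qed.

Section CubicForms.
Variable R : comNzRingType.
Implicit Type F : {mpoly R[3]}.

Definition cvec F : 'cV[R]_10 := \col_(j < 10)
  [:: F@_(mnm3 3 0 0); F@_(mnm3 2 1 0); F@_(mnm3 2 0 1); F@_(mnm3 1 2 0);
      F@_(mnm3 1 1 1); F@_(mnm3 1 0 2); F@_(mnm3 0 3 0);
      F@_(mnm3 0 2 1); F@_(mnm3 0 1 2); F@_(mnm3 0 0 3)]`_j.

Lemma homog_sum n d (ms : seq 'X_{1..n}) (F : {mpoly R[n]}) : uniq ms ->
  (forall m, mdeg m = d -> m \in ms) -> F \is d.-homog ->
  F = \sum_(m <- ms) F@_m *: 'X_[m].
Proof.
move=> ums memms homF; apply/mpolyP => m; rewrite raddf_sum /=.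
under eq_bigr => k _ do rewrite mcoeffZ mcoeffX.
have [min|mnin] := boolP (m \in ms).
  rewrite (bigD1_seq m min ums) /= eqxx mulr1 big1 ?addr0 // => k /negbTE km.
  by rewrite km mulr0.
rewrite big1_seq => [|k /andP[_ kin]]; last first.
  by case: eqP => [km|]; [rewrite -km kin in mnin | rewrite mulr0].
apply: dhomog_nemf_coeff homF _; apply: contraNneq mnin; exact: memms.
Qed.

Lemma homog3E F : F \is 3.-homog -> F =
  F@_(mnm3 3 0 0) *: ('X_0 * 'X_0 * 'X_0) + F@_(mnm3 2 1 0) *: ('X_0 * 'X_0 * 'X_1)
  + F@_(mnm3 2 0 1) *: ('X_0 * 'X_0 * 'X_2) + F@_(mnm3 1 2 0) *: ('X_0 * 'X_1 * 'X_1)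
  + F@_(mnm3 1 1 1) *: ('X_0 * 'X_1 * 'X_2) + F@_(mnm3 1 0 2) *: ('X_0 * 'X_2 * 'X_2)
  + F@_(mnm3 0 3 0) *: ('X_1 * 'X_1 * 'X_1) + F@_(mnm3 0 2 1) *: ('X_1 * 'X_1 * 'X_2)
  + F@_(mnm3 0 1 2) *: ('X_1 * 'X_2 * 'X_2) + F@_(mnm3 0 0 3) *: ('X_2 * 'X_2 * 'X_2).
Proof.
move=> homF.
rewrite {1}(homog_sum uniq_mnms3 mem_mnms3 homF).
rewrite !big_cons big_nil addr0 !mpolyX_mnm3 !addrA.
by rewrite !(expr0, expr1, mul1r, mulr1) !(exprS _ 2) !expr2 !mulrA.
Qed.

Lemma evalpt_cvec F Q : F \is 3.-homog -> evalpt F Q = evalc (cvec F) Q.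
Proof.
move=> homF; rewrite /evalc mxE !big_ord_recl big_ord0 !mxE /=.
rewrite {1}(homog3E homF) /evalpt !(mevalD, mevalZ, mevalM, mevalXU).
move: (F@_(mnm3 3 0 0)) (F@_(mnm3 2 1 0)) (F@_(mnm3 2 0 1)) (F@_(mnm3 1 2 0)) (F@_(mnm3 1 1 1)) (F@_(mnm3 1 0 2)) (F@_(mnm3 0 3 0)) (F@_(mnm3 0 2 1)) (F@_(mnm3 0 1 2)) (F@_(mnm3 0 0 3)).
by move=> *; ring.
Qed.
End CubicForms.

Section DirectionalDerivative.
Variable R : fieldType.
Implicit Types (A B F : {mpoly R[3]}) (X H : 'rV[R]_3).

Definition dirder X H A := \sum_i H 0 i * evalpt A^`M(i) X.

Lemma dirderD X H A B : dirder X H (A + B) = dirder X H A + dirder X H B.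
Proof.
rewrite -big_split /=; apply: eq_bigr => i _.
by rewrite mderivD /evalpt mevalD mulrDr.
Qed.

Lemma dirderZ X H a A : dirder X H (a *: A) = a * dirder X H A.
Proof.
rewrite mulr_sumr; apply: eq_bigr => i _.
by rewrite mderivZ /evalpt mevalZ mulrCA.
Qed.

Lemma dirderM X H A B :
  dirder X H (A * B) = dirder X H A * evalpt B X + evalpt A X * dirder X H B.
Proof.
rewrite mulr_suml mulr_sumr -big_split /=; apply: eq_bigr => i _.
by rewrite mderivM /evalpt mevalD !mevalM; ring.
Qed.

Lemma dirderX X H i : dirder X H 'X_i = H 0 i.
Proof.
rewrite /dirder (bigD1 i) //= big1 => [|j ne].
  have -> : 'X_i^`M(i) = 1 :> {mpoly R[3]}.
    rewrite mderivX mnm1E eqxx scale1r -mpolyX0; congr 'X_[_].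
    by apply/mnmP => l; rewrite mnmBE mnm0E subnn.
  rewrite addr0 /evalpt meval1.
  by rewrite mulr1.
by rewrite mderivX mnm1E eq_sym (negbTE ne) scale0r /evalpt meval0 mulr0.
Qed.

Lemma dirder_cvec F X H : F \is 3.-homog ->
  dirder X H F = (cubics_polar X H *m cvec F) 0 0.
Proof.
move=> homF; rewrite mxE !big_ord_recl big_ord0 !mxE /=.
rewrite {1}(homog3E homF) !(dirderD, dirderZ, dirderM, dirderX).
rewrite /evalpt !(mevalM, mevalXU).
move: (F@_(mnm3 3 0 0)) (F@_(mnm3 2 1 0)) (F@_(mnm3 2 0 1)) (F@_(mnm3 1 2 0)).
move: (F@_(mnm3 1 1 1)) (F@_(mnm3 1 0 2)) (F@_(mnm3 0 3 0)) (F@_(mnm3 0 2 1)).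
by move: (F@_(mnm3 0 1 2)) (F@_(mnm3 0 0 3)) => *; ring.
Qed.

(** Lines through X; they cut out X when its k-th coordinate is nonzero. The zero form at i = k
    allows sums over all three indices. *)
Definition line_at X (k i : 'I_3) : {mpoly R[3]} := X 0 k *: 'X_i - X 0 i *: 'X_k.

Lemma line_at_eq0 X k : line_at X k k = 0.
Proof. by rewrite /line_at subrr. Qed.

(** Modulo these lines, X_k ['X_i] may be replaced by X_i ['X_k]. Doing this for one variable after
    another reduces a monomial to its value at X times a power of ['X_k]. *)
Lemma line_decomposition X k d A : A \is d.-homog ->
  exists c : 'I_3 -> {mpoly R[3]},
    X 0 k ^+ d *: A = evalpt A X *: 'X_k ^+ d + \sum_i c i * line_at X k i.
Proof.
pose good d A := exists c : 'I_3 -> {mpoly R[3]},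
    X 0 k ^+ d *: A = evalpt A X *: 'X_k ^+ d + \sum_i c i * line_at X k i.
have good0 : good d 0.
  exists (fun _ => 0); rewrite scaler0 /evalpt meval0 scale0r add0r.
  by rewrite big1 // => i _; rewrite mul0r.
have goodD B C : good d B -> good d C -> good d (B + C).
  move=> [b Eb] [c Ec]; exists (fun i => b i + c i).
  rewrite scalerDr Eb Ec evalptD scalerDl.
  under [in RHS]eq_bigr => i _ do rewrite mulrDl.
  by rewrite big_split /= addrACA.
have goodZ a B : good d B -> good d (a *: B).
  move=> [b Eb]; exists (fun i => a *: b i).
  rewrite scalerA mulrC -scalerA Eb scalerDr evalptZ scalerA; congr (_ + _).
  by rewrite scaler_sumr; apply: eq_bigr => i _; rewrite scalerAl.
have good_mul e B i : good e B -> good e.+1 (B * 'X_i).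
  move=> [b Eb]; pose c j := b j * (X 0 k *: 'X_i)
    + (if j == i then evalpt B X *: 'X_k ^+ e else 0).
  exists c.
  have -> : X 0 k ^+ e.+1 *: (B * 'X_i) = (X 0 k ^+ e *: B) * (X 0 k *: 'X_i).
    by rewrite -scalerAl -scalerAr scalerA exprSr.
  rewrite Eb mulrDl mulr_suml.
  under [in RHS]eq_bigr => j _ do rewrite mulrDl.
  rewrite big_split /= [X in _ = _ + (_ + X)](bigD1 i) //= eqxx.
  rewrite [X in _ = _ + (_ + (_ + X))]big1 => [|j /negbTE ->]; last by rewrite mul0r.
  rewrite addr0 evalptM evalptX.
  have -> : \sum_j b j * (X 0 k *: 'X_i) * line_at X k j =
      \sum_j b j * line_at X k j * (X 0 k *: 'X_i).
    by apply: eq_bigr => j _; rewrite mulrAC.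
  move: (\sum_j _) => S; rewrite /line_at.
  by rewrite -!mul_mpolyC exprS !rmorphM /=; ring.
have good_pow e B i n : good e B -> good (e + n)%N (B * 'X_i ^+ n).
  elim: n e B => [|n IH] e B gB; first by rewrite expr0 mulr1 addn0.
  by rewrite exprS mulrA -addSnnS; apply: IH; apply: (good_mul).
have good1 : good 0%N 1.
  exists (fun _ => 0); rewrite !expr0 scale1r /evalpt meval1 scale1r.
  by rewrite big1 ?addr0 // => i _; rewrite mul0r.
have goodX (m : 'X_{1..3}) : good (mdeg m) 'X_[m].
  have -> : mdeg m = (0 + m 0%R + m 1%R + m 2%R)%N by rewrite mdegE (sum3 (fun i => m i)).
  rewrite {4}[m]mnm3E mpolyX_mnm3 -['X_0 ^+ _]mul1r.
  by do 3!apply: (good_pow).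
move=> homA; rewrite [A]mpolyE big_seq; apply: (big_ind (good d)) => // m min.
by apply: goodZ; rewrite -(dhomog_mf homA min); apply: goodX.
Qed.

End DirectionalDerivative.

Lemma ord3_others (k : 'I_3) : exists i j : 'I_3,
  forall (V : nmodType) (F : 'I_3 -> V), \sum_l F l = F k + F i + F j.
Proof.
move: k; apply: ord3P; [exists 1, 2 | exists 0, 2 | exists 0, 1] => V F; rewrite sum3 //.
  by rewrite [F 1 + _]addrC.
by rewrite addrC addrA.
Qed.

(** Up to constants, F and G are combinations of two lines through X. Transversality means that the
    determinant D of the coefficients is nonzero at X, and by Cramer's rule D times either line lies
    in (F, G). Every form vanishing at X is a combination of the same lines. *)
Lemma intersection_mult_transversal (L : fieldType) (F G : {mpoly L[3]}) (X : 'rV_3) :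
  F \is 3.-homog -> G \is 3.-homog -> X != 0 -> evalpt F X = 0 -> evalpt G X = 0 ->
  meets_transversally (cvec F) (cvec G) X -> intersection_mult F G X 1.
Proof.
move=> homF homG X0 FX GX trans.
have [k xk] : exists k, X 0 k != 0.
  apply/existsP; apply: contraNT X0; rewrite negb_exists => /forallP X0.
  by apply/eqP/rowP => j; rewrite mxE; apply/eqP; rewrite -[_ == _]negbK X0.
have [i [j sumE]] := ord3_others k.
set x := X 0 k in xk; pose l := line_at X k.
have decomp d (A : {mpoly L[3]}) : A \is d.-homog -> evalpt A X = 0 ->
    exists c : 'I_3 -> {mpoly L[3]}, x ^+ d *: A = c i * l i + c j * l j.
  move=> /(line_decomposition X k)[c cE] AX; exists c.
  by rewrite cE AX scale0r add0r sumE line_at_eq0 mulr0 add0r.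
have [f Ef] := decomp _ _ homF FX; have [g Eg] := decomp _ _ homG GX.
have lX n : evalpt (l n) X = 0 by rewrite evalptB !evalptZ !evalptX mulrC subrr.
have x3 : x ^+ 3 != 0 by rewrite expf_neq0.
have dir H (A : {mpoly L[3]}) (c : 'I_3 -> {mpoly L[3]}) :
    x ^+ 3 *: A = c i * l i + c j * l j ->
    x ^+ 3 * dirder X H A = evalpt (c i) X * dirder X H (l i)
                            + evalpt (c j) X * dirder X H (l j).
  by move=> E; rewrite -dirderZ E dirderD !dirderM !lX !mulr0 !add0r.
have indep a b : a * evalpt (f i) X + b * evalpt (g i) X = 0 ->
    a * evalpt (f j) X + b * evalpt (g j) X = 0 -> a = 0 /\ b = 0.
  move=> ei ej; apply: trans => H.
  rewrite mulmxDr -!scalemxAr [LHS]mxE [X in X + _]mxE [X in _ + X]mxE -!dirder_cvec //.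
  apply: (mulfI x3); rewrite mulr0.
  transitivity (a * (x ^+ 3 * dirder X H F) + b * (x ^+ 3 * dirder X H G)).
    by ring.
  rewrite (dir _ _ _ Ef) (dir _ _ _ Eg).
  transitivity ((a * evalpt (f i) X + b * evalpt (g i) X) * dirder X H (l i)
    + (a * evalpt (f j) X + b * evalpt (g j) X) * dirder X H (l j)); first by ring.
  by rewrite ei ej !mul0r addr0.
pose D := f i * g j - f j * g i.
(* If D vanished at X, the relations with coefficients (g i, - f i) and (g j, - f j) would have to
   be trivial; then all four coefficients vanish at X and independence fails. *)
have DX : evalpt D X != 0.
  apply: contra_neq (oner_neq0 L); rewrite evalptB !evalptM => D0.
  have [gi0 fi0] : evalpt (g i) X = 0 /\ - evalpt (f i) X = 0.
    by apply: indep; first ring; rewrite -[RHS]oppr0 -D0; ring.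
  have [gj0 fj0] : evalpt (g j) X = 0 /\ - evalpt (f j) X = 0.
    by apply: indep; last ring; rewrite -D0; ring.
  have [] // := indep 1 0; rewrite mul0r addr0 mul1r.
    by apply: oppr_inj; rewrite fi0 oppr0.
  by apply: oppr_inj; rewrite fj0 oppr0.
apply: (intersection_mult1 homF homG FX GX) => d A homA AX.
have [a Ea] := decomp _ _ homA AX.
exists (x ^+ d *: D); first by rewrite evalptZ mulf_neq0 ?expf_neq0.
exists (x ^+ 3 *: (a i * g j - a j * g i)), (x ^+ 3 *: (a j * f i - a i * f j)).
rewrite -[LHS]scalerAl [LHS]scalerAr Ea -!scalerAl !scalerAr Ef Eg /D.
by ring.
Qed.

Section Proportional.
Variable K : fieldType.
Implicit Types u v S : 'rV[K]_3.

Lemma bracket_proportional u v S c : u = c *: v -> bracket u v S = 0.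
Proof. by move=> ->; rewrite bracket_scale bracketE; ring. Qed.

Lemma bracket_swap u v S : bracket u v S = - bracket v u S.
Proof. by rewrite !bracketE; ring. Qed.

Lemma bracket_rot u v S : bracket u v S = bracket v S u.
Proof. by rewrite !bracketE; ring. Qed.

Lemma eqmx_bracket u v S : (u == v)%MS -> bracket u v S = 0.
Proof. by case/andP=> /sub_rVP[c uE] _; apply: bracket_proportional uE. Qed.

Lemma eqmx_scaler u v c : c != 0 -> v = c *: u -> (u == v)%MS.
Proof.
move=> c0 ->; apply/andP; split; last by rewrite scalemx_sub.
by rewrite -{1}[u](scalerK c0) scalemx_sub.
Qed.

Lemma eqmx_scaled u v : (u == v)%MS -> exists c, v = c *: u.
Proof. by case/andP => _ /sub_rVP. Qed.

Variable p : 'I_8 -> 'rV[K]_3.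
Hypothesis gp : generic_config p.

(** Two vectors are independent when some bracket containing them is nonzero; in this form
    distinctness is read off [generic_config]. *)
Lemma generic_distinct i j : i != j -> exists S, bracket (p i) (p j) S != 0.
Proof.
have b0 := gen_bracket gp.
have sym u v : (exists S, bracket u v S != 0) -> exists S, bracket v u S != 0.
  by move=> [S uv]; exists S; rewrite bracket_swap oppr_eq0.
have d01 : exists S, bracket (p (inord 0)) (p (inord 1)) S != 0.
  by exists (p (inord 2)).
have d12 : exists S, bracket (p (inord 1)) (p (inord 2)) S != 0.
  by exists (p (inord 0)); rewrite -bracket_rot.
have d20 : exists S, bracket (p (inord 2)) (p (inord 0)) S != 0.
  by exists (p (inord 1)); rewrite bracket_rot.
have d0k k : (3 <= k < 8)%N -> exists S, bracket (p (inord 0)) (p (inord k)) S != 0.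
  by move=> /(gen_coord gp)[_ ? _]; exists (p (inord 2)).
have dk1 k : (3 <= k < 8)%N -> exists S, bracket (p (inord k)) (p (inord 1)) S != 0.
  by move=> /(gen_coord gp)[? _ _]; exists (p (inord 2)).
have d2k k : (3 <= k < 8)%N -> exists S, bracket (p (inord 2)) (p (inord k)) S != 0.
  by move=> /(gen_coord gp)[? _ _]; exists (p (inord 1)); rewrite bracket_rot.
move: i j; apply: ord8P => [|||k lk]; apply: ord8P => [|||l ll];
  rewrite ?eqxx // => kl; do ?[by auto].
have [kl'|lk'|kE] := ltngtP k l; last by rewrite kE eqxx in kl.
- exists (p (inord 2)); case/andP: lk => lk _; case/andP: ll => _ ll.
  by have [] := @gen_pair _ _ gp k l; rewrite ?lk.
- apply: sym; exists (p (inord 2)); case/andP: lk => _ lk; case/andP: ll => ll _.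
  by have [] := @gen_pair _ _ gp l k; rewrite ?ll.
Qed.

Lemma numerator_distinct i : exists S, bracket (numerator p) (p i) S != 0.
Proof.
have b0 := gen_bracket gp; have [? ? ?] := gen_C gp; have [? ? ?] := gen_D gp.
move: i; apply: ord8P => [|||k /(gen_num gp)[? _]]; last by exists (p (inord 2)).
- exists (p (inord 1)).
  suff -> : bracket (numerator p) (p (inord 0)) (p (inord 1)) = Dx p * Dy p * Cz p
      * bracket (p (inord 0)) (p (inord 1)) (p (inord 2)) by rewrite !mulf_neq0.
  by rewrite /numerator !bracketE !mxE; ring.
- exists (p (inord 2)).
  suff -> : bracket (numerator p) (p (inord 1)) (p (inord 2)) = Cx p * Dy p * Dz p
      * bracket (p (inord 0)) (p (inord 1)) (p (inord 2)) by rewrite !mulf_neq0.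
  by rewrite /numerator !bracketE !mxE; ring.
- exists (p (inord 0)).
  suff -> : bracket (numerator p) (p (inord 2)) (p (inord 0)) = Dx p * Cy p * Dz p
      * bracket (p (inord 0)) (p (inord 1)) (p (inord 2)) by rewrite !mulf_neq0.
  by rewrite /numerator !bracketE !mxE; ring.
Qed.

Lemma numerator_neq0 : numerator p != 0.
Proof.
have [S] := numerator_distinct (inord 0); apply: contra_neq => ->.
by rewrite bracketE !mxE; ring.
Qed.

Lemma generic_neq0 i : p i != 0.
Proof.
have [S] := numerator_distinct i; apply: contra_neq => ->.
by rewrite bracketE !mxE; ring.
Qed.
End Proportional.

(** * Multiplicities over an extension field *)

Section BaseChange.
Variables (K L : fieldType) (iota : {rmorphism K -> L}).

Lemma dhomog_map n d (F : {mpoly K[n]}) : F \is d.-homog -> map_mpoly iota F \is d.-homog.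
Proof.
move=> homF; apply/dhomogP => m; rewrite mcoeff_msupp mcoeff_map_mpoly => Fm.
apply: (dhomog_mf homF); rewrite mcoeff_msupp; apply: contra_neq Fm => ->.
by rewrite raddf0.
Qed.

Lemma cvec_map (F : {mpoly K[3]}) : cvec (map_mpoly iota F) = map_mx iota (cvec F).
Proof.
apply/matrixP => j i; rewrite !mxE !mcoeff_map_mpoly.
by case: j; do 10?[case => [?|]].
Qed.

Lemma evalc_map (c : 'cV[K]_10) Q : evalc (map_mx iota c) (map_mx iota Q) = iota (evalc c Q).
Proof. by rewrite /evalc cubics_row_map -map_mxM mxE. Qed.

End BaseChange.

Lemma cvec_eq0 (R : comNzRingType) (F : {mpoly R[3]}) : F \is 3.-homog ->
  cvec F = 0 -> F = 0.
Proof.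
move=> homF /colP c0; rewrite (homog3E homF).
have e k (ltk : (k < 10)%N) := c0 (Ordinal ltk).
have := e 0%N isT; rewrite !mxE /= => ->; have := e 1%N isT; rewrite !mxE /= => ->.
have := e 2%N isT; rewrite !mxE /= => ->; have := e 3%N isT; rewrite !mxE /= => ->.
have := e 4%N isT; rewrite !mxE /= => ->; have := e 5%N isT; rewrite !mxE /= => ->.
have := e 6%N isT; rewrite !mxE /= => ->; have := e 7%N isT; rewrite !mxE /= => ->.
have := e 8%N isT; rewrite !mxE /= => ->; have := e 9%N isT; rewrite !mxE /= => ->.
by rewrite !scale0r !addr0.
Qed.

Lemma cvec_indep (K : fieldType) (F G : {mpoly K[3]}) : F \is 3.-homog -> G \is 3.-homog ->
  lin_indep2 F G -> row_full (row_mx (cvec F) (cvec G)).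
Proof.
move=> homF homG indep; rewrite /row_full -mxrank_tr -/(row_free _).
apply: inj_row_free => v /(congr1 trmx); rewrite trmx_mul trmxK trmx0.
have -> : v^T = col_mx (v 0 0)%:M (v 0 1)%:M :> 'cV_(1 + 1).
  apply/colP => i; rewrite !mxE; case: splitP => k; rewrite ord1 /= => iE;
    by rewrite !mxE eqxx mulr1n; congr (v 0 _); apply: val_inj.
rewrite mul_row_col !mul_mx_scalar => E.
have [|a0 b0] := indep (v 0 0) (v 0 1).
  apply: cvec_eq0; first by rewrite rpredD ?rpredZ.
  rewrite -E; apply/colP => j; rewrite !mxE !(mcoeffD, mcoeffZ).
  by case: j; do 10?[case => [?|]].
apply/rowP => j; rewrite mxE; case: j => -[|[|//]] lt.
  by rewrite -[RHS]a0; congr (v 0 _); apply: val_inj.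
by rewrite -[RHS]b0; congr (v 0 _); apply: val_inj.
Qed.

Section BasePoints.
Variables (K L : fieldType) (iota : {rmorphism K -> L}) (p : 'I_8 -> 'rV[K]_3).
Hypothesis gp : generic_config p.

Let q i := map_mx iota (p i).
Let Q := map_mx iota (ninth_formula p).

Let gq : generic_config q.
Proof. by apply: map_generic_config gp => r; rewrite fmorph_eq0. Qed.

Let QE : exists2 c, c != 0 & Q = c *: numerator q.
Proof.
exists (iota (bracket (p (inord 0)) (p (inord 1)) (p (inord 2))))^-1.
  by rewrite invr_eq0 fmorph_eq0 (gen_bracket gp).
by rewrite /Q ninth_formulaE map_mxZ fmorphV numerator_map.
Qed.

Lemma base_point_count X : X != 0 ->
  (exists R c, ((exists i, R = q i) \/ R = numerator q) /\ X = c *: R) ->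
  (\sum_(i < 8) (q i == X)%MS + (Q == X)%MS)%N = 1%N.
Proof.
move=> X0 [R [c [bR XR]]]; have [d d0 Qd] := QE.
have c0 : c != 0 by apply: contra_neq X0 => c0; rewrite XR c0 scale0r.
case: bR => [[i Ri]|RN].
  have Xi : (q i == X)%MS by apply: eqmx_scaler c0 _; rewrite XR Ri.
  have QX : (Q == X)%MS = false.
    apply/negP => /eqmx_scaled[e Xe].
    have [S] := numerator_distinct gq i; rewrite bracket_swap oppr_eq0 => /eqP[].
    apply: (@bracket_proportional _ _ _ S (c^-1 * (e * d))).
    by rewrite -Ri -[R](scalerK c0) -XR Xe Qd !scalerA mulrA.
  rewrite (bigD1 i) //= Xi QX big1 // => j ji; apply/eqP; rewrite eqb0.
  apply/negP => /eqmx_scaled[e Xe]; have [S] := generic_distinct gq ji => /eqP[].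
  rewrite bracket_swap (@bracket_proportional _ (q i) _ S (c^-1 * e)) ?oppr0 //.
  by rewrite -Ri -[R](scalerK c0) -XR Xe !scalerA.
have QX : (Q == X)%MS.
  apply: (eqmx_scaler (c := c / d)); first by rewrite mulf_neq0 ?invr_eq0.
  by rewrite Qd scalerA divfK // XR RN.
rewrite QX big1 // => j _; apply/eqP; rewrite eqb0.
apply/negP => /eqmx_scaled[e Xe]; have [S] := numerator_distinct gq j => /eqP[].
apply: (@bracket_proportional _ _ _ S (c^-1 * e)).
by rewrite -RN -[R](scalerK c0) -XR Xe !scalerA.
Qed.

(** The common zeros are exactly the nine points, which are distinct and transversal, so
    multiplicity and count are both 1 there and both 0 elsewhere. *)
Lemma generic_multiplicity F G : cubic_through p F -> cubic_through p G ->
  lin_indep2 F G -> forall X : 'rV[L]_3, X != 0 ->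
  intersection_mult (map_mpoly iota F) (map_mpoly iota G) X
    (\sum_(i < 8) (q i == X)%MS + (Q == X)%MS)%N.
Proof.
move=> [homF Fp] [homG Gp] indep X X0.
have homF' := dhomog_map iota homF; have homG' := dhomog_map iota homG.
have full : row_full (row_mx (cvec (map_mpoly iota F)) (cvec (map_mpoly iota G))).
  by rewrite !cvec_map -map_row_mx /row_full mxrank_map; apply: cvec_indep.
have Fq i : evalc (cvec (map_mpoly iota F)) (q i) = 0.
  by rewrite cvec_map evalc_map -evalpt_cvec // Fp rmorph0.
have Gq i : evalc (cvec (map_mpoly iota G)) (q i) = 0.
  by rewrite cvec_map evalc_map -evalpt_cvec // Gp rmorph0.
have [[FN GN] [base trans]] := generic_pencil gq full Fq Gq.
have [d d0 Qd] := QE.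
have zeroF R : (exists i, R = q i) \/ R = numerator q ->
    evalc (cvec (map_mpoly iota F)) R = 0 /\ evalc (cvec (map_mpoly iota G)) R = 0.
  by move=> [[i ->]|->]; [split; [exact: Fq | exact: Gq] | split].
have zero R c : (exists i, R = q i) \/ R = numerator q -> X = c *: R ->
    evalpt (map_mpoly iota F) X = 0 /\ evalpt (map_mpoly iota G) X = 0.
  move=> /zeroF[FR GR] XR; rewrite (evalpt_cvec X homF') (evalpt_cvec X homG') XR.
  by rewrite 2!evalc_scale FR GR mulr0.
have [/andP[/eqP FX /eqP GX]|FGX] :=
    boolP ((evalpt (map_mpoly iota F) X == 0) && (evalpt (map_mpoly iota G) X == 0)); last first.
  have no R c : (exists i, R = q i) \/ R = numerator q -> X <> c *: R.
    by move=> bR /(zero _ _ bR)[FX0 GX0]; rewrite FX0 GX0 eqxx in FGX.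
  suff -> : (\sum_(i < 8) (q i == X)%MS + (Q == X)%MS)%N = 0%N.
    by apply: (intersection_mult0 homF' homG'); apply/orP; rewrite -negb_and.
  have -> : (Q == X)%MS = false.
    by apply/negP => /eqmx_scaled[c]; rewrite Qd scalerA; apply: no; right.
  rewrite big1 // => i _; apply/eqP; rewrite eqb0; apply/negP => /eqmx_scaled[c].
  by apply: no; left; exists i.
have [R [c [bR XR]]] : exists R c,
    ((exists i, R = q i) \/ R = numerator q) /\ X = c *: R.
  by apply: base; rewrite -?evalpt_cvec.
rewrite base_point_count //; last by exists R, c.
apply: intersection_mult_transversal => //.
have c0 : c != 0 by apply: contra_neq X0 => c0; rewrite XR c0 scale0r.
move=> a b dH; apply: (trans R bR) => H.
have := dH H; rewrite XR cubics_polar_scale -scalemxAl mxE => /eqP.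
by rewrite mulf_eq0 expf_eq0 (negbTE c0) andbF => /eqP.
Qed.

End BasePoints.

(** * The generic configuration *)

Section NumericConfigurations.
Implicit Types P Q : seq (seq Z).

Definition zquadrics P :=
  let x := nth [::] P 0 in let y := nth [::] P 1 in let z := nth [::] P 2 in
  [:: zmul x x; zmul x y; zmul x z; zmul y y; zmul y z; zmul z z].

Definition zcubics P :=
  let x := nth [::] P 0 in let y := nth [::] P 1 in let z := nth [::] P 2 in
  [:: zmul (zmul x x) x; zmul (zmul x x) y; zmul (zmul x x) z; zmul x (zmul y y);
      zmul (zmul x y) z; zmul x (zmul z z); zmul (zmul y y) y; zmul (zmul y y) z;
      zmul y (zmul z z); zmul (zmul z z) z].

Definition zcubics_dx P :=
  let x := nth [::] P 0 in let y := nth [::] P 1 in let z := nth [::] P 2 in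
  [:: zscale 3 (zmul x x); zscale 2 (zmul x y); zscale 2 (zmul x z); zmul y y;
      zmul y z; zmul z z; [::]; [::]; [::]; [::]].

Definition zcubics_dy P :=
  let x := nth [::] P 0 in let y := nth [::] P 1 in let z := nth [::] P 2 in
  [:: [::]; zmul x x; [::]; zscale 2 (zmul x y); zmul x z; [::]; zscale 3 (zmul y y);
      zscale 2 (zmul y z); zmul z z; [::]].

Definition zcubics_dz P :=
  let x := nth [::] P 0 in let y := nth [::] P 1 in let z := nth [::] P 2 in
  [:: [::]; [::]; zmul x x; [::]; zmul x y; zscale 2 (zmul x z); [::]; zmul y y;
      zscale 2 (zmul y z); zscale 3 (zmul z z)].

Definition zbracket P1 P2 P3 := zdet 3 [:: P1; P2; P3].

Definition zC (c : seq (seq (seq Z))) i :=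
  zdet 6 [seq zquadrics (nth [::] c k) | k <- [:: i; 3; 4; 5; 6; 7]%N].

Definition zD (c : seq (seq (seq Z))) i j k :=
  let P := nth [::] c i in
  zdet 10 ([seq zcubics (nth [::] c l) | l <- [:: j; k; 3; 4; 5; 6; 7]%N]
           ++ [:: zcubics_dx P; zcubics_dy P; zcubics_dz P]).

Definition znumerator c :=
  let u := zmul (zC c 0) (zmul (zD c 1 2 0) (zD c 2 0 1)) in
  let v := zmul (zD c 0 1 2) (zmul (zC c 1) (zD c 2 0 1)) in
  let w := zmul (zD c 0 1 2) (zmul (zD c 1 2 0) (zC c 2)) in
  [seq zadd (zmul u (nth [::] (nth [::] c 0) j))
        (zadd (zmul v (nth [::] (nth [::] c 1) j)) (zmul w (nth [::] (nth [::] c 2) j)))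
  | j <- iota 0 3].

(** Looks at the constant coefficient only, that is, at the value for parameter 0. *)
Definition znz (a : seq Z) := ~~ Z.eqb (head 0%bZ a) 0.

Definition zgeneric c :=
  let P i := nth [::] c i in let N := znumerator c in
  [&& znz (zbracket (P 0) (P 1) (P 2)), all (fun i => znz (zC c i)) [:: 0; 1; 2]%N,
      znz (zD c 0 1 2), znz (zD c 1 2 0), znz (zD c 2 0 1),
      all (fun i => [&& znz (zbracket (P i) (P 1) (P 2)), znz (zbracket (P 0) (P i) (P 2)),
        znz (zbracket (P 0) (P 1) (P i)), znz (zbracket N (P i) (P 2))
        & znz (zbracket N (P i) (P 1))]) (iota 3 5)
    & all (fun i => all (fun j => (i < j)%N ==> znz (zbracket (P i) (P j) (P 2))
        && znz (zbracket (P i) (P j) (P 1))) (iota 3 5)) (iota 3 5)].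

Variables (R : comNzRingType) (t : R).

Definition zrow n (a : seq (seq Z)) : 'rV[R]_n := \row_(j < n) zeval t (nth [::] a j).

Lemma zrow_rdet n M : rdet [seq zrow n a | a <- M] = zeval t (zdet n M).
Proof.
rewrite -det_zmx; congr (\det _); apply/matrixP => i j; rewrite !mxE.
case: (ltnP i (size M)) => lt; first by rewrite (nth_map [::]) // mxE.
by rewrite !nth_default ?size_map // mxE.
Qed.

Let int2 : zint R 2 = 2. Proof. by []. Qed.
Let int3 : zint R 3 = 3. Proof. by []. Qed.

Lemma quadrics_row_zrow P : quadrics_row (zrow 3 P) = zrow 6 (zquadrics P).
Proof.
apply/rowP => -[]; do 6?[case => [?|]] => //=; rewrite !mxE /= !zevalM; ring.
Qed.

Lemma cubics_row_zrow P : cubics_row (zrow 3 P) = zrow 10 (zcubics P).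
Proof.
apply/rowP => -[]; do 10?[case => [?|]] => //=; rewrite !mxE /= !zevalM; ring.
Qed.

Lemma cubics_row_dx_zrow P : cubics_row_dx (zrow 3 P) = zrow 10 (zcubics_dx P).
Proof.
apply/rowP => -[]; do 10?[case => [?|]] => //=;
  rewrite !mxE /= ?zevalZ ?zevalM ?int2 ?int3; ring.
Qed.

Lemma cubics_row_dy_zrow P : cubics_row_dy (zrow 3 P) = zrow 10 (zcubics_dy P).
Proof.
apply/rowP => -[]; do 10?[case => [?|]] => //=;
  rewrite !mxE /= ?zevalZ ?zevalM ?int2 ?int3; ring.
Qed.

Lemma cubics_row_dz_zrow P : cubics_row_dz (zrow 3 P) = zrow 10 (zcubics_dz P).
Proof.
apply/rowP => -[]; do 10?[case => [?|]] => //=;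
  rewrite !mxE /= ?zevalZ ?zevalM ?int2 ?int3; ring.
Qed.

Lemma bracket_zrow P1 P2 P3 :
  bracket (zrow 3 P1) (zrow 3 P2) (zrow 3 P3) = zeval t (zbracket P1 P2 P3).
Proof. exact: (zrow_rdet 3 [:: P1; P2; P3]). Qed.

Variable c : seq (seq (seq Z)).
Definition zconfig (i : 'I_8) : 'rV[R]_3 := zrow 3 (nth [::] c i).

Let zconfigE k : (k < 8)%N -> zconfig (inord k) = zrow 3 (nth [::] c k).
Proof. by move=> ltk; rewrite /zconfig inordK. Qed.

Lemma Cdet_zconfig i : (i < 8)%N ->
  Cdet (zconfig (inord i)) (zconfig (inord 3)) (zconfig (inord 4)) (zconfig (inord 5))
    (zconfig (inord 6)) (zconfig (inord 7)) = zeval t (zC c i).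
Proof. by move=> lti; rewrite -zrow_rdet /= -!quadrics_row_zrow -!zconfigE. Qed.

Lemma Ddet_zconfig i j k : (i < 8)%N -> (j < 8)%N -> (k < 8)%N ->
  Ddet (zconfig (inord i)) (zconfig (inord j)) (zconfig (inord k)) (zconfig (inord 3))
    (zconfig (inord 4)) (zconfig (inord 5)) (zconfig (inord 6)) (zconfig (inord 7)) =
  zeval t (zD c i j k).
Proof.
move=> lti ltj ltk; rewrite -zrow_rdet /= -cubics_row_dx_zrow -cubics_row_dy_zrow.
by rewrite -cubics_row_dz_zrow -!cubics_row_zrow -!zconfigE.
Qed.

Lemma Cx_zconfig : Cx zconfig = zeval t (zC c 0). Proof. exact: Cdet_zconfig. Qed.
Lemma Cy_zconfig : Cy zconfig = zeval t (zC c 1). Proof. exact: Cdet_zconfig. Qed.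
Lemma Cz_zconfig : Cz zconfig = zeval t (zC c 2). Proof. exact: Cdet_zconfig. Qed.
Lemma Dx_zconfig : Dx zconfig = zeval t (zD c 0 1 2). Proof. exact: Ddet_zconfig. Qed.
Lemma Dy_zconfig : Dy zconfig = zeval t (zD c 1 2 0). Proof. exact: Ddet_zconfig. Qed.
Lemma Dz_zconfig : Dz zconfig = zeval t (zD c 2 0 1). Proof. exact: Ddet_zconfig. Qed.

Definition CD_zconfig := (Cx_zconfig, Cy_zconfig, Cz_zconfig, Dx_zconfig, Dy_zconfig,
  Dz_zconfig).

Lemma numerator_zconfig : numerator zconfig = zrow 3 (znumerator c).
Proof.
rewrite /numerator !CD_zconfig !zconfigE //; apply/rowP => j; rewrite !mxE.
rewrite (nth_map 0%N) ?size_iota // nth_iota // add0n !zevalD !zevalM.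
move: (zC c 0) (zC c 1) (zC c 2) (zD c 0 1 2) (zD c 1 2 0) (zD c 2 0 1).
move: (nth [::] c 0) (nth [::] c 1) (nth [::] c 2) => P0 P1 P2 c0 c1 c2 d0 d1 d2.
by ring.
Qed.
End NumericConfigurations.

Lemma znz_neq0 (R : numDomainType) (a : seq Z) : znz a -> zeval (0 : R) a != 0.
Proof.
case: a => [//|x a] /= /negP x0; rewrite mul0r addr0 /zint intr_eq0.
by apply/negP => /eqP e; apply: x0; rewrite -(int_of_ZK x) e.
Qed.

Lemma zgeneric_config (R : numDomainType) c :
  zgeneric c -> generic_config (zconfig (0 : R) c).
Proof.
case/and5P=> b0 /and4P[cx cy cz _] dx dy /and3P[dz /allP co /allP pr].
have pt k : (k < 8)%N -> zconfig (0 : R) c (inord k) = zrow 0 3 (nth [::] c k).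
  by move=> ltk; rewrite /zconfig inordK.
split.
- by rewrite !pt // bracket_zrow; apply: znz_neq0 b0.
- rewrite !CD_zconfig.
  by split; [apply: znz_neq0 cx | apply: znz_neq0 cy | apply: znz_neq0 cz].
- rewrite !CD_zconfig.
  by split; [apply: znz_neq0 dx | apply: znz_neq0 dy | apply: znz_neq0 dz].
- move=> i /andP[i3 i8]; have /co/and5P[n1 n2 n3 _ _] : i \in iota 3 5.
    by rewrite mem_iota i3.
  rewrite !pt // !bracket_zrow.
  by split; [apply: znz_neq0 n1 | apply: znz_neq0 n2 | apply: znz_neq0 n3].
- move=> i /andP[i3 i8]; have /co/and5P[_ _ _ n1 n2] : i \in iota 3 5.
    by rewrite mem_iota i3.
  rewrite numerator_zconfig !pt // !bracket_zrow.
  by split; [apply: znz_neq0 n1 | apply: znz_neq0 n2].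
move=> i j /andP[i3 ij] j8.
have i8 := ltn_trans ij j8; have j3 := leq_trans i3 (ltnW ij).
have /pr/allP prj : i \in iota 3 5 by rewrite mem_iota i3.
have /prj : j \in iota 3 5 by rewrite mem_iota j3.
rewrite ij => /andP[n1 n2]; rewrite !pt // !bracket_zrow.
by split; [apply: znz_neq0 n1 | apply: znz_neq0 n2].
Qed.

(** A projective frame and four more points with small coordinates; zeros are encoded as empty lists
    for [zdet]. *)
Definition sample_config : seq (seq (seq Z)) :=
  [seq [seq if x is Z0 then [::] else [:: x] | x <- P] |
     P <- [:: [:: 1; 0; 0]; [:: 0; 1; 0]; [:: 0; 0; 1]; [:: 1; 1; 1]; [:: 1; -2; -1];
              [:: 1; 2; 2]; [:: 1; -3; 3]; [:: 1; -1; -2]]%bZ].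

Lemma sample_generic : zgeneric sample_config.
Proof. by vm_compute. Qed.

Lemma eq_numerator (R : comNzRingType) (p q : 'I_8 -> 'rV[R]_3) : p =1 q ->
  numerator p = numerator q.
Proof. by move=> E; rewrite /numerator /Cx /Cy /Cz /Dx /Dy /Dz !E. Qed.

Lemma eq_generic_config (R : comNzRingType) (p q : 'I_8 -> 'rV[R]_3) : p =1 q ->
  generic_config p -> generic_config q.
Proof.
move=> E [gb gC gD gco gn gp]; rewrite (eq_numerator E) in gn; split.
- by rewrite -!E.
- by case: gC; rewrite /Cx /Cy /Cz !E.
- by case: gD; rewrite /Dx /Dy /Dz !E.
- by move=> i /gco; rewrite !E.
- by move=> i /gn; rewrite !E.
- by move=> i j lij /(gp i j lij); rewrite !E.
Qed.

Definition polypoint (i : 'I_8) : 'rV[polyR]_3 := \row_(j < 3) 'X_(mxvec_index i j).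

Lemma generic_pointE i : generic_point i = map_mx (@tofrac polyR) (polypoint i).
Proof. by apply/rowP => j; rewrite !mxE. Qed.

Definition at_points (R : comNzRingType) (q : 'I_8 -> 'rV[R]_3) : 'I_(8 * 3) -> R :=
  fun k => mxvec (\matrix_(i < 8, j < 3) q i 0 j) 0 k.

Lemma at_pointsE (R : comNzRingType) (q : 'I_8 -> 'rV[R]_3) i j :
  at_points q (mxvec_index i j) = q i 0 j.
Proof. by rewrite /at_points mxvecE mxE. Qed.

Lemma meval_polypoint (q : 'I_8 -> 'rV[rat]_3) i :
  map_mx (meval (at_points q)) (polypoint i) = q i.
Proof. by apply/rowP => j; rewrite !mxE mevalXU at_pointsE. Qed.

(** The unknowns are specialized to the sample renumbered by the inverse of s, so that the permuted
    points become the sample in its own order. *)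
Lemma polypoint_generic (s : 'S_8) : generic_config (fun i => polypoint (s i)).
Proof.
pose q i := zconfig (0 : rat) sample_config ((s^-1)%g i).
apply: (generic_config_map (f := meval (at_points q))) => [r|].
  by apply: contra_neq => ->; rewrite raddf0.
apply: (@eq_generic_config _ (zconfig (0 : rat) sample_config)) => [i|].
  by rewrite meval_polypoint /q permK.
exact: zgeneric_config sample_generic.
Qed.

Lemma generic_point_generic (s : 'S_8) : generic_config (fun i => generic_point (s i)).
Proof.
apply: (@eq_generic_config _ (fun i => map_mx (@tofrac polyR) (polypoint (s i)))).
  by move=> i; rewrite generic_pointE.
apply: map_generic_config (polypoint_generic s) => r.
by rewrite tofrac_eq0.
Qed.

(** Enumerate each set followed by its complement, and match the two enumerations. *)
Lemma perm_of_set (T : finType) (A B : {set T}) : #|A| = #|B| ->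
  exists s : {perm T}, forall x, (s x \in B) = (x \in A).
Proof.
move=> cAB; pose l (A : {set T}) := enum A ++ enum (~: A).
have mem_l (C : {set T}) x : x \in l C by rewrite mem_cat !mem_enum inE orbN.
have uniq_l (C : {set T}) : uniq (l C).
  rewrite cat_uniq !enum_uniq andbT /=; apply/hasPn => x.
  by rewrite !mem_enum inE.
have size_l (C : {set T}) : size (l C) = #|T|.
  by rewrite size_cat -!cardE cardsC.
pose f x := nth x (l B) (index x (l A)).
have idx x : (index x (l A) < size (l B))%N.
  by rewrite size_l -(size_l A) index_mem.
have finj : injective f.
  move=> x y; rewrite /f (set_nth_default x y (idx y)) => /eqP.
  rewrite nth_uniq // => /eqP e.
  by rewrite -[x](nth_index x (mem_l A x)) e nth_index.
exists (perm finj) => x; rewrite permE /f nth_cat -cardE -cAB.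
rewrite index_cat -[x \in A]mem_enum; have [xA|xA] := boolP (x \in enum A).
  by rewrite cardE index_mem xA -mem_enum mem_nth // -cardE -cAB cardE index_mem.
rewrite cardE ltnNge leq_addr /= addKn; apply/negbTE.
have : nth x (enum (~: B)) (index x (enum (~: A))) \in enum (~: B).
  rewrite mem_nth // -cardE cardsCs setCK -cAB -[#|A|](congr1 (fun C => #|pred_of_set C|) (setCK A)).
  rewrite -cardsCs cardE index_mem mem_enum inE.
  by rewrite mem_enum in xA.
by rewrite mem_enum inE.
Qed.

Section LowDegreeForms.
Variable K : fieldType.
Implicit Type F : {mpoly K[3]}.

Definition mnms1 : seq 'X_{1..3} := [:: mnm3 1 0 0; mnm3 0 1 0; mnm3 0 0 1].
Definition mnms2 : seq 'X_{1..3} := [:: mnm3 2 0 0; mnm3 1 1 0; mnm3 1 0 1;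
  mnm3 0 2 0; mnm3 0 1 1; mnm3 0 0 2].

Lemma uniq_mnms1 : uniq mnms1. Proof. by rewrite /mnms1 /= !inE !mnm3_inj. Qed.
Lemma uniq_mnms2 : uniq mnms2. Proof. by rewrite /mnms2 /= !inE !mnm3_inj. Qed.

Lemma mem_mnms1 m : mdeg m = 1%N -> m \in mnms1.
Proof.
rewrite [m]mnm3E mdegE !big_ord_recl big_ord0 !mnmE /=.
move: (m 0) (m 1) (m 2) => a b c; rewrite /bump /= !inE !mnm3_inj => E.
have [la lb lc] : [/\ a < 2, b < 2 & c < 2]%N by split; lia.
by move: E la lb lc; case: a => [|[|a]]; case: b => [|[|b]]; case: c => [|[|c]].
Qed.

Lemma mem_mnms2 m : mdeg m = 2%N -> m \in mnms2.
Proof.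
rewrite [m]mnm3E mdegE !big_ord_recl big_ord0 !mnmE /=.
move: (m 0) (m 1) (m 2) => a b c; rewrite /bump /= !inE !mnm3_inj => E.
have [la lb lc] : [/\ a < 3, b < 3 & c < 3]%N by split; lia.
by move: E la lb lc; case: a => [|[|[|a]]]; case: b => [|[|[|b]]]; case: c => [|[|[|c]]].
Qed.

Lemma rdet_vanish n (s : seq 'rV[K]_n) (c : 'cV[K]_n) : size s = n -> rdet s != 0 ->
  (forall r, r \in s -> (r *m c) 0 0 = 0) -> c = 0.
Proof.
move=> szs d0 sc; pose M := \matrix_(i < n) nth 0 s i.
have Mu : M \in unitmx by rewrite unitmxE unitfE.
rewrite -[c](mulKmx Mu); suff -> : M *m c = 0 by rewrite mulmx0.
apply/colP => i; rewrite [RHS]mxE.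
have <- : (row i M *m c) 0 0 = (M *m c) i 0 by rewrite -row_mul mxE.
by rewrite rowK sc // mem_nth ?szs.
Qed.

Lemma line_through F (u v w : 'rV[K]_3) : F \is 1.-homog -> bracket u v w != 0 ->
  evalpt F u = 0 -> evalpt F v = 0 -> evalpt F w = 0 -> F = 0.
Proof.
move=> homF d0 Fu Fv Fw; pose c : 'cV[K]_3 :=
  \col_j [:: F@_(mnm3 1 0 0); F@_(mnm3 0 1 0); F@_(mnm3 0 0 1)]`_j.
have FE := homog_sum uniq_mnms1 mem_mnms1 homF.
have evalE Q : evalpt F Q = (Q *m c) 0 0.
  rewrite mul3E !mxE /= {1}FE !big_cons big_nil addr0 !mpolyX_mnm3 /evalpt.
  rewrite !(mevalD, mevalZ, mevalM, rmorphXn) /= !mevalXU; ring.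
have : c = 0.
  apply: (@rdet_vanish _ [:: u; v; w]) => // r.
  by rewrite !inE => /or3P[] /eqP->; rewrite -evalE.
move/colP => c0; have e k (ltk : (k < 3)%N) := c0 (Ordinal ltk).
rewrite FE !big_cons big_nil.
have := e 0%N isT; rewrite !mxE /= => ->; have := e 1%N isT; rewrite !mxE /= => ->.
by have := e 2%N isT; rewrite !mxE /= => ->; rewrite !scale0r !addr0.
Qed.

Lemma conic_through F (s : seq 'rV[K]_3) : F \is 2.-homog -> size s = 6%N ->
  rdet [seq quadrics_row Q | Q <- s] != 0 ->
  (forall Q, Q \in s -> evalpt F Q = 0) -> F = 0.
Proof.
move=> homF szs d0 Fs; pose c : 'cV[K]_6 :=
  \col_j [:: F@_(mnm3 2 0 0); F@_(mnm3 1 1 0); F@_(mnm3 1 0 1); F@_(mnm3 0 2 0);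
    F@_(mnm3 0 1 1); F@_(mnm3 0 0 2)]`_j.
have FE := homog_sum uniq_mnms2 mem_mnms2 homF.
have evalE Q : evalpt F Q = (quadrics_row Q *m c) 0 0.
  rewrite mxE !big_ord_recl big_ord0 !mxE /=.
  rewrite {1}FE !big_cons big_nil addr0 !mpolyX_mnm3 /evalpt.
  rewrite !(mevalD, mevalZ, mevalM, rmorphXn) /= !mevalXU.
  move: (F@_(mnm3 2 0 0)) (F@_(mnm3 1 1 0)) (F@_(mnm3 1 0 1)) (F@_(mnm3 0 2 0)).
  by move: (F@_(mnm3 0 1 1)) (F@_(mnm3 0 0 2)) => *; ring.
have : c = 0.
  apply: (@rdet_vanish _ [seq quadrics_row Q | Q <- s]); rewrite ?size_map //.
  by move=> _ /mapP[Q Qs ->]; rewrite -evalE Fs.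
move/colP => c0; have e k (ltk : (k < 6)%N) := c0 (Ordinal ltk).
rewrite FE !big_cons big_nil.
have := e 0%N isT; rewrite !mxE /= => ->; have := e 1%N isT; rewrite !mxE /= => ->.
have := e 2%N isT; rewrite !mxE /= => ->; have := e 3%N isT; rewrite !mxE /= => ->.
have := e 4%N isT; rewrite !mxE /= => ->; have := e 5%N isT; rewrite !mxE /= => ->.
by rewrite !scale0r !addr0.
Qed.
End LowDegreeForms.

Lemma generic_point_distinct i j : i != j -> ~~ (generic_point i == generic_point j)%MS.
Proof.
move=> ij; have := generic_distinct (generic_point_generic 1%g) ij.
move=> [S]; rewrite !perm1; apply: contraNN => /eqmx_bracket ->; exact: eqxx.
Qed.

Lemma card_inords (s : seq nat) : all (fun k => k < 8)%N s -> uniq s ->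
  #|[set x in [seq (inord k : 'I_8) | k <- s]]| = size s.
Proof.
move=> /allP s8 us; rewrite cardsE -(size_map (fun k => inord k : 'I_8)).
apply/card_uniqP; rewrite map_inj_in_uniq // => k l ks ls /(congr1 val).
by rewrite /= !inordK ?s8.
Qed.

(** A permutation brings any three or six points to the positions used in the bracket or in Cx, and
    every permuted configuration is generic. *)
Lemma generic_point_position : general_position generic_point.
Proof.
split.
- by move=> i; have := generic_neq0 (generic_point_generic 1%g) i; rewrite perm1.
- exact: generic_point_distinct.
- move=> A cA F homF FA; have cB := card_inords (s := [:: 0; 1; 2]%N) isT isT.
  have [s sA] := perm_of_set (etrans cB (esym cA)); have gs := generic_point_generic s.
  by apply: (line_through homF (gen_bracket gs)); apply: FA; rewrite sA inE map_f.
- move=> A cA F homF FA; have cB := card_inords (s := [:: 0; 3; 4; 5; 6; 7]%N) isT isT.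
  have [s sA] := perm_of_set (etrans cB (esym cA)); have gs := generic_point_generic s.
  have [Cx0 _ _] := gen_C gs.
  apply: (conic_through homF
    (s := [seq generic_point (s (inord k)) | k <- [:: 0; 3; 4; 5; 6; 7]%N])) => //.
  by move=> _ /mapP[k kin ->]; apply: FA; rewrite sA inE map_f.
Qed.

Lemma ninth_Cayley_Bacharach :
  is_Cayley_Bacharach_point generic_point (ninth_formula generic_point).
Proof.
have gp : generic_config generic_point.
  apply: eq_generic_config (generic_point_generic 1%g) => i.
  by rewrite perm1.
split; first exact: generic_point_position.
  rewrite ninth_formulaE scaler_eq0 negb_or invr_eq0 (gen_bracket gp).
  exact: numerator_neq0.
move=> F G cF cG indep L iota _ X X0.
exact: generic_multiplicity.
Qed.

(** * Divisibility by the bracket *)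

Section Collinear.
Variable R : comNzRingType.
Implicit Types Q : 'rV[R]_3.

Lemma det_mx33 (A : 'M[R]_3) : \det A =
  A 0 0 * (A 1 1 * A 2 2 - A 1 2 * A 2 1) - A 0 1 * (A 1 0 * A 2 2 - A 1 2 * A 2 0)
  + A 0 2 * (A 1 0 * A 2 1 - A 1 1 * A 2 0).
Proof.
have -> : A = \matrix_(i < 3) nth 0 [:: row 0 A; row 1 A; row 2 A] i.
  by apply/row_matrixP => i; rewrite rowK; move: i; apply: ord3P.
by rewrite [LHS]bracketE !mxE /= ?mxE.
Qed.

Definition binary_cubic Q : 'rV[R]_4 := let x := Q 0 0 in let y := Q 0 1 in
  \row_(j < 4) [:: x ^+ 3; x ^+ 2 * y; x * y ^+ 2; y ^+ 3]`_j.
Definition binary_cubic_dx Q : 'rV[R]_4 := let x := Q 0 0 in let y := Q 0 1 in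
  \row_(j < 4) [:: 3 * x ^+ 2; 2 * x * y; y ^+ 2; 0]`_j.
Definition binary_cubic_dy Q : 'rV[R]_4 := let x := Q 0 0 in let y := Q 0 1 in
  \row_(j < 4) [:: 0; x ^+ 2; 2 * x * y; 3 * y ^+ 2]`_j.

(* A confluent Vandermonde determinant.                                        *)
Lemma binary_cubic_det Q1 Q2 Q3 :
  let d Q Q' := Q 0 0 * Q' 0 1 - Q 0 1 * Q' 0 0 in
  rdet [:: binary_cubic Q2; binary_cubic Q3; binary_cubic_dx Q1; binary_cubic_dy Q1] =
  3 * (d Q1 Q2 ^+ 2 * d Q3 Q1 ^+ 2 * d Q2 Q3).
Proof.
rewrite /rdet (expand_det_row _ 0) !big_ord_recl big_ord0 /cofactor !det_mx33 !mxE /=.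
move: (Q1 0 0) (Q1 0 1) (Q2 0 0) (Q2 0 1) (Q3 0 0) (Q3 0 1) => a b c d e f.
by ring.
Qed.

Variables R4 R5 R6 R7 R8 : 'rV[R]_3.

(** The column order l lists the monomials without z before the multiples of z. On z = 0, the rows
    of Q2, Q3 and the first two derivative rows at Q1 occupy the first four columns. The
    z-derivative and the other five points give the conic determinant in the last six. The factor k,
    a sign times the z-coordinates of those five points, is the same for Dx, Dy and Dz. *)
Lemma Ddet_flat : exists k, forall Q1 Q2 Q3,
  Q1 0 2 = 0 -> Q2 0 2 = 0 -> Q3 0 2 = 0 ->
  Ddet Q1 Q2 Q3 R4 R5 R6 R7 R8 = k * Cdet Q1 R4 R5 R6 R7 R8 *
    rdet [:: binary_cubic Q2; binary_cubic Q3; binary_cubic_dx Q1; binary_cubic_dy Q1].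
Proof.
pose l := [:: 0; 1; 3; 6; 2; 4; 5; 7; 8; 9]%N.
pose z := R4 0 2 * R5 0 2 * R6 0 2 * R7 0 2 * R8 0 2.
exists (z * -1) => Q1 Q2 Q3 z1 z2 z3.
have listE (a : seq R) (u : 'rV[R]_4) (v : 'rV[R]_6) b c : size b = 4%N ->
    u = \row_j b`_j -> v = \row_j c`_j -> [seq nth 0 a i | i <- l] = b ++ c ->
    colpick l (\row_(j < 10) a`_j) = row_mx u v.
  by move=> szb -> -> E; rewrite colpickE // E (@row_mx_list R 4 6).
have six : forall a b c d e f a' b' c' d' e' f' : R, a = a' -> b = b' -> c = c' -> d = d' ->
    e = e' -> f = f' -> [:: a; b; c; d; e; f] = [:: a'; b'; c'; d'; e'; f'].
  by move=> ? ? ? ? ? ? ? ? ? ? ? ? -> -> -> -> -> ->.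
have cub Q : colpick l (cubics_row Q) = row_mx (binary_cubic Q) (Q 0 2 *: quadrics_row Q).
  pose x := Q 0 0; pose y := Q 0 1; pose w := Q 0 2.
  apply: (listE _ _ _ [:: x ^+ 3; x ^+ 2 * y; x * y ^+ 2; y ^+ 3]
    [:: w * x ^+ 2; w * (x * y); w * (x * w); w * y ^+ 2; w * (y * w); w * w ^+ 2]) => //.
    by apply/rowP => -[]; do 6?[case => [?|]] => //=; rewrite !mxE.
  rewrite /= -/x -/y -/w; do 4![apply: (congr2 cons); first by []].
  by apply: six; ring.
have flat0 : 0 = \row_(j < 6) [:: 0; 0; 0; 0; 0; 0 : R]`_j.
  by apply/rowP => -[]; do 6?[case => [?|]] => //=; rewrite !mxE.
pose x := Q1 0 0; pose y := Q1 0 1.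
have dx : colpick l (cubics_row_dx Q1) = row_mx (binary_cubic_dx Q1) 0.
  apply: (listE _ _ _ [:: 3 * x ^+ 2; 2 * x * y; y ^+ 2; 0] _ erefl erefl flat0).
  by rewrite /= z1; do 4![apply: (congr2 cons); first by []]; apply: six; ring.
have dy : colpick l (cubics_row_dy Q1) = row_mx (binary_cubic_dy Q1) 0.
  apply: (listE _ _ _ [:: 0; x ^+ 2; 2 * x * y; 3 * y ^+ 2] _ erefl erefl flat0).
  by rewrite /= z1; do 4![apply: (congr2 cons); first by []]; apply: six; ring.
have dz : colpick l (cubics_row_dz Q1) = row_mx (0 : 'rV_4) (1 *: quadrics_row Q1).
  have zero4 : 0 = \row_(j < 4) [:: 0; 0; 0; 0 : R]`_j.
    by apply/rowP => -[]; do 4?[case => [?|]] => //=; rewrite !mxE.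
  apply: (listE _ _ _ [:: 0; 0; 0; 0] [:: x ^+ 2; x * y; x * 0; y ^+ 2; y * 0; 0 ^+ 2] erefl zero4).
    by rewrite scale1r /quadrics_row z1.
  rewrite /= z1 -/x -/y; do 4?[apply: (congr2 cons); first by ring].
  by apply: six; ring.
have sgn : zeval (0 : R) (zdet 10 (colmx 10 l)) = 1.
  have -> : zdet 10 (colmx 10 l) = [:: 1%bZ] by vm_compute.
  by rewrite /= mul0r addr0.
pose rows := [:: cubics_row Q2; cubics_row Q3; cubics_row_dx Q1; cubics_row_dy Q1;
  cubics_row_dz Q1; cubics_row R4; cubics_row R5; cubics_row R6; cubics_row R7;
  cubics_row R8].
have -> : Ddet Q1 Q2 Q3 R4 R5 R6 R7 R8 = - rdet rows.
  rewrite /Ddet -/(rdet _) /=.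
  set c2 := cubics_row Q2; set c3 := cubics_row Q3.
  set c4 := cubics_row R4; set c5 := cubics_row R5; set c6 := cubics_row R6.
  set c7 := cubics_row R7; set c8 := cubics_row R8.
  set ux := cubics_row_dx Q1; set uy := cubics_row_dy Q1; set uz := cubics_row_dz Q1.
  rewrite /rows -/c2 -/c3 -/c4 -/c5 -/c6 -/c7 -/c8 -/ux -/uy -/uz.
  rewrite (@rdet_move R 10 [:: c2; c3; ux; uy] [:: c4; c5; c6; c7; c8] [::] uz) //=.
  rewrite (@rdet_move R 10 [:: c2; c3; ux] [:: c4; c5; c6; c7; c8] [:: uz] uy) //=.
  rewrite (@rdet_move R 10 [:: c2; c3] [:: c4; c5; c6; c7; c8] [:: uy; uz] ux) //=.
  by ring.
have := rdet_colpick rows (erefl : size l = 10%N); rewrite sgn mulr1 => <-.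
rewrite /rows /= !cub z2 z3 !scale0r dx dy dz.
set s := [:: binary_cubic Q2; binary_cubic Q3; binary_cubic_dx Q1; binary_cubic_dy Q1].
pose t := [:: (quadrics_row Q1, 1 : R); (quadrics_row R4, R4 0 2);
  (quadrics_row R5, R5 0 2); (quadrics_row R6, R6 0 2); (quadrics_row R7, R7 0 2);
  (quadrics_row R8, R8 0 2)].
pose tl := [:: 0; binary_cubic R4; binary_cubic R5; binary_cubic R6; binary_cubic R7;
  binary_cubic R8].
have -> : z * -1 * Cdet Q1 R4 R5 R6 R7 R8 = - rdet [seq r.2 *: r.1 | r <- t].
  have CE : Cdet Q1 R4 R5 R6 R7 R8 = rdet (unzip1 t) by [].
  rewrite rdet_scale // CE; move: (rdet _) => C; rewrite !big_cons big_nil /= /z.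
  by ring.
rewrite mulNr; congr (- _).
have blocks (a b c d : 'rV[R]_4) (u : seq ('rV[R]_4 * 'rV[R]_6)) : size u = 6%N ->
    rdet ([seq row_mx r 0 | r <- [:: a; b; c; d]] ++ [seq row_mx r.1 r.2 | r <- u]) =
    rdet (unzip2 u) * rdet [:: a; b; c; d].
  move=> szu; rewrite (@rdet_cat R 4 6) //.
  have -> : \matrix_(i < 4) nth 0 [seq row_mx r 0 | r <- [:: a; b; c; d]] i =
      row_mx (\matrix_(i < 4) nth 0 [:: a; b; c; d] i) 0 :> 'M_(4, 4 + 6).
    apply/row_matrixP => i; rewrite row_row_mx !rowK row0 (nth_map 0) //.
  have -> : \matrix_(i < 6) nth 0 [seq row_mx r.1 r.2 | r <- u] i =
      row_mx (\matrix_(i < 6) nth 0 (unzip1 u) i) (\matrix_(i < 6) nth 0 (unzip2 u) i)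
      :> 'M_(6, 4 + 6).
    by apply/row_matrixP => i; rewrite row_row_mx !rowK !(nth_map (0, 0)) ?szu.
  by rewrite -block_mxEv det_lblock mulrC.
rewrite -(blocks _ _ _ _ (zip tl [seq r.2 *: r.1 | r <- t])) //.
Qed.
End Collinear.

(** Move the common line to z = 0 and let d_ij be the binary determinant of Pi and Pj. By
    [Ddet_flat] the three coefficients are a common factor times d_23, d_31, d_12, and d_23 P1 +
    d_31 P2 + d_12 P3 = 0. *)
Lemma numerator_collinear (K : fieldType) (p : 'I_8 -> 'rV[K]_3) :
  bracket (p (inord 0)) (p (inord 1)) (p (inord 2)) = 0 -> numerator p = 0.
Proof.
move=> b0.
have [n n0 pn] : exists2 n : 'cV[K]_3, n != 0 & forall k, (k < 3)%N -> p (inord k) *m n = 0.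
  pose M := \matrix_(i < 3) nth 0 [:: p (inord 0); p (inord 1); p (inord 2)] i.
  have /det0P[v v0 vM] : \det M^T == 0 by rewrite det_tr; apply/eqP.
  exists v^T; first by rewrite -trmx0 (inj_eq trmx_inj).
  move=> k k3; have -> : p (inord k) = row (inord k) M.
    by rewrite rowK inordK //; case: k k3 => [|[|[|//]]].
  by rewrite -row_mul -[M]trmxK -trmx_mul vM trmx0 row0.
(* An invertible matrix whose last column is the equation n of the line carries that line to z = 0;
   n is completed according to a nonzero coordinate. *)
have [g gu gn] : exists2 g : 'M[K]_3, g \in unitmx & col 2 g = n.
  pose m r0 r1 r2 : 'M[K]_3 := \matrix_(i < 3) nth 0 [:: r0; r1; r2] i.
  have det_m r0 r1 r2 : \det (m r0 r1 r2) = bracket r0 r1 r2 by [].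
  have col_m (a b c a' b' c' : K) : col 2 (m (row3 a b (n 0 0)) (row3 c a' (n 1 0))
      (row3 b' c' (n 2 0))) = n.
    by apply/colP; apply: ord3P; rewrite !mxE /= ?mxE.
  have [n2|n2] := eqVneq (n 2 0) 0; last first.
    exists (m (row3 1 0 (n 0 0)) (row3 0 1 (n 1 0)) (row3 0 0 (n 2 0))) => //.
    rewrite unitmxE unitfE det_m bracketE !mxE /=.
    by apply: contra_neq n2 => <-; ring.
  have [n1|n1] := eqVneq (n 1 0) 0; last first.
    exists (m (row3 1 0 (n 0 0)) (row3 0 0 (n 1 0)) (row3 0 1 (n 2 0))) => //.
    rewrite unitmxE unitfE det_m bracketE !mxE /=.
    by apply: contra_neq n1 => e; apply: oppr_inj; rewrite oppr0 -e; ring.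
  exists (m (row3 0 0 (n 0 0)) (row3 1 0 (n 1 0)) (row3 0 1 (n 2 0))) => //.
  rewrite unitmxE unitfE det_m bracketE !mxE /=.
  apply: contra_neq n0 => e; apply/colP; apply: ord3P; rewrite mxE //.
  by rewrite -e; ring.
have [l l0 [m m0 [_ _ EN]]] := numerator_mul p gu.
suff N0 : numerator (fun i => p i *m g) = 0.
  have : numerator p *m g = 0.
    by apply: (scalerI (mulf_neq0 l0 (expf_neq0 2 m0))); rewrite -EN N0 scaler0.
  by move/(congr1 (mulmx^~ (invmx g))); rewrite mulmxK // mul0mx.
have q0 k : (k < 3)%N -> (p (inord k) *m g) 0 2 = 0.
  move=> k3; have <- : (p (inord k) *m col 2 g) 0 0 = (p (inord k) *m g) 0 2.
    by rewrite colE mulmxA -colE mxE.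
  by rewrite gn pn // mxE.
have [c cE] := Ddet_flat (p (inord 3) *m g) (p (inord 4) *m g) (p (inord 5) *m g)
  (p (inord 6) *m g) (p (inord 7) *m g).
have [z0 z1 z2] := And3 (q0 0%N isT) (q0 1%N isT) (q0 2%N isT).
rewrite /numerator /Cx /Cy /Cz /Dx /Dy /Dz !cE // !binary_cubic_det.
set cx := Cdet (p (inord 0) *m g) _ _ _ _ _; set cy := Cdet (p (inord 1) *m g) _ _ _ _ _.
set cz := Cdet (p (inord 2) *m g) _ _ _ _ _.
move: cx cy cz z0 z1 z2; move: (p (inord 0) *m g) (p (inord 1) *m g) (p (inord 2) *m g).
move=> q0' q1' q2' cx cy cz z0 z1 z2.
by apply/rowP; apply: ord3P; rewrite !mxE ?z0 ?z1 ?z2; ring.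
Qed.

(** * Polynomials linear in one unknown *)

Section PolynomialMorphisms.
Variables (n : nat) (R : comNzRingType).

Lemma mmapXU (S : comNzRingType) (f : {rmorphism R -> S}) (h : 'I_n -> S) i :
  mmap f h 'X_i = h i.
Proof. by rewrite mmapX mmap1U. Qed.

Lemma mpoly_morph_eq (S : comNzRingType) (f g : {rmorphism {mpoly R[n]} -> S}) :
  (forall c, f c%:MP = g c%:MP) -> (forall i, f 'X_i = g 'X_i) -> f =1 g.
Proof.
move=> fgC fgX q; rewrite [q]mpolyE !rmorph_sum; apply: eq_bigr => m _ /=.
rewrite -mul_mpolyC !rmorphM fgC mpolyXE_id !rmorph_prod /=; congr (_ * _).
by apply: eq_bigr => i _; rewrite !rmorphXn /= fgX.
Qed.

Lemma mpoly_ring_ind (P : {mpoly R[n]} -> Prop) : (forall c, P c%:MP) ->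
  (forall i, P 'X_i) -> (forall p q, P p -> P q -> P (p + q)) ->
  (forall p q, P p -> P q -> P (p * q)) -> forall q, P q.
Proof.
move=> PC PX PD PM q; have P1 : P 1 by rewrite -mpolyC1.
rewrite [q]mpolyE; apply: big_ind => //; first by rewrite -(mpolyC0 n R).
move=> m _; rewrite -mul_mpolyC mpolyXE_id; apply: (PM) => //.
apply: big_ind => // i _; elim: (m i) => [|e IH]; first by rewrite expr0.
by rewrite exprS; apply: (PM).
Qed.
End PolynomialMorphisms.

Section LinearPrime.
Variables (F : fieldType) (n : nat).
Local Notation A := {mpoly F[n]}.
Implicit Types f q u w : A.

Definition prime_poly f := forall a b, divides f (a * b) -> divides f a \/ divides f b.

Variable k : 'I_n.

(** Sets ['X_k] to 0; being fixed by it expresses that a polynomial does not involve ['X_k]. *)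
Definition kill : {rmorphism A -> A} :=
  mmap (@mpolyC n F) (fun i => if i == k then 0 else 'X_i).

Lemma killC c : kill c%:MP = c%:MP. Proof. exact: mmapC. Qed.
Lemma killX i : kill 'X_i = if i == k then 0 else 'X_i. Proof. exact: mmapXU. Qed.

Variables u w : A.
Hypotheses (ku : kill u = u) (kw : kill w = w) (u0 : u != 0).
Let f := u * 'X_k + w.
Hypothesis regular : forall h, divides u (f * h) -> divides u h.

Definition linear_root (i : 'I_n) : {fraction A} :=
  if i == k then - (tofrac w / tofrac u) else tofrac 'X_i.

(** Substitutes - w / u for ['X_k], which makes f vanish; its kernel turns out to be generated by
    f. *)
Definition at_root : {rmorphism A -> {fraction A}} :=
  mmap (@tofrac A \o @mpolyC n F) linear_root.

Let at_rootC c : at_root c%:MP = tofrac c%:MP. Proof. exact: mmapC. Qed.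
Let at_rootX i : at_root 'X_i = linear_root i. Proof. exact: mmapXU. Qed.

Let at_root_kill q : at_root (kill q) = tofrac (kill q).
Proof.
apply: (@mpoly_morph_eq _ _ _ (at_root \o kill) (@tofrac A \o kill)) => [c|i] /=.
  by rewrite killC at_rootC.
rewrite killX; case: ifP => ik; first by rewrite !rmorph0.
by rewrite at_rootX /linear_root ik.
Qed.

Lemma at_rootE : at_root f = 0.
Proof.
have au : at_root u = tofrac u by rewrite -{1}ku at_root_kill ku.
have aw : at_root w = tofrac w by rewrite -{1}kw at_root_kill kw.
rewrite rmorphD rmorphM /= at_rootX /linear_root eqxx au aw.
by rewrite mulrN mulrC divfK ?tofrac_eq0 // addNr.
Qed.

Let reduction q : exists e r h, kill r = r /\ u ^+ e * q = r + f * h.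
Proof.
elim/mpoly_ring_ind: q => [c|i|p q|p q].
- by exists 0%N, c%:MP, 0; rewrite killC mul1r mulr0 addr0.
- have [->|ik] := eqVneq i k.
    by exists 1%N, (- w), 1; rewrite rmorphN kw /f; split=> //; ring.
  by exists 0%N, 'X_i, 0; rewrite killX (negbTE ik) mul1r mulr0 addr0.
- move=> [e1 [r1 [h1 [k1 E1]]]] [e2 [r2 [h2 [k2 E2]]]].
  exists (e1 + e2)%N, (u ^+ e2 * r1 + u ^+ e1 * r2), (u ^+ e2 * h1 + u ^+ e1 * h2).
  rewrite rmorphD !rmorphM !rmorphXn /= ku k1 k2; split=> //.
  transitivity (u ^+ e2 * (u ^+ e1 * p) + u ^+ e1 * (u ^+ e2 * q)).
    by rewrite exprD; ring.
  by rewrite E1 E2; ring.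
- move=> [e1 [r1 [h1 [k1 E1]]]] [e2 [r2 [h2 [k2 E2]]]].
  exists (e1 + e2)%N, (r1 * r2), (r1 * h2 + r2 * h1 + f * h1 * h2).
  rewrite rmorphM /= k1 k2; split=> //.
  transitivity ((u ^+ e1 * p) * (u ^+ e2 * q)); first by rewrite exprD; ring.
  by rewrite E1 E2; ring.
Qed.

(* Pseudo-division gives u ^+ e * q = r + f * h with r free of 'X_k, and the   *)
(* regularity of u modulo f disposes of u ^+ e.                                *)
Lemma at_root_eq0 q : at_root q = 0 -> divides f q.
Proof.
have [e [r [h [kr E]]]] := reduction q => q0.
have r0 : r = 0.
  apply/eqP; rewrite -tofrac_eq0 -kr -at_root_kill kr; apply/eqP.
  have := congr1 at_root E; rewrite rmorphD !rmorphM /= at_rootE q0 mulr0 mul0r addr0.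
  by [].
move: E; rewrite r0 add0r; elim: e h => [|e IH] h.
  by rewrite expr0 mul1r => ->; exists h.
rewrite exprS -mulrA => E.
have [h' hE] : divides u h by apply: regular; exists (u ^+ e * q).
apply: (IH h'); apply: (mulfI u0); rewrite E hE; ring.
Qed.

Lemma linear_prime : prime_poly f.
Proof.
move=> a b [q E]; have /eqP : at_root a * at_root b = 0.
  by rewrite -rmorphM E rmorphM /= at_rootE mul0r.
by rewrite mulf_eq0 => /orP[] /eqP /at_root_eq0; [left | right].
Qed.
End LinearPrime.

Section LinearPrimeInstances.
Variables (F : fieldType) (n : nat).
Implicit Types u w : {mpoly F[n]}.

Lemma prime_var (k : 'I_n) : prime_poly ('X_k : {mpoly F[n]}).
Proof.
have := @linear_prime F n k 1 0 (rmorph1 _) (rmorph0 _) (oner_neq0 _).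
rewrite mul1r addr0; apply=> h _; by exists h; rewrite mul1r.
Qed.

(** If the prime u divides u ['X_k] + w, it divides w. *)
Lemma prime_regular u w (k : 'I_n) : prime_poly u -> ~ divides u w ->
  forall h, divides u ((u * 'X_k + w) * h) -> divides u h.
Proof.
move=> pu uw h /pu[[q E]|//]; case: uw; exists (q - 'X_k).
by rewrite mulrBr -E; ring.
Qed.
End LinearPrimeInstances.

Lemma mxvec_index_eq m n (i i' : 'I_m) (j j' : 'I_n) :
  (mxvec_index i j == mxvec_index i' j') = (i == i') && (j == j').
Proof. by rewrite (inj_eq (@cast_ord_inj _ _ _)) (inj_eq enum_rank_inj). Qed.

Section BracketDivides.
Let x i j : polyR := 'X_(mxvec_index (inord i) j).
Let minor : polyR := x 0 0 * x 1 1 - x 0 1 * x 1 0.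
Let b : polyR := bracket (polypoint (inord 0)) (polypoint (inord 1)) (polypoint (inord 2)).
Let tail : polyR := x 0 2 * (x 1 0 * x 2 1 - x 1 1 * x 2 0)
  - x 1 2 * (x 0 0 * x 2 1 - x 0 1 * x 2 0).

Let minorE : minor = x 1 1 * x 0 0 - x 0 1 * x 1 0.
Proof. by rewrite /minor; ring. Qed.
Let bE : b = minor * x 2 2 + tail.
Proof. by rewrite /b bracketE !mxE /minor /tail /x; ring. Qed.

Let kill_x i j i' j' : (i < 8)%N -> (i' < 8)%N -> (i != i') || (j != j') ->
  kill rat (mxvec_index (inord i) j) (x i' j') = x i' j'.
Proof.
move=> li li' ne; rewrite killX mxvec_index_eq -(inj_eq val_inj) /= !inordK //.
by rewrite [i' == i]eq_sym [j' == j]eq_sym -[_ && _]negbK negb_and ne.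
Qed.

Let val_at (q : 'I_8 -> 'rV[rat]_3) i j :
  (x i j).@[at_points q] = q (inord i) 0 j.
Proof. by rewrite mevalXU at_pointsE. Qed.

Let not_divides (u w : polyR) (q : 'I_8 -> 'rV[rat]_3) :
  u.@[at_points q] = 0 -> w.@[at_points q] != 0 -> ~ divides u w.
Proof. by move=> u0 w0 [h E]; rewrite E mevalM u0 mul0r eqxx in w0. Qed.

Let config (l : seq (seq rat)) (i : 'I_8) : 'rV[rat]_3 := \row_j (nth [::] l i)`_j.

(** The minor is linear in one unknown with an unknown as leading coefficient. That this coefficient
    does not divide the rest is seen at a rational configuration where it vanishes and the rest does
    not. *)
Let minor_prime : prime_poly minor.
Proof.
rewrite minorE; apply: (@linear_prime _ _ (mxvec_index (inord 0) 0) (x 1 1)).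
- by rewrite kill_x.
- by rewrite rmorphN rmorphM /= !kill_x.
- have : (x 1 1).@[at_points (config [:: [::]; [:: 0; 1; 0]])] != 0.
    by rewrite val_at !mxE inordK.
  by apply: contra_neq => ->; rewrite meval0.
apply: prime_regular; first exact: prime_var.
apply: (not_divides (q := config [:: [:: 0; 1; 0]; [:: 1; 0; 0]])).
  by rewrite val_at !mxE inordK.
by rewrite mevalN mevalM !val_at !mxE !inordK.
Qed.

Let bracket_hyps : [/\ kill rat (mxvec_index (inord 2) 2) minor = minor,
  kill rat (mxvec_index (inord 2) 2) tail = tail, minor != 0
  & forall h, divides minor (b * h) -> divides minor h].
Proof.
split.
- by rewrite /minor rmorphB !rmorphM /= !kill_x.
- by rewrite /tail rmorphB !rmorphM !rmorphB !rmorphM /= !kill_x.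
- have : minor.@[at_points (config [:: [:: 1; 0; 0]; [:: 0; 1; 0]])] != 0.
    by rewrite mevalB !mevalM !val_at !mxE !inordK.
  by apply: contra_neq => ->; rewrite meval0.
move=> h; rewrite bE; apply: prime_regular; first exact: minor_prime.
apply: (not_divides (q := config [:: [:: 1; 0; 0]; [:: 0; 0; 1]; [:: 0; 1; 0]])).
  by rewrite mevalB !mevalM !val_at !mxE !inordK.
by rewrite /tail mevalB !mevalM !mevalB !mevalM !val_at !mxE !inordK.
Qed.

(** Solving the bracket for its last unknown makes the three points collinear over the fraction
    field, where the numerator is 0; [at_root_eq0] converts this into divisibility. *)
Lemma bracket_divides_numerator j : divides b (numerator polypoint 0 j).
Proof.
have [k1 k2 m0 reg] := bracket_hyps.
rewrite bE in reg *; apply: (at_root_eq0 k1 k2 m0 reg).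
set f := at_root _ _ _; pose p i := map_mx f (polypoint i).
have fb : f b = 0 by rewrite bE; apply: at_rootE k1 k2 m0.
have : numerator p 0 j = 0.
  by rewrite numerator_collinear ?mxE // bracket_map.
by rewrite numerator_map mxE.
Qed.
End BracketDivides.

(** * Rescaling and permuting the points *)

Section Rescaling.
Variables (R : comNzRingType) (p : 'I_8 -> 'rV[R]_3) (l : 'I_8 -> R).
Let lp i := l i *: p i.

Lemma quadrics_row_scale a (Q : 'rV[R]_3) : quadrics_row (a *: Q) = a ^+ 2 *: quadrics_row Q.
Proof. by apply/rowP => -[]; do 6?[case => [?|]] => //=; rewrite !mxE /=; ring. Qed.

Lemma cubics_row_scale a (Q : 'rV[R]_3) : cubics_row (a *: Q) = a ^+ 3 *: cubics_row Q.
Proof. by apply/rowP => -[]; do 10?[case => [?|]] => //=; rewrite !mxE /=; ring. Qed.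

Lemma Cdet_scale a1 a2 a3 a4 a5 a6 (Q1 Q2 Q3 Q4 Q5 Q6 : 'rV[R]_3) :
  Cdet (a1 *: Q1) (a2 *: Q2) (a3 *: Q3) (a4 *: Q4) (a5 *: Q5) (a6 *: Q6) =
  (a1 * a2 * a3 * a4 * a5 * a6) ^+ 2 * Cdet Q1 Q2 Q3 Q4 Q5 Q6.
Proof.
pose s := [:: (quadrics_row Q1, a1 ^+ 2); (quadrics_row Q2, a2 ^+ 2);
  (quadrics_row Q3, a3 ^+ 2); (quadrics_row Q4, a4 ^+ 2); (quadrics_row Q5, a5 ^+ 2);
  (quadrics_row Q6, a6 ^+ 2)].
have -> : Cdet Q1 Q2 Q3 Q4 Q5 Q6 = rdet (unzip1 s) by [].
have -> : Cdet (a1 *: Q1) (a2 *: Q2) (a3 *: Q3) (a4 *: Q4) (a5 *: Q5) (a6 *: Q6) =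
  rdet [seq r.2 *: r.1 | r <- s] by rewrite /Cdet -/(rdet _) /= !quadrics_row_scale.
by rewrite rdet_scale // !big_cons big_nil /=; ring.
Qed.

Lemma Ddet_scale a1 a2 a3 a4 a5 a6 a7 a8 (Q1 Q2 Q3 Q4 Q5 Q6 Q7 Q8 : 'rV[R]_3) :
  Ddet (a1 *: Q1) (a2 *: Q2) (a3 *: Q3) (a4 *: Q4) (a5 *: Q5) (a6 *: Q6) (a7 *: Q7)
    (a8 *: Q8) =
  a1 ^+ 6 * (a2 * a3 * a4 * a5 * a6 * a7 * a8) ^+ 3 * Ddet Q1 Q2 Q3 Q4 Q5 Q6 Q7 Q8.
Proof.
pose s := [:: (cubics_row Q2, a2 ^+ 3); (cubics_row Q3, a3 ^+ 3);
  (cubics_row Q4, a4 ^+ 3); (cubics_row Q5, a5 ^+ 3); (cubics_row Q6, a6 ^+ 3);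
  (cubics_row Q7, a7 ^+ 3); (cubics_row Q8, a8 ^+ 3); (cubics_row_dx Q1, a1 ^+ 2);
  (cubics_row_dy Q1, a1 ^+ 2); (cubics_row_dz Q1, a1 ^+ 2)].
have -> : Ddet Q1 Q2 Q3 Q4 Q5 Q6 Q7 Q8 = rdet (unzip1 s) by [].
have -> : Ddet (a1 *: Q1) (a2 *: Q2) (a3 *: Q3) (a4 *: Q4) (a5 *: Q5) (a6 *: Q6)
    (a7 *: Q7) (a8 *: Q8) = rdet [seq r.2 *: r.1 | r <- s].
  rewrite /Ddet -/(rdet _) /= !cubics_row_scale !cubics_row_dxE !cubics_row_dyE.
  by rewrite !cubics_row_dzE !cubics_polar_scale.
by rewrite rdet_scale // !big_cons big_nil /=; ring.
Qed.

Lemma numerator_scale : numerator lp =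
  ((l (inord 0) * l (inord 1) * l (inord 2)) ^+ 9 *
   (l (inord 3) * l (inord 4) * l (inord 5) * l (inord 6) * l (inord 7)) ^+ 8)
  *: numerator p.
Proof.
rewrite /numerator /Cx /Cy /Cz /Dx /Dy /Dz !Cdet_scale !Ddet_scale !scalerDr !scalerA.
by do 2?[congr (_ + _)]; congr (_ *: _); ring.
Qed.

Lemma bracket_rescale : bracket (lp (inord 0)) (lp (inord 1)) (lp (inord 2)) =
  l (inord 0) * l (inord 1) * l (inord 2)
  * bracket (p (inord 0)) (p (inord 1)) (p (inord 2)).
Proof. by rewrite !bracketE !mxE; ring. Qed.
End Rescaling.

Lemma prod_ord8 (R : comNzRingType) (l : 'I_8 -> R) : \prod_i l i =
  l (inord 0) * l (inord 1) * l (inord 2) *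
   (l (inord 3) * l (inord 4) * l (inord 5) * l (inord 6) * l (inord 7)).
Proof.
have -> : \prod_i l i = \prod_(0 <= k < 8) l (inord k).
  by rewrite big_mkord; apply: eq_bigr => i _; rewrite inord_val.
rewrite /index_iota /=; by rewrite !big_cons big_nil; ring.
Qed.

(** Over a domain the lowest and the highest exponents of a product add up. They agree for p q,
    hence also for p. *)
Lemma poly_factor_monomial (A : idomainType) (p q : {poly A}) (c : A) n :
  c != 0 -> p * q = c *: 'X^n -> exists k, p = p`_k *: 'X^k.
Proof.
move=> c0 E; have pq0 : p * q != 0 by rewrite E -mul_polyC mulf_neq0 ?polyC_eq0 // monic_neq0 ?monicXn.
have [p0 q0] : p != 0 /\ q != 0 by apply/andP; rewrite -negb_or -mulf_eq0.
have low (r : {poly A}) : r != 0 -> exists2 k, r`_k != 0 & forall i, (i < k)%N -> r`_i = 0.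
  move=> r0; have ex : exists k, r`_k != 0.
    by exists (size r).-1; rewrite -lead_coefE lead_coef_eq0.
  exists (ex_minn ex); first by case: ex_minnP.
  move=> i; case: ex_minnP => m _ min lt; apply/eqP; apply: contraLR lt.
  by rewrite -leqNgt; apply: min.
have [k pk kmin] := low p p0; have [l ql lmin] := low q q0.
have klE : (p * q)`_(k + l) = p`_k * q`_l.
  have lt : (k < (k + l).+1)%N by rewrite ltnS leq_addr.
  rewrite coefM (bigD1 (Ordinal lt)) //= addKn big1 ?addr0 // => i ne.
  have {}ne : (i != k :> nat) by rewrite -(inj_eq val_inj) in ne.
  case: (ltnP i k) => ik; first by rewrite kmin // mul0r.
  by rewrite lmin ?mulr0 //; move: (ltn_ord i) ik ne; lia.
have kln : (k + l = n)%N.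
  apply/eqP; have : (p * q)`_(k + l) != 0 by rewrite klE mulf_neq0.
  by rewrite E coefZ coefXn; case: ((k + l)%N =P n) => //= _; rewrite mulr0 eqxx.
have szpq : (size p + size q = n.+2)%N.
  have := size_mul p0 q0; rewrite E size_scale // size_polyXn.
  have : (0 < size p)%N by rewrite size_poly_gt0.
  lia.
have kp : (k < size p)%N by apply: contraNltn pk => le; rewrite nth_default.
have lq : (l < size q)%N by apply: contraNltn ql => le; rewrite nth_default.
exists k; apply/polyP => i; rewrite coefZ coefXn; case: eqP => [->|/eqP ik].
  by rewrite mulr1.
rewrite /= mulr0; case: (ltnP i k) => lik; first exact: kmin.
rewrite nth_default //; have -> : size p = k.+1 by move: kln szpq kp lq; lia.
by rewrite ltn_neqAle eq_sym ik.
Qed.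

Lemma rdet_exchange (R : comNzRingType) n (s1 s2 s3 : seq 'rV[R]_n) a b :
  (size s1 + size s2 + size s3).+2 = n ->
  rdet (s1 ++ a :: s2 ++ b :: s3) = - rdet (s1 ++ b :: s2 ++ a :: s3).
Proof.
move=> szs; rewrite rdet_move /=; last by move: szs; lia.
rewrite rdet_move /=; last by move: szs; lia.
rewrite !catA rdet_swap ?mulrN //.
by rewrite size_cat; move: szs; lia.
Qed.

(** * Symmetry under permutations of the points *)

Section Antisymmetry.
Variables (R : comNzRingType) (p : 'I_8 -> 'rV[R]_3).
Implicit Type Q : 'rV[R]_3.

Lemma Cdet_exchange (s1 s2 s3 : seq 'rV[R]_3) (Q Q' : 'rV[R]_3) :
  (size s1 + size s2 + size s3).+2 = 6%N ->
  rdet [seq quadrics_row P | P <- s1 ++ Q :: s2 ++ Q' :: s3] =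
  - rdet [seq quadrics_row P | P <- s1 ++ Q' :: s2 ++ Q :: s3].
Proof. by move=> szs; rewrite !(map_cat, map_cons) rdet_exchange // !size_map. Qed.

Lemma Ddet_exchange (t : seq 'rV[R]_10) (s1 s2 s3 : seq 'rV[R]_3) (Q Q' : 'rV[R]_3) :
  (size s1 + size s2 + size s3).+2 = 7%N -> size t = 3%N ->
  rdet ([seq cubics_row P | P <- s1 ++ Q :: s2 ++ Q' :: s3] ++ t) =
  - rdet ([seq cubics_row P | P <- s1 ++ Q' :: s2 ++ Q :: s3] ++ t).
Proof.
move=> szs szt; rewrite !(map_cat, map_cons) -!catA /= -!catA rdet_exchange //.
by rewrite !size_map size_cat size_map szt; move: szs; lia.
Qed.

Lemma numerator_bracket :
  bracket (numerator p) (p (inord 1)) (p (inord 2)) = Cx p * Dy p * Dz p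
    * bracket (p (inord 0)) (p (inord 1)) (p (inord 2)).
Proof. by rewrite /numerator !bracketE !mxE; ring. Qed.

Let star k i := p (tperm (inord 0) (inord k) i).

Let star0 k : star k (inord 0) = p (inord k).
Proof. by rewrite /star tpermL. Qed.
Let stark k : star k (inord k) = p (inord 0).
Proof. by rewrite /star tpermR. Qed.
Let starD k j : (0 < j < 8)%N -> (k < 8)%N -> j != k -> star k (inord j) = p (inord j).
Proof.
move=> /andP[j0 j8] k8 jk; rewrite /star tpermD //.
  by rewrite -(inj_eq val_inj) /= !inordK // eq_sym -lt0n.
by rewrite -(inj_eq val_inj) /= !inordK // eq_sym.
Qed.

(** The exchange permutes the C's and, up to a sign each, the D's. Every coefficient contains two
    D's, so the sign of V comes from the bracket alone. *)
Lemma numerator_swap1 : numerator (star 1) = numerator p.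
Proof.
have E2 : star 1 (inord 2) = p (inord 2) by apply: starD.
have E3 : star 1 (inord 3) = p (inord 3) by apply: starD.
have E4 : star 1 (inord 4) = p (inord 4) by apply: starD.
have E5 : star 1 (inord 5) = p (inord 5) by apply: starD.
have E6 : star 1 (inord 6) = p (inord 6) by apply: starD.
have E7 : star 1 (inord 7) = p (inord 7) by apply: starD.
rewrite /numerator /Cx /Cy /Cz /Dx /Dy /Dz star0 stark E2 E3 E4 E5 E6 E7.
set P0 := p (inord 0); set P1 := p (inord 1); set P2 := p (inord 2).
set P3 := p (inord 3); set P4 := p (inord 4); set P5 := p (inord 5).
set P6 := p (inord 6); set P7 := p (inord 7).
have sw Q Q1 Q2 : Ddet Q Q1 Q2 P3 P4 P5 P6 P7 = - Ddet Q Q2 Q1 P3 P4 P5 P6 P7.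
  exact: (@Ddet_exchange _ [::] [::] [:: P3; P4; P5; P6; P7] Q1 Q2).
rewrite (sw P1 P0 P2) (sw P0 P2 P1) (sw P2 P1 P0) !(mulrN, mulNr) opprK.
by apply/rowP => j; rewrite !mxE; ring.
Qed.

Lemma numerator_swap2 : numerator (star 2) = numerator p.
Proof.
have E1 : star 2 (inord 1) = p (inord 1) by apply: starD.
have E3 : star 2 (inord 3) = p (inord 3) by apply: starD.
have E4 : star 2 (inord 4) = p (inord 4) by apply: starD.
have E5 : star 2 (inord 5) = p (inord 5) by apply: starD.
have E6 : star 2 (inord 6) = p (inord 6) by apply: starD.
have E7 : star 2 (inord 7) = p (inord 7) by apply: starD.
rewrite /numerator /Cx /Cy /Cz /Dx /Dy /Dz star0 stark E1 E3 E4 E5 E6 E7.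
set P0 := p (inord 0); set P1 := p (inord 1); set P2 := p (inord 2).
set P3 := p (inord 3); set P4 := p (inord 4); set P5 := p (inord 5).
set P6 := p (inord 6); set P7 := p (inord 7).
have sw Q Q1 Q2 : Ddet Q Q1 Q2 P3 P4 P5 P6 P7 = - Ddet Q Q2 Q1 P3 P4 P5 P6 P7.
  exact: (@Ddet_exchange _ [::] [::] [:: P3; P4; P5; P6; P7] Q1 Q2).
rewrite (sw P2 P1 P0) (sw P1 P0 P2) (sw P0 P2 P1) !(mulrN, mulNr) !opprK.
by apply/rowP => j; rewrite !mxE; ring.
Qed.

(** In these three determinants both exchanged points enter through evaluation rows, so two rows are
    swapped. *)
Lemma star_antisymmetric k : (3 <= k < 8)%N ->
  [/\ Cx (star k) = - Cx p, Dy (star k) = - Dy p & Dz (star k) = - Dz p].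
Proof.
move=> /andP[k3 k8]; have E1 : star k (inord 1) = p (inord 1).
  by apply: starD => //; rewrite neq_ltn (leq_trans _ k3).
have E2 : star k (inord 2) = p (inord 2).
  by apply: starD => //; rewrite neq_ltn (leq_trans _ k3).
rewrite /Cx /Dy /Dz star0 E1 E2 /Cdet /Ddet -!/(rdet _).
set t1 := [:: cubics_row_dx (p (inord 1)); _; _].
set t2 := [:: cubics_row_dx (p (inord 2)); _; _].
pose Q0 := p (inord 0); pose Q1 := p (inord 1); pose Q2 := p (inord 2).
pose l i j := [seq p (inord m) | m <- iota i (j - i)].
have E j : (3 <= j < 8)%N -> j != k -> star k (inord j) = p (inord j).
  by case/andP=> j3 j8 jk; apply: starD => //; rewrite j8 (leq_trans _ j3).
suff : [:: star k (inord 3); star k (inord 4); star k (inord 5); star k (inord 6);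
    star k (inord 7)] = l 3%N k ++ Q0 :: l k.+1 8%N /\
    [:: p (inord 3); p (inord 4); p (inord 5); p (inord 6); p (inord 7)] =
    l 3%N k ++ p (inord k) :: l k.+1 8%N.
  move=> [El Er]; rewrite El Er.
  have szl : (size (l 3%N k) + size (l k.+1 8%N) = 4)%N.
    by rewrite !size_map !size_iota; lia.
  split.
  - by rewrite (@Cdet_exchange [::] (l 3%N k) (l k.+1 8%N)) //= szl.
  - by rewrite (@Ddet_exchange t1 [:: Q2] (l 3%N k) (l k.+1 8%N)) //=; lia.
  - by rewrite (@Ddet_exchange t2 [::] (Q1 :: l 3%N k) (l k.+1 8%N)) //=; lia.
rewrite /l; have [ek|[ek|[ek|[ek|ek]]]] :
    k = 3%N \/ k = 4%N \/ k = 5%N \/ k = 6%N \/ k = 7%N by lia.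
all: by rewrite ek in E *; rewrite stark !E.
Qed.

End Antisymmetry.

Section Pencil.
Variables (K : fieldType) (p : 'I_8 -> 'rV[K]_3).

(** Eight linear conditions on ten coefficients leave at least two dimensions. *)
Lemma pencil_exists : exists F G : 'cV[K]_10, row_full (row_mx F G) /\
  forall i, evalc F (p i) = 0 /\ evalc G (p i) = 0.
Proof.
pose A : 'M[K]_(8, 10) := \matrix_i cubics_row (p i).
pose Z := kermx A^T; have rZ : (2 <= \rank Z)%N.
  rewrite mxrank_ker mxrank_tr; have := rank_leq_row A; lia.
pose X : 'M[K]_(2, 10) := pid_mx 2 *m row_base Z.
have rX : row_free X.
  by rewrite /row_free mxrankMfree ?row_base_free // rank_pid_mx.
have XA : A *m X^T = 0.
  apply: trmx_inj; rewrite trmx_mul trmxK trmx0.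
  apply/sub_kermxP; rewrite (submx_trans (submxMl _ _)) // eq_row_base.
  exact: submx_refl.
have XE : X^T = row_mx (lsubmx (X^T : 'M_(10, 1 + 1))) (rsubmx (X^T : 'M_(10, 1 + 1))).
  by rewrite hsubmxK.
exists (lsubmx (X^T : 'M_(10, 1 + 1))), (rsubmx (X^T : 'M_(10, 1 + 1))).
rewrite -XE /row_full mxrank_tr; split; first exact: rX.
move=> i; have : row i A *m X^T = 0 by rewrite -row_mul XA row0.
rewrite rowK => H; rewrite /evalc mulmx_lsub mulmx_rsub.
by rewrite [in LHS]mxE [X in _ /\ X = _]mxE H !mxE.
Qed.

(** The permuted numerator is a base point of the same pencil and differs from the eight points, so
    it is the ninth. *)
Lemma numerator_proportional (s : 'S_8) : generic_config p ->
  generic_config (fun i => p (s i)) ->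
  exists c, numerator (fun i => p (s i)) = c *: numerator p.
Proof.
move=> gp gs; have [F [G [full FG]]] := pencil_exists.
have Fp i := proj1 (FG i); have Gp i := proj2 (FG i).
have [[Fs Gs] _] := generic_pencil gs full (fun i => Fp (s i)) (fun i => Gp (s i)).
have [_ [base _]] := generic_pencil gp full Fp Gp.
have [R [c [[[i Ri]|RN] E]]] := base _ (numerator_neq0 gs) Fs Gs; last first.
  by exists c; rewrite E RN.
have [S] := numerator_distinct gs ((s^-1)%g i); rewrite permKV => /eqP[].
by apply: bracket_proportional (_ : _ = c *: p i); rewrite E Ri.
Qed.

(** For k >= 3 the factor c is found from [numerator_bracket]: the product Cx Dy Dz only changes
    sign, so c [123] = - [k23] with the zero-based point k in place of P1. Division by the two
    brackets gives the factor -1. *)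
Lemma ninth_formula_star k : (0 < k < 8)%N -> let s := tperm (inord 0) (inord k) in
  generic_config p -> generic_config (fun i => p (s i)) ->
  ninth_formula (fun i => p (s i)) = - ninth_formula p.
Proof.
move=> /andP[k0 k8] s gp gs; rewrite !ninth_formulaE.
have s0 : p (s (inord 0)) = p (inord k) by rewrite tpermL.
have sk : p (s (inord k)) = p (inord 0) by rewrite tpermR.
have sD j : (0 < j < 8)%N -> j != k -> p (s (inord j)) = p (inord j).
  move=> /andP[j0 j8] jk; rewrite tpermD // -(inj_eq val_inj) /= !inordK //.
    by rewrite eq_sym -lt0n.
  by rewrite eq_sym.
have [e1|k1] := eqVneq k 1%N.
  subst k; rewrite s0 sk (sD 2%N) // bracket_swap invrN scaleNr.
  by rewrite (numerator_swap1 p).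
have [e2|k2] := eqVneq k 2%N.
  subst k; rewrite s0 sk (sD 1%N) // bracket_rot bracket_swap invrN scaleNr.
  by rewrite (numerator_swap2 p).
have k3 : (3 <= k < 8)%N.
  by rewrite k8 andbT; clear -k0 k1 k2; case: k k0 k1 k2 => [|[|[|]]].
have [c cE] := numerator_proportional gp gs.
have [aC aDy aDz] := star_antisymmetric p k3.
have s1 : p (s (inord 1)) = p (inord 1) by rewrite sD // eq_sym.
have s2 : p (s (inord 2)) = p (inord 2) by rewrite sD // eq_sym.
have := numerator_bracket (fun i => p (s i)).
rewrite aC aDy aDz cE bracket_scale s0 s1 s2 numerator_bracket => E.
have [Cx0 _ _] := gen_C gp; have [_ Dy0 Dz0] := gen_D gp.
have b0 := gen_bracket gp; have bk := gen_bracket gs; rewrite s0 s1 s2 in bk.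
have {E} cb : c * bracket (p (inord 0)) (p (inord 1)) (p (inord 2)) =
    - bracket (p (inord k)) (p (inord 1)) (p (inord 2)).
  by apply: (mulfI (mulf_neq0 (mulf_neq0 Cx0 Dy0) Dz0)); rewrite mulrCA E; ring.
rewrite scalerA -scaleNr; congr (_ *: _); apply: (mulfI bk); apply: (mulIf b0).
rewrite mulVKf // cb mulrN mulNr divfK //.
Qed.
End Pencil.

Lemma eq_ninth_formula (K : fieldType) (q r : 'I_8 -> 'rV[K]_3) : q =1 r ->
  ninth_formula q = ninth_formula r.
Proof. by move=> E; rewrite !ninth_formulaE !E (eq_numerator E). Qed.

Section SymmetricGroup.
Variables (K : fieldType) (p : 'I_8 -> 'rV[K]_3).
Hypothesis gp : forall s : 'S_8, generic_config (fun i => p (s i)).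
Let V (s : 'S_8) := ninth_formula (fun i => p (s i)).

(** The quantification over r makes the property multiplicative in s, so that transpositions with
    the first point suffice. *)
Let good (s : 'S_8) := forall r, V (s * r)%g = V r \/ V (s * r)%g = - V r.

Let good_star (i : 'I_8) : good (tperm (inord 0) i).
Proof.
move=> r; have [-> |i0] := eqVneq i (inord 0).
  by left; rewrite tperm1 mul1g.
right; pose q j := p (r j).
have -> : V (tperm (inord 0) i * r)%g = ninth_formula (fun j => q (tperm (inord 0) i j)).
  by apply: eq_ninth_formula => j; rewrite permM.
have gq : generic_config (fun j => q (tperm (inord 0) i j)).
  by apply: eq_generic_config (gp (tperm (inord 0) i * r)%g) => j; rewrite permM.
have lti : (0 < i < 8)%N.
  rewrite ltn_ord andbT lt0n; apply: contraNneq i0 => i0.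
  by apply/eqP/val_inj; rewrite /= inordK.
have := @ninth_formula_star K q i lti; rewrite inord_val /=; apply=> //.
exact: gp.
Qed.

Let goodM s t : good s -> good t -> good (s * t)%g.
Proof.
move=> gs gt r; rewrite -mulgA.
by case: (gs (t * r)%g) => ->; case: (gt r) => ->; rewrite ?opprK; [left | right | right | left].
Qed.

Lemma ninth_formula_perm s : V s = V 1%g \/ V s = - V 1%g.
Proof.
suff /(_ 1%g) : good s by rewrite mulg1.
have [ts -> _] := prod_tpermP s.
apply: (big_ind good) => [r|? ?|[i j] _] /=; first by left; rewrite mul1g.
  exact: goodM.
have [->|ij] := eqVneq i j; first by move=> r; left; rewrite tperm1 mul1g.
have [->|i0] := eqVneq i (inord 0); first exact: good_star.
have [->|j0] := eqVneq j (inord 0); first by rewrite tpermC; apply: good_star.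
have -> : tperm i j = (tperm (inord 0) i * (tperm (inord 0) j * tperm (inord 0) i))%g.
  have -> : tperm i j = (tperm (inord 0) j ^ tperm (inord 0) i)%g.
    by rewrite tpermJ tpermL tpermD // eq_sym.
  by rewrite conjgE tpermV.
by apply: goodM; [|apply: goodM]; apply: good_star.
Qed.
End SymmetricGroup.

(** * Homogeneity and common divisors *)

Section Substitution.
Variables (S : comNzRingType) (g : {rmorphism rat -> S}).
Implicit Type q : 'I_8 -> 'rV[S]_3.

Definition subst_points q : {rmorphism polyR -> S} := mmap g (at_points q).

Lemma subst_pointsC q c : subst_points q c%:MP = g c.
Proof. exact: mmapC. Qed.

Lemma subst_pointsX q i j : subst_points q 'X_(mxvec_index i j) = q i 0 j.
Proof. by rewrite [LHS]mmapXU at_pointsE. Qed.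

Lemma subst_polypoint q i : map_mx (subst_points q) (polypoint i) = q i.
Proof. by apply/rowP => j; rewrite !mxE subst_pointsX. Qed.
End Substitution.

Lemma polyR_morph_eq (S : comNzRingType) (f h : {rmorphism polyR -> S}) :
  (forall c, f c%:MP = h c%:MP) ->
  (forall i j, f 'X_(mxvec_index i j) = h 'X_(mxvec_index i j)) -> f =1 h.
Proof.
move=> fhC fhX; apply: mpoly_morph_eq => // k.
by case/mxvec_indexP: k => i j; apply: fhX.
Qed.

Definition poly_bracket : polyR :=
  bracket (polypoint (inord 0)) (polypoint (inord 1)) (polypoint (inord 2)).

Lemma ninth_polynomial : exists W : 'rV[polyR]_3, numerator polypoint = poly_bracket *: W.
Proof.
have [w0 E0] := bracket_divides_numerator 0; have [w1 E1] := bracket_divides_numerator 1.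
have [w2 E2] := bracket_divides_numerator 2; exists (row3 w0 w1 w2).
apply/rowP; apply: ord3P.
- by rewrite E0 [RHS]mxE [row3 _ _ _ _ _]mxE.
- by rewrite E1 [RHS]mxE [row3 _ _ _ _ _]mxE.
- by rewrite E2 [RHS]mxE [row3 _ _ _ _ _]mxE.
Qed.

Section Grading.

Definition weight (i : 'I_8) (m : 'X_{1..8 * 3}) : nat := \sum_(j < 3) m (mxvec_index i j).

(** Multiplies the i-th point by a new variable, so that the degree in that point becomes an
    exponent of ['X]. *)
Definition rescale (i : 'I_8) : {rmorphism polyR -> {poly polyR}} :=
  subst_points (polyC \o @mpolyC _ rat)
    (fun k => (if k == i then 'X else 1) *: map_mx polyC (polypoint k)).

Definition homog_at (i : 'I_8) (e : nat) (d : polyR) := rescale i d = d *: 'X^e.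

Lemma rescaleX i k j : rescale i 'X_(mxvec_index k j) =
  (if k == i then 'X else 1) * ('X_(mxvec_index k j))%:P.
Proof. by rewrite /rescale subst_pointsX !mxE. Qed.

Lemma rescale_monomial i m : rescale i 'X_[m] = 'X_[m] *: 'X^(weight i m).
Proof.
pose c k := (\sum_(j < 3) (k == mxvec_index i j))%N.
have rX k : rescale i 'X_k = ('X_k)%:P * 'X^(c k).
  case/mxvec_indexP: k => k j; rewrite rescaleX mulrC /c.
  have [->|ki] := eqVneq k i.
    rewrite (bigD1 j) //= eqxx big1 ?addn0 ?expr1 // => l lj.
    by rewrite mxvec_index_eq eqxx /= eq_sym (negbTE lj).
  by rewrite big1 ?expr0 // => l _; rewrite mxvec_index_eq (negbTE ki).
rewrite -mul_polyC {1}[X in rescale i X]mpolyXE_id rmorph_prod /=.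
under eq_bigr => k _ do rewrite rmorphXn rX exprMn -exprM.
rewrite big_split /=; congr (_ * _).
  by rewrite mpolyXE_id rmorph_prod; apply: eq_bigr => k _; rewrite rmorphXn.
rewrite prodrXr; congr ('X^_); rewrite /c /weight.
under eq_bigr => k _ do rewrite big_distrl /=.
rewrite exchange_big /=; apply: eq_bigr => j _.
rewrite (bigD1 (mxvec_index i j)) //= eqxx mul1n big1 ?addn0 // => k /negbTE ->.
by rewrite mul0n.
Qed.
End Grading.

Lemma map_rescale i k : map_mx (rescale i) (polypoint k) =
  (if k == i then 'X else 1) *: map_mx polyC (polypoint k).
Proof. exact: subst_polypoint. Qed.

Lemma rescaleC i c : rescale i c%:MP = (c%:MP)%:P.
Proof. exact: subst_pointsC. Qed.

Lemma mcoeff_rescale i d k m : (rescale i d)`_k@_m = d@_m *+ (k == weight i m).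
Proof.
rewrite {1}(mpolyE d) rmorph_sum coef_sum raddf_sum /=.
rewrite [in RHS](mpolyE d) raddf_sum /= -sumrMnl.
apply: eq_bigr => n _; rewrite -mul_mpolyC rmorphM rescaleC rescale_monomial.
rewrite coefCM coefZ coefXn !mcoeffCM mulr_natr mcoeffMn mcoeffX -mulrnAr.
by have [->//|_] := eqVneq n m; rewrite !mul0rn.
Qed.

Lemma homog_at_weight i e d m : homog_at i e d -> m \in msupp d -> weight i m = e.
Proof.
move=> hd; rewrite mcoeff_msupp; apply: contraNeq => /negbTE ne.
have := mcoeff_rescale i d (weight i m) m.
by rewrite hd coefZ coefXn ne mulr0 mcoeff0 eqxx mulr1n => <-.
Qed.

Lemma homog_at0_constant d : (forall i, homog_at i 0 d) -> d = (d@_0)%:MP.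
Proof.
move=> hd; apply/mpolyP => m; rewrite mcoeffC.
have [<-|m0] := eqVneq 0%MM m; first by rewrite mulr1.
rewrite mulr0; apply/eqP; apply: contra_neqT m0; rewrite -mcoeff_msupp => md.
apply/mnmP => k; rewrite mnm0E; case/mxvec_indexP: k => i j; apply/eqP.
have /eqP := homog_at_weight (hd i) md; rewrite /weight sum_nat_eq0.
by move/forallP/(_ j); rewrite eq_sym.
Qed.

Lemma rescale1 i d : (rescale i d).[1] = d.
Proof.
pose f : {rmorphism polyR -> polyR} := horner_eval (1 : polyR) \o rescale i.
suff /(_ d) : f =1 (idfun : {rmorphism polyR -> polyR}) by [].
apply: polyR_morph_eq => [c|k j]; first by rewrite /= rescaleC /horner_eval hornerC.
rewrite /= rescaleX /horner_eval hornerM hornerC.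
by case: eqP => _; rewrite ?hornerX ?hornerC mul1r.
Qed.

(** The rescaled divisor divides a monomial in ['X], hence is one; at ['X] = 1 its coefficient is
    seen to be d. *)
Lemma homog_at_divisor i e c d : homog_at i e c -> c != 0 -> divides d c ->
  exists k, homog_at i k d.
Proof.
move=> hc c0 [q E]; have : rescale i d * rescale i q = c *: 'X^e.
  by rewrite -rmorphM -E.
case/(poly_factor_monomial c0) => k Ek; exists k.
suff E1 : (rescale i d)`_k = d by rewrite /homog_at Ek E1.
by have := rescale1 i d; rewrite {1}Ek hornerZ hornerXn expr1n mulr1.
Qed.

(** The numerator has degree 9 in P1, P2, P3 and 8 in the other points; the bracket accounts for the
    excess. *)
Lemma homog_at_ninth i j W : numerator polypoint = poly_bracket *: W ->
  homog_at i 8 (W 0 j).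
Proof.
move=> E; pose l k : {poly polyR} := if k == i then 'X else 1.
have EW : map_mx (rescale i) (numerator polypoint) = (\prod_k l k) ^+ 8 *
  (l (inord 0) * l (inord 1) * l (inord 2)) *: map_mx polyC (numerator polypoint).
  rewrite -!numerator_map (eq_numerator (map_rescale i)) numerator_scale.
  rewrite prod_ord8 -![if _ == i then 'X else 1]/(l _).
  by move: (l) => l'; congr (_ *: _); ring.
have EB : rescale i poly_bracket =
    l (inord 0) * l (inord 1) * l (inord 2) * poly_bracket%:P.
  rewrite /poly_bracket -!bracket_map !map_rescale.
  exact: (bracket_rescale (fun k => map_mx polyC (polypoint k)) l).
have l0 k : l k != 0 by rewrite /l; case: ifP => _; rewrite ?polyX_eq0 ?oner_eq0.
have prodl : \prod_k l k = 'X.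
  by rewrite (bigD1 i) //= /l eqxx big1 ?mulr1 // => k /negbTE ->.
have B0 : poly_bracket != 0.
  by have := gen_bracket (polypoint_generic 1%g); rewrite !perm1.
move: EW; rewrite E !map_mxZ EB scalerA prodl => /rowP /(_ j).
rewrite [LHS]mxE [RHS]mxE [map_mx _ W _ _]mxE [map_mx polyC W _ _]mxE.
set u := l (inord 0) * _ * _ => EW.
have uB0 : u * poly_bracket%:P != 0 by rewrite !mulf_neq0 ?polyC_eq0.
rewrite /homog_at -mul_polyC; apply: (mulfI uB0); rewrite EW; ring.
Qed.

Section MapPoints.
Variables (S T : comNzRingType) (g : {rmorphism rat -> S}) (f : {rmorphism S -> T}).
Variable h : {rmorphism rat -> T}.

Lemma subst_points_comp (q : 'I_8 -> 'rV[S]_3) (r : 'I_8 -> 'rV[T]_3) d :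
  (forall c, f (g c) = h c) -> (forall i, map_mx f (q i) = r i) ->
  f (subst_points g q d) = subst_points h r d.
Proof.
move=> fg fq; apply: (@polyR_morph_eq T (f \o subst_points g q)) => [c|i j].
  by rewrite /= !subst_pointsC.
by rewrite /= !subst_pointsX -fq mxE.
Qed.
End MapPoints.

(** * Degree of a divisor along a line *)

Section LineDegree.
Variables (L : numClosedFieldType) (i : 'I_8) (q : 'I_8 -> 'rV[L]_3).
Implicit Types (a b : 'rV[L]_3) (t : L).

Definition replace_point (S : comNzRingType) (q : 'I_8 -> 'rV[S]_3) x :=
  fun k => if k == i then x else q k.

Let ev d x := subst_points (@ratr L) (replace_point q x) d.

Lemma homog_at_eval k d t (x : 'rV[L]_3) : homog_at i k d -> ev d (t *: x) = t ^+ k * ev d x.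
Proof.
move=> hd; pose h : {rmorphism polyR -> L} := subst_points (@ratr L) (replace_point q x).
pose f : {rmorphism polyR -> L} := horner_eval t \o (map_poly h \o rescale i).
have -> : ev d (t *: x) = f d.
  rewrite /ev; apply: polyR_morph_eq => [c|l j].
    rewrite subst_pointsC /f /= rescaleC map_polyC /horner_eval hornerC.
    by apply/esym; apply: subst_pointsC.
  rewrite subst_pointsX /f /= rescaleX rmorphM /= map_polyC /horner_eval hornerM hornerC.
  rewrite [X in _ = _ * X](subst_pointsX _ _ l j) /replace_point.
  case: (l == i); rewrite ?mxE; first by rewrite map_polyX hornerX.
  by rewrite rmorph1 hornerC mul1r.
by rewrite /f /= hd map_polyZ /horner_eval hornerZ map_polyXn hornerXn mulrC.
Qed.

Lemma nowhere_zero_horner (p : {poly L}) : (forall t, p.[t] != 0) -> forall t, p.[t] = p.[0].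
Proof.
move=> nz t; have [/size_poly1P[c _ ->]|] := boolP (size p == 1%N); first by rewrite !hornerC.
by case/closed_rootP => x /rootP e; have := nz x; rewrite e eqxx.
Qed.

Definition line_poly (d : polyR) a b : {poly L} :=
  subst_points (polyC \o @ratr L)
    (replace_point (fun k => map_mx polyC (q k)) (map_mx polyC a + 'X *: map_mx polyC b)) d.

Lemma line_polyE d a b t : (line_poly d a b).[t] = ev d (a + t *: b).
Proof.
apply: (subst_points_comp (f := horner_eval t)) => [c|k]; first exact: hornerC.
have eC (v : 'rV[L]_3) : map_mx (horner_eval t) (map_mx polyC v) = v.
  by apply/rowP => j; rewrite !mxE /horner_eval hornerC.
rewrite /replace_point; case: (k == i) => //.
by rewrite map_mxD map_mxZ !eC; congr (_ + _ *: _); apply: hornerX.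
Qed.

(* The polynomials d(a + t b) in t and d(s a + b) in s have no root, hence are *)
(* constants; comparing them at s = 1 / t gives s ^+ k = 1 for all s.          *)
Lemma homog_at_line k d a b : homog_at i k d -> ev d b != 0 ->
  (forall t, ev d (a + t *: b) != 0) -> k = 0%N.
Proof.
move=> hd b0 ab0; pose A := line_poly d a b; pose B := line_poly d b a.
have AE t : A.[t] = A.[0] by apply: nowhere_zero_horner => u; rewrite line_polyE.
have BA t : t != 0 -> B.[t] = t ^+ k * A.[0].
  move=> t0; rewrite -(AE t^-1) !line_polyE -homog_at_eval //.
  by rewrite scalerDr scalerA mulfV // scale1r addrC.
have A0 : A.[0] != 0 by rewrite line_polyE.
have BE t : B.[t] = B.[0].
  apply: nowhere_zero_horner => u; have [->|u0] := eqVneq u 0.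
    by rewrite line_polyE scale0r addr0.
  by rewrite BA // mulf_neq0 // expf_neq0.
have := BE 2; rewrite -(BE 1) !BA ?oner_eq0 ?Num.Theory.pnatr_eq0 // expr1n.
move/(mulIf A0)/eqP; rewrite -natrX Num.Theory.pnatr_eq1 -[1%N](expn0 2) eqn_exp2l //.
by move/eqP.
Qed.
End LineDegree.

Section SampleLine.

(* The fourth point moves on the line (0, -2, -1) + t (1, 1, 1), found by a    *)
(* search such that no two of Cx, ..., Dz whose vanishing matters vanish        *)
(* simultaneously on it, as the certificates below show.                       *)
Definition sample_line := set_nth [::] sample_config 3 [:: [:: 0; 1]; [:: -2; 1]; [:: -1; 1]]%bZ.

(** A Bezout identity with nonzero constant value, which excludes common roots; the computed list
    may carry trailing zeros. *)
Definition bezout_cert (u v a b : seq Z) :=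
  let r := zadd (zmul u a) (zmul v b) in znz r && all (Z.eqb 0) (behead r).

Lemma bezout_cert_neq0 (R : numDomainType) (t : R) u v a b : bezout_cert u v a b ->
  zeval t a = 0 -> zeval t b = 0 -> False.
Proof.
rewrite /bezout_cert => /andP[r0 rs] a0 b0.
have all0 s : all (Z.eqb 0) s -> zeval t s = 0.
  by elim: s => [|[|y|y] s IH] //= /IH ->; rewrite mulr0 addr0.
have : zeval t (zadd (zmul u a) (zmul v b)) = 0.
  by rewrite zevalD !zevalM a0 b0 !mulr0 addr0.
move: r0 rs; case: (zadd _ _) => [//|x s] x0 /all0 /= ->.
have := znz_neq0 R (a := [:: x]) x0; rewrite /= !mulr0 addr0 => /eqP nx /nx.
exact.
Qed.

Lemma sample_line_certs : let c := sample_line in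
  [/\ bezout_cert [:: -2340; 4050; -324] [:: 311; -6] (zC c 0) (zD c 0 1 2),
      bezout_cert [:: 646164; 154710; -273492] [:: 46203; 33086] (zC c 1) (zD c 1 2 0),
      bezout_cert [:: 193941; 320625; -89838] [:: 24753; 8680] (zC c 2) (zD c 2 0 1),
      bezout_cert [:: 103501; 92734] [:: -371358; 7164] (zC c 0) (zC c 1)
    & [&& bezout_cert [:: 126294; 70295; -68266] [:: 316764; -437094; 34452] (zD c 0 1 2) (zD c 1 2 0),
        bezout_cert [:: 16203; 20867; -6026] [:: -43659; 87957; -7074] (zD c 0 1 2) (zD c 2 0 1)
      & bezout_cert [:: 24058; 61844; -16560] [:: 54499; 40378; -38520] (zD c 1 2 0) (zD c 2 0 1)]]%bZ.
Proof. by split; vm_compute. Qed.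

Variable L : numClosedFieldType.

Lemma numerator_unit_points (R : comNzRingType) (p : 'I_8 -> 'rV[R]_3) :
  p (inord 0) = row3 1 0 0 -> p (inord 1) = row3 0 1 0 -> p (inord 2) = row3 0 0 1 ->
  numerator p = row3 (Cx p * Dy p * Dz p) (Dx p * Cy p * Dz p) (Dx p * Dy p * Cz p).
Proof.
move=> p0 p1 p2; rewrite /numerator p0 p1 p2.
move: (Cx p) (Cy p) (Cz p) (Dx p) (Dy p) (Dz p) => c0 c1 c2 d0 d1 d2.
by apply/rowP; apply: ord3P; rewrite !mxE /=; ring.
Qed.

(** If one of u, v, w is 0, the coordinate without it is a product of nonzero factors. If none is,
    vanishing would give x = y = 0. *)
Lemma row3_coprime_neq0 (x y z u v w : L) :
  (x = 0 -> u = 0 -> False) -> (y = 0 -> v = 0 -> False) -> (z = 0 -> w = 0 -> False) ->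
  (x = 0 -> y = 0 -> False) -> (u = 0 -> v = 0 -> False) -> (u = 0 -> w = 0 -> False) ->
  (v = 0 -> w = 0 -> False) -> row3 (x * v * w) (u * y * w) (u * v * z) != 0.
Proof.
move=> xu yv zw xy uv uw vw; apply/eqP => /rowP e.
move: (e 0) (e 1) (e (2 : 'I_3)); rewrite !mxE /= => /eqP e0 /eqP e1 /eqP e2.
move: e0 e1 e2; rewrite !mulf_eq0.
have [u0|u0] := eqVneq u 0.
  by case/orP => [/orP[]|] /eqP; [move/xu/(_ u0) | move/(uv u0) | move/(uw u0)].
have [v0|v0] := eqVneq v 0.
  by move=> _ /orP[/orP[]|] /eqP; [move/eqP: u0 | move/yv/(_ v0) | move/(vw v0)].
have [w0|w0] := eqVneq w 0.
  by move=> _ _ /orP[/orP[]|] /eqP; [move/eqP: u0 | move/eqP: v0 | move/zw/(_ w0)].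
by rewrite !orbF /= => /eqP x0 /eqP y0; case: (xy x0 y0).
Qed.

Lemma sample_line_numerator (t : L) : numerator (zconfig t sample_line) != 0.
Proof.
have [cx cy cz cc /and3P[dxy dxz dyz]] := sample_line_certs.
have e1 : zeval t [:: 1%bZ] = 1 by rewrite /= mulr0 addr0.
have unit a b c : zrow t 3 [:: a; b; c] = row3 (zeval t a) (zeval t b) (zeval t c).
  by apply/rowP; apply: ord3P; rewrite !mxE.
have unit0 : zeval t [::] = 0 by [].
have pt k a b c : (k < 8)%N -> nth [::] sample_line k = [:: a; b; c] ->
    zconfig t sample_line (inord k) = row3 (zeval t a) (zeval t b) (zeval t c).
  by move=> ltk E; rewrite /zconfig (inordK ltk) E unit.
have p0 := pt 0%N _ _ _ isT erefl.
have p1 := pt 1%N _ _ _ isT erefl.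
have p2 := pt 2%N _ _ _ isT erefl.
rewrite !e1 !unit0 in p0 p1 p2.
rewrite (numerator_unit_points p0 p1 p2).
rewrite !CD_zconfig; apply: row3_coprime_neq0.
- exact: bezout_cert_neq0 cx.
- exact: bezout_cert_neq0 cy.
- exact: bezout_cert_neq0 cz.
- exact: bezout_cert_neq0 cc.
- exact: bezout_cert_neq0 dxy.
- exact: bezout_cert_neq0 dxz.
exact: bezout_cert_neq0 dyz.
Qed.

End SampleLine.

Lemma subst_bracket (S : comNzRingType) (g : {rmorphism rat -> S}) (q : 'I_8 -> 'rV[S]_3) :
  subst_points g q poly_bracket = bracket (q (inord 0)) (q (inord 1)) (q (inord 2)).
Proof. by rewrite /poly_bracket -bracket_map !subst_polypoint. Qed.

Section Divisors.
Variable W : 'rV[polyR]_3.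
Hypothesis defW : numerator polypoint = poly_bracket *: W.

Lemma subst_numerator (S : comNzRingType) (g : {rmorphism rat -> S}) (q : 'I_8 -> 'rV[S]_3) :
  numerator q = bracket (q (inord 0)) (q (inord 1)) (q (inord 2)) *:
    map_mx (subst_points g q) W.
Proof.
rewrite -(subst_bracket g) -map_mxZ -defW -numerator_map; apply: eq_numerator => i.
by rewrite subst_polypoint.
Qed.

(** Where d vanishes, W vanishes, and with it the numerator, a multiple of W. *)
Lemma subst_divisor_neq0 (S : comNzRingType) (g : {rmorphism rat -> S})
    (q : 'I_8 -> 'rV[S]_3) d :
  (forall j, divides d (W 0 j)) -> numerator q != 0 -> subst_points g q d != 0.
Proof.
move=> dW; apply: contra_neq => d0; rewrite (subst_numerator g).
suff -> : map_mx (subst_points g q) W = 0 by rewrite scaler0.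
apply/rowP => j; rewrite mxE [RHS]mxE; have [r ->] := dW j.
by rewrite rmorphM /= d0 mul0r.
Qed.

Section FourthPoint.
Variable L : numClosedFieldType.

Lemma zeval_constant (t : L) a : (size a <= 1)%N -> zeval t a = zeval 0 a.
Proof. by case: a => [|x [|]] //= _; rewrite !mulr0. Qed.

(** [sample_line] is a + t b. Its direction b is the fourth sample point, so the point at infinity
    of the line completes the other points to the generic sample. *)
Let a : 'rV[L]_3 := zrow 0 3 [:: [::]; [:: -2]; [:: -1]]%bZ.
Let b : 'rV[L]_3 := zrow 0 3 [:: [:: 1]; [:: 1]; [:: 1]]%bZ.

Lemma sample_lineE (t : L) :
  zconfig t sample_line =1 replace_point (inord 3) (zconfig 0 sample_config) (a + t *: b).
Proof.
have small : all (all (fun c => size c <= 1)%N) sample_config by [].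
move=> k; rewrite /replace_point /zconfig; have [->|k3] := eqVneq k (inord 3).
  rewrite (@inordK 7 3) //; apply/rowP; apply: ord3P; rewrite !mxE /= /zint; ring.
have {}k3 : (k != 3 :> nat) by apply: contraNneq k3 => k3; apply/eqP/val_inj; rewrite /= inordK.
apply/rowP => j; rewrite !mxE nth_set_nth /= (negbTE k3); apply: zeval_constant.
have [jk|jk] := ltnP j (size (nth [::] sample_config k)); last by rewrite nth_default.
have [ks|ks] := ltnP k (size sample_config); last by move: jk; rewrite (nth_default _ ks).
exact: (allP (allP small _ (mem_nth _ ks)) _ (mem_nth _ jk)).
Qed.

Lemma sample_configE :
  zconfig 0 sample_config =1 replace_point (inord 3) (zconfig (0 : L) sample_config) b.
Proof.
by move=> k; rewrite /replace_point; case: eqP => // ->; rewrite /zconfig inordK.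
Qed.

Lemma divisor_fourth_degree k d : (forall j, divides d (W 0 j)) ->
  homog_at (inord 3) k d -> k = 0%N.
Proof.
move=> dW hd; apply: (homog_at_line (q := zconfig (0 : L) sample_config) (a := a) (b := b) hd).
  apply: subst_divisor_neq0 => //; rewrite -(eq_numerator sample_configE).
  exact: numerator_neq0 (zgeneric_config _ sample_generic).
move=> t; apply: subst_divisor_neq0 => //; rewrite -(eq_numerator (sample_lineE t)).
exact: sample_line_numerator.
Qed.
End FourthPoint.
End Divisors.

Lemma ninth_formula_tofrac (W : 'rV[polyR]_3) (q : 'I_8 -> 'rV[polyR]_3) :
  numerator polypoint = poly_bracket *: W ->
  bracket (q (inord 0)) (q (inord 1)) (q (inord 2)) != 0 ->
  ninth_formula (fun i => map_mx (@tofrac polyR) (q i)) =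
    map_mx (@tofrac polyR) (map_mx (subst_points (@mpolyC _ rat) q) W).
Proof.
move=> defW b0; rewrite ninth_formulaE numerator_map bracket_map.
rewrite (subst_numerator defW (@mpolyC _ rat) q) map_mxZ scalerA mulVf ?scale1r //.
by rewrite tofrac_eq0.
Qed.

(** * Passing from the fourth point to all points *)

Section Relabelling.
Variable s : 'S_8.

Definition relabel : {rmorphism polyR -> polyR} :=
  subst_points (@mpolyC _ rat) (fun i => polypoint (s i)).

Lemma relabelX i j : relabel 'X_(mxvec_index i j) = 'X_(mxvec_index (s i) j).
Proof. by rewrite /relabel subst_pointsX mxE. Qed.

Lemma relabelC c : relabel c%:MP = c%:MP.
Proof. exact: subst_pointsC. Qed.

Lemma homog_at_relabel i k d : homog_at i k d -> homog_at (s i) k (relabel d).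
Proof.
move=> hd; pose f : {rmorphism polyR -> {poly polyR}} := map_poly relabel \o rescale i.
have E : rescale (s i) \o relabel =1 f.
  apply: polyR_morph_eq => [c|l j].
    by rewrite /f /= relabelC !rescaleC map_polyC /= relabelC.
  rewrite /f /= relabelX !rescaleX (inj_eq perm_inj) rmorphM /= map_polyC /= relabelX.
  by case: (l == i); rewrite ?map_polyX ?rmorph1.
by rewrite /homog_at -[LHS]/((rescale (s i) \o relabel) d) E /f /= hd map_polyZ map_polyXn.
Qed.

End Relabelling.

Section NinthPolynomial.
Variable W : 'rV[polyR]_3.
Hypothesis defW : numerator polypoint = poly_bracket *: W.

Lemma ninth_formula_generic (s : 'S_8) : ninth_formula (fun i => generic_point (s i)) =
  map_mx (@tofrac polyR) (map_mx (relabel s) W).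
Proof.
rewrite -(ninth_formula_tofrac defW (gen_bracket (polypoint_generic s))).
by apply: eq_ninth_formula => i; rewrite generic_pointE.
Qed.

Lemma relabel1 : map_mx (relabel 1%g) W = W.
Proof.
apply/rowP => j; rewrite mxE.
apply: (polyR_morph_eq (h := (idfun : {rmorphism polyR -> polyR}))) => [c|i l].
  exact: relabelC.
by rewrite relabelX perm1.
Qed.

Lemma ninth_formula_ninth : ninth_formula generic_point = map_mx (@tofrac polyR) W.
Proof.
rewrite -[in RHS]relabel1 -ninth_formula_generic.
by apply: eq_ninth_formula => i; rewrite perm1.
Qed.

Lemma ninth_formula_sym (s : 'S_8) :
  ninth_formula (fun i => generic_point (s i)) = ninth_formula generic_point \/
  ninth_formula (fun i => generic_point (s i)) = - ninth_formula generic_point.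
Proof.
have <- : ninth_formula (fun i => generic_point ((1 : 'S_8)%g i)) = ninth_formula generic_point.
  by apply: eq_ninth_formula => i; rewrite perm1.
exact: ninth_formula_perm generic_point_generic s.
Qed.

Lemma relabel_ninth (s : 'S_8) : map_mx (relabel s) W = W \/ map_mx (relabel s) W = - W.
Proof.
have tofracI : injective (map_mx (@tofrac polyR) : 'rV_3 -> 'rV_3).
  move=> u v /rowP e; apply/rowP => j; apply/eqP; rewrite -tofrac_eq; apply/eqP.
  by have := e j; rewrite mxE [RHS]mxE.
have := ninth_formula_sym s; rewrite ninth_formula_generic ninth_formula_ninth -map_mxN.
by case=> /tofracI ->; [left | right].
Qed.

Lemma ninth_neq0 : exists j, W 0 j != 0.
Proof.
apply/existsP; apply: contraT; rewrite negb_exists => /forallP W0.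
have [_ V0 _] := ninth_Cayley_Bacharach; move: V0; rewrite ninth_formula_ninth.
by case/eqP; apply/rowP => j; rewrite !mxE (eqP (negbNE (W0 j))) tofrac0.
Qed.

(** W is invariant up to sign, so relabelling preserves common divisors. *)
Lemma divides_relabel (s : 'S_8) d : (forall j, divides d (W 0 j)) ->
  forall j, divides (relabel s d) (W 0 j).
Proof.
move=> dW j; have [q E] := dW j.
have Ej : relabel s (W 0 j) = relabel s d * relabel s q by rewrite E rmorphM.
have [/rowP/(_ j)|/rowP/(_ j)] := relabel_ninth s; rewrite mxE Ej.
  by move=> <-; exists (relabel s q).
by rewrite mxE => e; exists (- relabel s q); rewrite mulrN e opprK.
Qed.

Lemma divisor_degree i k d : (forall j, divides d (W 0 j)) -> homog_at i k d -> k = 0%N.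
Proof.
move=> dW hd; pose s := tperm i (inord 3).
apply: (divisor_fourth_degree defW algC (divides_relabel s dW)).
by have := homog_at_relabel s hd; rewrite /s tpermL.
Qed.

(** Degree 0 in every point makes a common divisor constant; it is nonzero because W is, hence a
    unit. *)
Lemma ninth_gcd : is_gcd3 W 1.
Proof.
split=> [j|d dW]; first by exists (W 0 j); rewrite mul1r.
have [j Wj] := ninth_neq0.
have d0 i : homog_at i 0 d.
  have [k hd] := homog_at_divisor (homog_at_ninth i j defW) Wj (dW j).
  by rewrite -(divisor_degree dW hd).
have := homog_at0_constant d0; set c := d@_0 => dE; exists (c^-1)%:MP.
rewrite dE -mpolyCM mulfV //; apply: contraNneq Wj => c0.
by have [q ->] := dW j; rewrite dE c0 mul0r.
Qed.
End NinthPolynomial.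

Theorem corollary5 :
  is_Cayley_Bacharach_point generic_point (ninth_formula generic_point) /\
  exists W : 'rV[polyR]_3,
    [/\ ninth_formula generic_point = map_mx (@tofrac polyR) W,
        forall j, multihomogeneous (fun=> 8%N) (W 0 j),
        forall s : 'S_8,
          let V := ninth_formula generic_point in
          let Vs := ninth_formula (fun i => generic_point (s i)) in
          (Vs = V \/ Vs = - V) /\ (Vs == V)%MS
      & is_gcd3 W 1].
Proof.
split; first exact: ninth_Cayley_Bacharach.
have [W defW] := ninth_polynomial; exists W; split.
- exact: ninth_formula_ninth.
- by move=> j m mW i; apply: homog_at_weight (homog_at_ninth i j defW) mW.
- move=> s /=; have sV := ninth_formula_sym s; split; first exact: sV.
  by case: sV => ->; apply/eqmxP => //; apply: eqmx_opp.
exact: ninth_gcd.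
Qed.
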